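(* Let $T$ be a finite set, $S=\{x:T\to\mathbb N\cup\{0\}\}$, and let $A\subset S$ be a finite decreasing set containing a nonzero configuration. Let $\nu:T\to(0,\infty)$, let $\mathcal X=A$, and let $$\pi(x)=\frac1Z\prod_{i\in T}\frac{\nu(i)^{x(i)}}{x(i)!},\qquad x\in\mathcal X,$$ with $Z$ the normalization constant. Consider the rates $$Q(x,y)=\begin{cases}\nu(i)\mathbf 1_{\{x+\mathbf 1_i\in A\}}\,,&\text{if }y=x+\mathbf 1_i,\\ x(i)\mathbf 1_{\{x-\mathbf 1_i\in A\}}\,,&\text{if }y=x-\mathbf 1_i,\\ 0\,,&\text{else.}\end{cases}$$ Define $$\epsilon_0=\max_{x\in A,\ i\in T:\ x(i)>0}\ \sum_{j\ne i}\nu(j)\mathbf 1_{\{x+\mathbf 1_j-\mathbf 1_i\in A\}}\mathbf 1_{\{x+\mathbf 1_j\notin A\}},\qquad \epsilon_1=\min_{x\in A,\ i\in T:\ x(i)>0}\nu(i)\mathbf 1_{\{x+\mathbf 1_i\notin A\}}.$$ Assume that $\epsilon_0\le1$. Then $\mathrm{Ric}(\mathcal X,Q,\pi)\ge\frac12(1-\epsilon_0+\epsilon_1)$.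
   Context: $\mathbf 1_i\in S$ is the configuration equal to $1$ at $i$ and $0$ elsewhere. A set $A\subset S$ is decreasing if $x\in A$, $y\in S$ and $y(i)\le x(i)$ for all $i\in T$ imply $y\in A$. The dynamics is reversible w.r.t. $\pi$. Entropic Ricci curvature. Let $\mathcal X$ be a finite set, $Q:\mathcal X\times\mathcal X\to[0,\infty)$ irreducible transition rates with $Q(x,x)=0$, reversible with respect to the strictly positive probability measure $\pi$: $Q(x,y)\pi(x)=Q(y,x)\pi(y)$. Let $\mathscr P(\mathcal X)=\{\rho\in[0,\infty)^{\mathcal X}:\sum_x\rho(x)\pi(x)=1\}$ and $\theta(s,t)=\int_0^1 s^\alpha t^{1-\alpha}\,d\alpha$. For $\rho_0,\rho_1\in\mathscr P(\mathcal X)$ define $$\mathcal W(\rho_0,\rho_1)^2=\inf_{\rho,\psi}\ \frac12\int_0^1\sum_{x,y\in\mathcal X}(\psi_t(x)-\psi_t(y))^2\,\theta(\rho_t(x),\rho_t(y))\,Q(x,y)\pi(x)\,dt,$$ the infimum running over all sufficiently regular curves (say $\rho$ piecewise $C^1$, $\psi$ measurable) $\rho:[0,1]\to\mathscr P(\mathcal X)$, $\psi:[0,1]\to\mathbb R^{\mathcal X}$ with $\frac{d}{dt}\rho_t(x)+\sum_{y}(\psi_t(y)-\psi_t(x))\theta(\rho_t(x),\rho_t(y))Q(x,y)=0$ for all $x$, and with $\rho|_{t=0}=\rho_0$, $\rho|_{t=1}=\rho_1$. This is a distance. The entropy is $\mathcal H(\rho)=\sum_x\pi(x)\rho(x)\log\rho(x)$.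 A constant speed geodesic is a curve $(\rho_t)_{t\in[0,1]}$ in $\mathscr P(\mathcal X)$ with $\mathcal W(\rho_s,\rho_t)=|s-t|\mathcal W(\rho_0,\rho_1)$ for all $s,t$. One writes $\mathrm{Ric}(\mathcal X,Q,\pi)\ge\kappa$ if for every constant speed geodesic and all $t\in[0,1]$, $$\mathcal H(\rho_t)\le(1-t)\mathcal H(\rho_0)+t\mathcal H(\rho_1)-\frac\kappa2t(1-t)\mathcal W(\rho_0,\rho_1)^2.$$ *)

(* Defs.v *)
From HB Require Import structures.
From mathcomp Require Import all_boot all_order all_algebra finmap.
From mathcomp Require Import all_classical all_reals all_analysis.
Set Implicit Arguments.
Unset Strict Implicit.
Unset Printing Implicit Defensive.
Import Order.TTheory GRing.Theory Num.Theory.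
Import numFieldNormedType.Exports.
Local Open Scope classical_set_scope.
Local Open Scope ring_scope.

Section EntropicRicci.
Context {R : realType} {X : finType}.
Implicit Types (Q : X -> X -> R) (pi : X -> R).

Definition density pi (rho : X -> R) : Prop :=
  (forall x, 0 <= rho x) /\ \sum_x rho x * pi x = 1.

(* logarithmic mean *)
Definition theta (s t : R) : R :=
  \int[lebesgue_measure]_(a in `[0%R, 1%R]) (s `^ a * t `^ (1 - a)).

Definition C1 (g : R -> R) : Prop :=
  (forall t, derivable g t 1) /\ continuous (derive1 g).

(* The pieces are closed intervals, so [f] is continuous on [0, 1] and its
   derivative has one-sided limits at the breakpoints.  A function is C^1 up
   to the boundary of a piece iff it extends to a C^1 function on the line. *)
Definition piecewise_C1 (f : R -> R) : Prop :=
  exists s : seq R, [/\ path <%R 0 s, last 0 s = 1 &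
    forall k, (k < size s)%N -> exists2 g : R -> R, C1 g &
      {in `[nth 0 (0 :: s) k, nth 0 s k], f =1 g}].

(* Curves are functions on [R]; only their values on [0, 1] matter.  The
   continuity equation is required for almost every [t], which avoids the
   breakpoints of [rho], where the derivative need not exist. *)
Definition continuity_eq Q (rho psi : R -> X -> R) : Prop :=
  {ae lebesgue_measure, forall t : R, t \in `[0, 1] -> forall x,
    derive1 (fun u => rho u x) t
    + \sum_y (psi t y - psi t x) * theta (rho t x) (rho t y) * Q x y = 0}.

Definition admissible Q pi (rho0 rho1 : X -> R) (rho psi : R -> X -> R) : Prop :=
  [/\ (forall t : R, t \in `[0, 1] -> density pi (rho t))
      /\ (forall x, piecewise_C1 (fun t => rho t x)),
      forall x, measurable_fun `[0 : R, 1] (fun t => psi t x),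
      continuity_eq Q rho psi,
      rho 0 = rho0 & rho 1 = rho1].

Definition action Q pi (rho psi : R -> X -> R) : \bar R :=
  ((2^-1)%R%:E * \int[lebesgue_measure]_(t in `[0%R, 1%R])
    (\sum_x \sum_y (psi t x - psi t y) ^+ 2 * theta (rho t x) (rho t y)
                   * Q x y * pi x)%R%:E)%E.

(* Extended-real valued: the infimum is +oo when no curve has finite action. *)
Definition W Q pi (rho0 rho1 : X -> R) : \bar R :=
  sqrte (ereal_inf [set a | exists rho psi : R -> X -> R,
    admissible Q pi rho0 rho1 rho psi /\ a = action Q pi rho psi]).

(* [ln 0 = 0], hence the convention 0 log 0 = 0 *)
Definition entropy pi (rho : X -> R) : R := \sum_x pi x * rho x * ln (rho x).

Definition geodesic Q pi (rho : R -> X -> R) : Prop :=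
  (forall t : R, t \in `[0, 1] -> density pi (rho t)) /\
  (forall s t : R, s \in `[0, 1] -> t \in `[0, 1] ->
     W Q pi (rho s) (rho t) = (`|s - t|%R%:E * W Q pi (rho 0%R) (rho 1%R))%E).

Definition Ric_ge Q pi (kappa : R) : Prop :=
  forall rho : R -> X -> R, geodesic Q pi rho ->
  forall t : R, t \in `[0, 1] ->
  ((entropy pi (rho t))%:E <=
     ((1 - t) * entropy pi (rho 0) + t * entropy pi (rho 1))%R%:E
     - (kappa / 2 * t * (1 - t))%R%:E * W Q pi (rho 0%R) (rho 1%R) ^+ 2)%E.

End EntropicRicci.

Notation config T := {ffun T -> nat}.

Section Dynamics.
Context {R : realType} {T : finType}.
Implicit Types (A : {fset config T}) (nu : T -> R) (x y : config T) (i : T).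

Definition unit_config i : config T := [ffun j => nat_of_bool (j == i)].

Definition incr x i : config T := [ffun j => (x j + unit_config i j)%N].

(* [x - 1_i]; truncated subtraction, only meaningful when [0 < x i] *)
Definition decr x i : config T := [ffun j => (x j - unit_config i j)%N].

Definition decreasing A : Prop :=
  forall x y, x \in A -> (forall i, (y i <= x i)%N) -> y \in A.

Definition weight nu x : R := \prod_i (nu i ^+ x i / (x i)`!%:R).

Definition stat_measure A nu (x : A) : R :=
  weight nu (val x) / \sum_(z : A) weight nu (val z).

(* The index picked is unique, and the first two cases exclude each other. *)
Definition rate A nu (x y : A) : R :=
  if [pick i | val y == incr (val x) i] is Some i then
    nu i * (incr (val x) i \in A)%:R
  else if [pick i | (0 < val x i)%N && (val y == decr (val x) i)] is Some i then
    (val x i)%:R * (decr (val x) i \in A)%:R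
  else 0.

(* The maximum and minimum below are over a finite set, which is nonempty as
   soon as [A] contains a nonzero configuration; they are then attained, see
   [eps0_max] and [eps1_min]. *)
Definition eps0_term A nu x i : R :=
  \sum_(j | j != i)
    nu j * (decr (incr x j) i \in A)%:R * (incr x j \notin A)%:R.

Definition eps0 A nu : R :=
  sup [set r | exists x i, [/\ x \in A, (0 < x i)%N & r = eps0_term A nu x i]].

Definition eps1_term A nu x i : R := nu i * (incr x i \notin A)%:R.

Definition eps1 A nu : R :=
  inf [set r | exists x i, [/\ x \in A, (0 < x i)%N & r = eps1_term A nu x i]].

Lemma sup_attained A (F : config T -> T -> R) :
  (exists x i, x \in A /\ (0 < x i)%N) ->
  let E := [set r | exists x i, [/\ x \in A, (0 < x i)%N & r = F x i]] in
  E (sup E) /\ ubound E (sup E).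
Proof.
move=> [x0 [i0 [x0A x0i]]] E.
pose p0 : A * T := ([` x0A]%fset, i0).
pose P (p : A * T) := (0 < val p.1 p.2)%N.
have Pp0 : P p0 by [].
case: (@Order.TotalTheory.arg_maxP _ R _ p0 P (fun p => F (val p.1) p.2) Pp0).
move=> p Pp maxp; set m := F (val p.1) p.2 in maxp.
have Em : E m by exists (val p.1), p.2; split => //; exact: valP.
have um : ubound E m.
  by move=> _ [x [i [xA xi ->]]]; exact: (maxp ([` xA]%fset, i)).
have -> : sup E = m.
  apply/eqP; rewrite eq_le; apply/andP; split.
    by apply: ge_sup => //; exists m.
  by apply: ub_le_sup => //; exists m.
by split.
Qed.

Lemma eps0_max A nu :
  (exists x i, x \in A /\ (0 < x i)%N) ->
  (exists x i, [/\ x \in A, (0 < x i)%N & eps0 A nu = eps0_term A nu x i]) /\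
  (forall x i, x \in A -> (0 < x i)%N -> eps0_term A nu x i <= eps0 A nu).
Proof.
move=> /(@sup_attained A (eps0_term A nu)) [h1 h2]; split; first exact: h1.
by move=> x i xA xi; apply: h2; exists x, i.
Qed.

Lemma eps1_min A nu :
  (exists x i, x \in A /\ (0 < x i)%N) ->
  (exists x i, [/\ x \in A, (0 < x i)%N & eps1 A nu = eps1_term A nu x i]) /\
  (forall x i, x \in A -> (0 < x i)%N -> eps1 A nu <= eps1_term A nu x i).
Proof.
move=> /(@sup_attained A (fun x i => - eps1_term A nu x i)) /=.
set E := (X in sup X).
have -> : eps1 A nu = - sup E.
  rewrite /eps1 /inf; congr (- sup _); apply/seteqP; split => r /=.
    by move=> [_ [x [i [xA xi ->]]] <-]; exists x, i.
  by move=> [x [i [xA xi ->]]]; exists (eps1_term A nu x i) => //; exists x, i.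
move=> [[x [i [xA xi e]]] h2]; split; first by exists x, i; rewrite e opprK.
by move=> y j yA yj; rewrite lerNl; apply: h2; exists y, j.
Qed.

End Dynamics.

(* Main.v *)
Require Import Defs.
From HB Require Import structures.
From mathcomp Require Import all_boot all_order all_algebra finmap.
From mathcomp Require Import all_classical all_reals all_analysis.
From mathcomp Require Import measurable_realfun ring lra.
Set Implicit Arguments.
Unset Strict Implicit.
Unset Printing Implicit Defensive.
Import Order.TTheory GRing.Theory Num.Theory.
Import numFieldNormedType.Exports.
Local Open Scope classical_set_scope.
Local Open Scope ring_scope.

(* The logarithmic mean makes [K(rho) psi (x) = sum_y (psi x - psi y) theta Q]
   satisfy [K(rho) ln rho = - L rho] with [L] the generator, so the heat flow
   is the gradient flow of the entropy.  Coupling the jumps from the ends of an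
   edge (x, x + 1_i) of the chain bounds from below, by [kappa] times the
   action, the form that controls the contraction of [<K(rho) psi, psi>] under
   the heat semigroup [P_t].  By duality the squared speed
   [<K(rho)^-1 f, f>] of a curve decays like [exp (- 2 kappa t)] under [P_t];
   its dual form, [2 <f, phi> - <K(rho) phi, phi> <= c] for all [phi], makes
   sense also where [rho] vanishes, as geodesics may touch the boundary.
   Running [P] along a curve for a time proportional to the parameter costs, by
   completing the square, only the entropy difference of the ends.
   For a geodesic [G] with squared length [D] and [0 < t < 1], apply this on
   [0, t] and, backwards, on [t, 1], with times growing from 0 to h at [G t]:
   gluing the two curves at [P_h (G t)] gives a curve from [G 0] to [G 1] whose
   action is at least [D], which to first order in [h] reads
   [kappa D <= 2 (H (G 0) / t + H (G 1) / (1 - t) - H (G t) / (t (1 - t)))]. *)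

(** A geodesic is given here only through its distances: it has no velocity, and the infimum in [W]
    need not be attained. It is therefore sampled at N + 1 equidistant times, consecutive samples
    are joined by nearly optimal admissible curves, and these are smoothed by the heat flow for a
    positive time, which makes densities positive and the equation for the potential solvable. The
    decay of the action is collected only at the grid nodes; inside a grid step the factor is
    bounded by 1, which uses [0 <= kappa]. Since the flow time grows linearly from 0 to h, the
    average decay is 1 - kappa h + O(h^2). In the coupling, jumps that carry an edge to another edge
    leave flux terms which cancel in the sum over the chain. Curvature comes only from jumps that
    bring both ends of an edge together; these occur at total rate at least 1 - eps0 + eps1. Such a
    jump removes the gradient a, which gains a^2 theta, while the change of theta can cost up to
    half of that. The surviving half is the factor 1/2 of the theorem. *)

Section RealCalculus.
Context {R : realType}.
Implicit Types (f g : R -> R) (t d e : R).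

Lemma is_deriveDf f g t d e : is_derive t 1 f d -> is_derive t 1 g e ->
  is_derive t 1 (fun u => f u + g u) (d + e).
Proof. by move=> fd gd; exact: is_deriveD. Qed.

Lemma is_deriveNf f t d : is_derive t 1 f d ->
  is_derive t 1 (fun u => - f u) (- d).
Proof. by move=> fd; exact: is_deriveN. Qed.

Lemma is_deriveBf f g t d e : is_derive t 1 f d -> is_derive t 1 g e ->
  is_derive t 1 (fun u => f u - g u) (d - e).
Proof. by move=> fd gd; apply: is_deriveDf => //; exact: is_deriveNf. Qed.

Lemma is_deriveMf f g t d e : is_derive t 1 f d -> is_derive t 1 g e ->
  is_derive t 1 (fun u => f u * g u) (d * g t + f t * e).
Proof.
move=> fd gd; have h := @is_deriveM _ _ f g t 1 d e fd gd.
by apply: is_derive_eq; rewrite addrC [d * _]mulrC.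
Qed.

Lemma is_deriveCf (c : R) t : is_derive t 1 (fun=> c) 0.
Proof. exact: is_derive_cst. Qed.

Lemma is_deriveZf (c : R) f t d : is_derive t 1 f d ->
  is_derive t 1 (fun u => c * f u) (c * d).
Proof.
move=> fd; have h := is_deriveMf (is_deriveCf c t) fd.
by apply: is_derive_eq; rewrite mul0r add0r.
Qed.

Lemma is_derive_bigsum (I : finType) (P : pred I) (F : I -> R -> R)
    (D : I -> R) t :
  (forall i, P i -> is_derive t 1 (F i) (D i)) ->
  is_derive t 1 (fun u => \sum_(i | P i) F i u) (\sum_(i | P i) D i).
Proof.
move=> FD; elim: (index_enum I) => [|i r IH].
  rewrite big_nil (_ : (fun u => _) = (fun=> 0)); first exact: is_deriveCf.
  by apply/funext => u; rewrite big_nil.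
rewrite big_cons (_ : (fun u => _) = (fun u =>
    if P i then F i u + \sum_(j <- r | P j) F j u else \sum_(j <- r | P j) F j u)).
  by case: ifP => // /FD Fi; exact: is_deriveDf.
by apply/funext => u; rewrite big_cons.
Qed.

Lemma is_derive_compf f g t d e : is_derive (g t) 1 f d -> is_derive t 1 g e ->
  is_derive t 1 (fun u => f (g u)) (d * e).
Proof. by move=> fd gd; exact: is_derive1_comp. Qed.

Lemma is_derive_lnf f t d : 0 < f t -> is_derive t 1 f d ->
  is_derive t 1 (fun u => ln (f u)) (d / f t).
Proof.
move=> ft fd; have h := is_derive_compf (is_derive1_ln ft) fd.
by apply: is_derive_eq; rewrite mulrC.
Qed.

Lemma is_derive_expRf f t d : is_derive t 1 f d ->
  is_derive t 1 (fun u => expR (f u)) (d * expR (f t)).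
Proof.
move=> fd; have h := is_derive_compf (is_derive_expR (f t)) fd.
by apply: is_derive_eq; rewrite mulrC.
Qed.

Lemma is_derive_affine (a b t : R) : is_derive t 1 (fun u => a * u + b) a.
Proof.
have h := is_deriveDf (is_deriveZf a (is_derive_id t 1)) (is_deriveCf b t).
by apply: is_derive_eq; rewrite mulr1 addr0.
Qed.

Lemma is_derive_expRM (c t : R) :
  is_derive t 1 (fun u => expR (c * u)) (c * expR (c * t)).
Proof.
have h := is_derive_expRf (is_deriveZf c (is_derive_id t 1)).
by apply: is_derive_eq; rewrite mulr1.
Qed.

Lemma is_derive_continuous f t d : is_derive t 1 f d -> {for t, continuous f}.
Proof.
by move=> fd; apply/differentiable_continuous/derivable1_diffP; exact: ex_derive.
Qed.

Lemma is_derive_unique f t d e : is_derive t 1 f d -> is_derive t 1 f e -> d = e.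
Proof. by move=> fd fe; rewrite -(@derive_val _ _ _ _ _ _ _ fd) derive_val. Qed.

Lemma is_derive_ge0_le f (f' : R -> R) a b : a <= b ->
  {within `[a, b], continuous f} ->
  (forall t, a < t < b -> is_derive t 1 f (f' t)) ->
  (forall t, a < t < b -> 0 <= f' t) -> f a <= f b.
Proof.
move=> ab fc fd f'0.
have [->//|anb] := eqVneq a b.
have {anb}ab' : a < b by rewrite lt_neqAle anb.
have fd' t : t \in `]a, b[ -> is_derive t 1 f (f' t) by rewrite in_itv/= => /fd.
have [c cab] := @MVT _ f f' a b ab' fd' fc.
move/eqP; rewrite subr_eq => /eqP ->; rewrite lerDr mulr_ge0 ?subr_ge0 //.
by apply: f'0; move: cab; rewrite in_itv.
Qed.

Lemma is_derive_ge0_nondecreasing f (f' : R -> R) a b : a <= b ->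
  (forall t, a <= t <= b -> is_derive t 1 f (f' t)) ->
  (forall t, a <= t <= b -> 0 <= f' t) -> f a <= f b.
Proof.
move=> ab fd f'0.
have w t : a < t < b -> a <= t <= b by move=> /andP[/ltW -> /ltW ->].
apply: (is_derive_ge0_le ab _ (fun t h => fd t (w t h))) => [|t /w]; last exact: f'0.
by apply: derivable_within_continuous => t; rewrite in_itv/= => /fd h; exact: ex_derive.
Qed.

Lemma is_derive_0_constant f a b :
  (forall t, is_derive t 1 f 0) -> f a = f b.
Proof.
move=> fd; have H c d : c <= d -> f c = f d.
  move=> cd; apply/eqP; rewrite eq_le.
  rewrite (is_derive_ge0_nondecreasing cd (fun t _ => fd t))//=.
  rewrite -lerN2 (is_derive_ge0_nondecreasing cd (fun t _ => is_deriveNf (fd t)))//.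
by have [/H|/ltW/H ->] := leP a b.
Qed.

End RealCalculus.

(** * The logarithmic mean: derivative, homogeneity, concavity *)

Section LogarithmicMean.
Context {R : realType}.
Local Notation mu := (@lebesgue_measure R).
Implicit Types (s t u : R).

Lemma continuous_integrable_segment (f : R -> R) (a b : R) : continuous f ->
  mu.-integrable `[a, b] (EFin \o f).
Proof.
move=> cf; apply: continuous_compact_integrable; first exact: segment_compact.
exact: continuous_subspaceT.
Qed.

(** This is (e^u - 1)/u. The integral form is smooth across u = 0, so the case s = t of the
    logarithmic mean needs no separate treatment. *)
Definition expmean u := \int[mu]_(a in `[0%R, 1%R]) expR (a * u).

Definition dexpmean u := \int[mu]_(a in `[0%R, 1%R]) (a * expR (a * u)).

Lemma continuous_expRM u : continuous (fun a : R => expR (a * u)).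
Proof.
rewrite (_ : (fun a => _) = fun a => expR (u * a)).
  by move=> a; exact: is_derive_continuous (is_derive_expRM u a).
by apply/funext => a; rewrite mulrC.
Qed.

Lemma continuous_MexpRM u : continuous (fun a : R => a * expR (a * u)).
Proof. by move=> a; apply: cvgM; [exact: cvg_id|exact: continuous_expRM]. Qed.

(** Differentiation under the integral sign on (u - 1, u + 1), where the derivative of the integrand
    is dominated by the constant e^(|u| + 1). *)
Lemma is_derive_expmean u : is_derive u 1 expmean (dexpmean u).
Proof.
have dE (a v : R) := is_derive_expRM a v.

have uI : `]u - 1, u + 1[%classic u by rewrite /= in_itv/=; apply/andP; split; lra.
have i1 (x : R) : `]u - 1, u + 1[%classic x ->
    mu.-integrable `[0%R, 1%R] (EFin \o (fun a : R => expR (a * x))).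
  by move=> _; apply: continuous_integrable_segment; exact: continuous_expRM.
have i2 (x y : R) : `]u - 1, u + 1[%classic x -> `[0%R, 1%R]%classic y ->
   derivable ((fun v a : R => expR (a * v))^~ y) x 1.
  by move=> _ _; have h := dE y x; exact: ex_derive.
have p1 x y : partial1of2 (fun v a : R => expR (a * v)) x y = y * expR (y * x).
  by rewrite partial1of2E; have h := dE y x; rewrite derive_val.
have g0 (y : R) : `[0%R, 1%R]%classic y -> 0 <= expR (`|u| + 1) by move=> _; exact: expR_ge0.
have i3 : mu.-integrable `[0%R, 1%R] (EFin \o (fun _ : R => expR (`|u| + 1))).
  by apply: continuous_integrable_segment => x; exact: cvg_cst.
have i4 (x y : R) : `]u - 1, u + 1[%classic x -> `[0%R, 1%R]%classic y ->
   `|partial1of2 (fun v a : R => expR (a * v)) x y| <= expR (`|u| + 1).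
  rewrite p1 /= !in_itv/= => /andP[x1 x2] /andP[y0 y1].
  rewrite ger0_norm ?mulr_ge0 ?expR_ge0// -[leRHS]mul1r ler_pM ?expR_ge0// ler_expR.
  have yx : y * x <= `|x|.
    by rewrite (le_trans (ler_norm _))// normrM (ger0_norm y0) ler_piMl.
  rewrite (le_trans yx)// ler_norml; apply/andP; split.
    by have := ler_norm (- u); rewrite normrN; lra.
  by have := ler_norm u; lra.
have d1 := @derivable_under_integral R _ _ mu _ _ (measurable_itv _) _ _ _ uI i1 i2 _ (fun=> expR_ge0 (`|u| + 1)) i3 i4.
have d2 := @differentiation_under_integral R _ _ mu _ _ (measurable_itv _) _ _ _ uI i1 i2 _ (fun=> expR_ge0 (`|u| + 1)) i3 i4.
apply: DeriveDef; first exact: d1.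
rewrite -derive1E d2; apply: eq_Rintegral => a _; exact: p1.
Qed.

Lemma expmean_gt0 u : 0 < expmean u.
Proof.
have : \int[mu]_(a in `[0%R, 1%R]) expR (- `|u|) <= expmean u.
  apply: le_Rintegral => //.
  - by apply: continuous_integrable_segment => x; exact: cvg_cst.
  - by apply: continuous_integrable_segment; exact: continuous_expRM.
  move=> a /=; rewrite in_itv/= ler_expR => /andP[a0 a1].
  rewrite lerNl (le_trans (ler_norm _))// normrN normrM (ger0_norm a0).
  by rewrite ler_piMl.
rewrite Rintegral_cst//= lebesgue_measure_itv/= lte_fin ltr01/= subr0 mulr1.
exact/lt_le_trans/expR_gt0.
Qed.

Lemma expmeanN u : expmean u = expR u * expmean (- u).
Proof.
rewrite /expmean -RintegralZl//; last first.
  by apply: continuous_integrable_segment; exact: continuous_expRM.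
rewrite Rintegration_by_substitution_onem ?lexx ?ler01//; last first.
  by apply: continuous_subspaceT; exact: continuous_expRM.
rewrite /unstable.onem subrr; apply: eq_Rintegral => a _.
by rewrite -expRD; congr expR; ring.
Qed.

(** Both sides of [expmeanN] are differentiated and the two derivatives compared, which saves a
    second change of variables. *)
Lemma dexpmeanN u : expR u * dexpmean (- u) = expmean u - dexpmean u.
Proof.
have h1 : is_derive u 1 (fun v => expR v * expmean (- v))
    (expR u * expmean (- u) + expR u * (dexpmean (- u) * - 1)).
  apply: (is_deriveMf (is_derive_expR u)).
  exact: is_derive_compf (is_derive_expmean _) (is_deriveNf (is_derive_id _ _)).
have h2 := is_derive_expmean u.
have : expmean = fun v => expR v * expmean (- v) by apply/funext => v; exact: expmeanN.
move=> E; rewrite -E in h1; have := is_derive_unique h2 h1.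
by rewrite -expmeanN => ->; ring.
Qed.

Lemma thetaE s t : 0 < s -> 0 < t -> theta s t = t * expmean (ln s - ln t).
Proof.
move=> s0 t0; rewrite /theta /expmean -RintegralZl//; last first.
  by apply: continuous_integrable_segment; exact: continuous_expRM.
apply: eq_Rintegral => a _; rewrite /powR !gt_eqF// -expRD -[t in RHS]lnK ?posrE//.
by rewrite -expRD expRK; congr expR; ring.
Qed.

Lemma theta0l t : theta 0 t = 0.
Proof.
(* The endpoint a = 0 is left out, because 0 to the power 0 is 1; it is restored as a null set. *)
have e : {in `]0%R, 1%R]%classic, (fun a : R => 0 `^ a * t `^ (1 - a)) =1 cst 0}.
  move=> a; rewrite inE/= in_itv/= => /andP[a0 _].
  by rewrite powR0 ?gt_eqF// mul0r.
have h : mu.-integrable `]0%R, 1%R] (EFin \o (fun a : R => 0 `^ a * t `^ (1 - a))).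
  apply: (eq_integrable _ (EFin \o cst 0)) => //; last exact: integrable0.
  by move=> a ai /=; rewrite e.
rewrite /theta -(Rintegral_itv_obnd_cbnd h).
transitivity (\int[mu]_(x in `]0%R, 1%R]) (0 : R)); first exact: eq_Rintegral.
by rewrite Rintegral_cst// mul0r.
Qed.

Lemma theta0r s : theta s 0 = 0.
Proof.
have e : {in `[0%R, 1%R[%classic, (fun a : R => s `^ a * 0 `^ (1 - a)) =1 cst 0}.
  move=> a; rewrite inE/= in_itv/= => /andP[_ a1].
  by rewrite (powR0 (x := 1 - a)) ?mulr0// gt_eqF// subr_gt0.
have h : mu.-integrable `[0%R, 1%R[ (EFin \o (fun a : R => s `^ a * 0 `^ (1 - a))).
  apply: (eq_integrable _ (EFin \o cst 0)) => //; last exact: integrable0.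
  by move=> a ai /=; rewrite e.
rewrite /theta -(Rintegral_itv_bndo_bndc h).
transitivity (\int[mu]_(x in `[0%R, 1%R[) (0 : R)); first exact: eq_Rintegral.
by rewrite Rintegral_cst// mul0r.
Qed.

Lemma thetaC s t : 0 <= s -> 0 <= t -> theta s t = theta t s.
Proof.
rewrite le_eqVlt => /predU1P[<-|s0]; first by rewrite theta0l theta0r.
rewrite le_eqVlt => /predU1P[<-|t0]; first by rewrite theta0l theta0r.
rewrite (thetaE s0 t0) (thetaE t0 s0) expmeanN opprB mulrA expRB.
rewrite lnK ?posrE// lnK ?posrE//.
by congr (_ * _); rewrite mulrCA divff ?gt_eqF// mulr1.
Qed.

Lemma theta_gt0 s t : 0 < s -> 0 < t -> 0 < theta s t.
Proof. by move=> s0 t0; rewrite thetaE// mulr_gt0// expmean_gt0. Qed.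

Lemma theta_ge0 s t : 0 <= s -> 0 <= t -> 0 <= theta s t.
Proof.
rewrite le_eqVlt => /predU1P[<-|s0]; first by rewrite theta0l.
rewrite le_eqVlt => /predU1P[<-|t0]; first by rewrite theta0r.
exact/ltW/theta_gt0.
Qed.

(* The first partial derivative of [theta]. *)
Definition dtheta s t := t * dexpmean (ln s - ln t) / s.

Lemma dthetaC s t : 0 < s -> 0 < t ->
  dtheta t s = expmean (ln s - ln t) - dexpmean (ln s - ln t).
Proof.
move=> s0 t0; rewrite -dexpmeanN opprB expRB ?lnK ?posrE// /dtheta.
by rewrite mulrAC.
Qed.

Lemma is_derive_theta (f g : R -> R) u (d e : R) : 0 < f u -> 0 < g u ->
  is_derive u 1 f d -> is_derive u 1 g e ->
  is_derive u 1 (fun v => theta (f v) (g v))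
    (dtheta (f u) (g u) * d + dtheta (g u) (f u) * e).
Proof.
move=> fu gu fd gd.
have h : is_derive u 1 (fun v => g v * expmean (ln (f v) - ln (g v)))
    (e * expmean (ln (f u) - ln (g u)) +
     g u * (dexpmean (ln (f u) - ln (g u)) * (d / f u - e / g u))).
  apply: is_deriveMf => //; apply: is_derive_compf; first exact: is_derive_expmean.
  by apply: is_deriveBf; exact: is_derive_lnf.
apply: (@near_eq_is_derive _ _ _ (fun v => g v * expmean (ln (f v) - ln (g v)))).
  have nf := cvgr_gt (f u) (is_derive_continuous fd) _ fu.
  have ng := cvgr_gt (g u) (is_derive_continuous gd) _ gu.
  near=> v; rewrite thetaE//; first by near: v; exact: nf.
  by near: v; exact: ng.
apply: is_derive_eq; rewrite (dthetaC fu gu) /dtheta.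
have f0 : f u != 0 by rewrite gt_eqF.
have g0 : g u != 0 by rewrite gt_eqF.
by field; rewrite f0 g0.
Unshelve. all: by end_near. Qed.

(** Euler's relation for a 1-homogeneous function: the tangent planes of [theta] have no constant
    term. *)
Lemma theta_euler s t : 0 < s -> 0 < t ->
  dtheta s t * s + dtheta t s * t = theta s t.
Proof.
move=> s0 t0; rewrite (dthetaC s0 t0) thetaE// /dtheta.
have f0 : s != 0 by rewrite gt_eqF.
by field; rewrite f0.
Qed.

(* Concavity and [1]-homogeneity, via the weighted AM-GM inequality under the
   integral sign. *)
Lemma theta_tangent s t s' t' : 0 < s -> 0 < t -> 0 < s' -> 0 < t' ->
  theta s' t' <= dtheta s t * s' + dtheta t s * t'.
Proof.
move=> s0 t0 s'0 t'0; rewrite (dthetaC s0 t0) /dtheta thetaE//.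
set w := ln s - ln t; set w' := ln s' - ln t'.
have I1 v := @continuous_integrable_segment _ 0 1 (@continuous_expRM v).
have I2 v := @continuous_integrable_segment _ 0 1 (@continuous_MexpRM v).
have IZ (c : R) (f : R -> R) : mu.-integrable `[0%R, 1%R] (EFin \o f) ->
    mu.-integrable `[0%R, 1%R] (EFin \o (fun a => c * f a)).
  by move=> If; apply: (integrableZl _ c If).
have ID (f g : R -> R) : mu.-integrable `[0%R, 1%R] (EFin \o f) ->
    mu.-integrable `[0%R, 1%R] (EFin \o g) ->
    mu.-integrable `[0%R, 1%R] (EFin \o (fun a => f a + g a)).
  by move=> If Ig; apply: (integrableD _ If Ig).
have -> : t * dexpmean w / s * s' + (expmean w - dexpmean w) * t' =
  \int[mu]_(a in `[0%R, 1%R])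
    ((t * s' / s - t') * (a * expR (a * w)) + t' * expR (a * w)).
  rewrite RintegralD// ?RintegralZl//; [|exact: IZ..].
  by rewrite -/(dexpmean w) -/(expmean w); ring.
rewrite /expmean -RintegralZl//; apply: le_Rintegral => //.
- exact: IZ.
- by apply: ID; exact: IZ.
move=> a /=; rewrite in_itv/= => /andP[a0 a1].
(* e^z is the weighted geometric mean of s'/s and t'/t, and by [e1] it is the ratio of the two
   integrands. [H] is the tangent line of exp at z; with the weights a and 1 - a its linear terms
   cancel, which gives the weighted AM-GM inequality. *)
pose z := a * (ln s' - ln s) + (1 - a) * (ln t' - ln t).
have e1 : t' * expR (a * w') = t * expR (a * w) * expR z.
  rewrite -[t' in LHS]lnK ?posrE// -[t in RHS]lnK ?posrE// -!expRD.
  by congr expR; rewrite /w /w' /z; ring.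
have H (x y : R) : 0 < x -> 0 < y -> expR z * (1 + (ln y - ln x - z)) <= y / x.
  move=> x0 y0; rewrite -[y / x]lnK ?posrE ?divr_gt0//.
  have -> : ln (y / x) = z + (ln y - ln x - z) by rewrite ln_div ?posrE//; ring.
  by rewrite [leRHS]expRD ler_pM2l ?expR_gt0// expR_ge1Dx.
have Hs := ler_wpM2l a0 (H _ _ s0 s'0).
have a1' : 0 <= 1 - a by rewrite subr_ge0.
have Ht := ler_wpM2l a1' (H _ _ t0 t'0).
rewrite e1.
have -> : (t * s' / s - t') * (a * expR (a * w)) + t' * expR (a * w)
   = t * expR (a * w) * (a * (s' / s) + (1 - a) * (t' / t)).
  have t1 : t != 0 by rewrite gt_eqF.
  have s1 : s != 0 by rewrite gt_eqF.
  by field; rewrite ?t1 ?s1.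
rewrite ler_pM2l ?mulr_gt0 ?expR_gt0//.
apply: le_trans (lerD Hs Ht).
set E := expR z.
have -> : a * (E * (1 + (ln s' - ln s - z))) + (1 - a) * (E * (1 + (ln t' - ln t - z)))
  = E * (1 + (a * (ln s' - ln s) + (1 - a) * (ln t' - ln t) - z)) by ring.
by rewrite -/z subrr addr0 mulr1.
Qed.

(** In the variable a, w e^(a w) is the derivative of e^(a w), so w times [expmean w] is e^w - 1;
    this includes w = 0. *)
Lemma theta_ln s t : 0 < s -> 0 < t -> theta s t * (ln s - ln t) = s - t.
Proof.
move=> s0 t0; rewrite thetaE//; set w := ln s - ln t.
have -> : s - t = t * (expR w - 1).
  rewrite expRB ?lnK ?posrE//.
  have t1 : t != 0 by rewrite gt_eqF.
  by field; rewrite t1.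
rewrite -mulrA; congr (_ * _).
have ab : (0 < 1 :> R) by [].
have d (a : R) : is_derive a 1 (fun a => expR (a * w)) (w * expR (a * w)).
  have := is_derive_expRM w a; rewrite (_ : (fun u => _) = fun u => expR (u * w)); first by rewrite [a * w]mulrC.
  by apply/funext => x; rewrite mulrC.
have := @continuous_FTC2 R (fun a => w * expR (a * w)) (fun a => expR (a * w)) 0 1 ab.
rewrite mul1r mul0r expR0 => H.
rewrite mulrC /expmean -RintegralZl//; last first.
  by apply: continuous_integrable_segment; exact: continuous_expRM.
rewrite /Rintegral H//.
- apply: continuous_subspaceT => a; apply: cvgM; first exact: cvg_cst.
  exact: continuous_expRM.
- split.
  + by move=> a _; have h := d a; exact: ex_derive.
  + by apply: cvg_at_right_filter; exact: continuous_expRM.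
  + by apply: cvg_at_left_filter; exact: continuous_expRM.
- by move=> a _; have h := d a; rewrite derive1E derive_val.
Qed.

End LogarithmicMean.

(** * Reversible chains and their heat semigroup *)

Record reversible_chain {R : realType} {X : finType} (Q : X -> X -> R)
    (pi : X -> R) : Prop := ReversibleChain {
  rate_ge0 : forall x y, 0 <= Q x y;
  stat_gt0 : forall x, 0 < pi x;
  stat_sum1 : \sum_x pi x = 1;
  detailed_balance : forall x y, Q x y * pi x = Q y x * pi y;
  irreducible : forall x y, connect [rel a b | 0 < Q a b] x y }.

Section HeatSemigroup.
Context {R : realType} {X : finType} (Q : X -> X -> R) (pi : X -> R).
Context (QP : reversible_chain Q pi).
Implicit Types (f g : X -> R) (s t : R) (x y z : X).

Definition lap f x := \sum_y Q x y * (f y - f x).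

Definition ip f g := \sum_x f x * g x * pi x.

(** The summand 1 makes this number positive and strictly larger than every exit rate, so that
    [jump_kernel] has a positive diagonal. *)
Definition unif_rate := 1 + \sum_x \sum_y Q x y.
Local Notation l := unif_rate.

Lemma unif_rate_gt0 : 0 < l.
Proof.
rewrite ltr_pwDl// sumr_ge0// => x _; rewrite sumr_ge0// => y _.
exact: rate_ge0 QP _ _.
Qed.

(* Uniformization: [lap = l (jump_kernel - 1)] with a stochastic kernel. *)
Definition jump_kernel x y := Q x y / l + (y == x)%:R * (1 - (\sum_z Q x z) / l).

Lemma jump_diag_gt0 x : 0 < 1 - (\sum_z Q x z) / l.
Proof.
rewrite subr_gt0 ltr_pdivrMr ?unif_rate_gt0// mul1r /unif_rate.
rewrite [X in _ < _ + X](bigD1 x)//= ltr_pwDl// lerDl sumr_ge0// => y _.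
by rewrite sumr_ge0// => z _; exact: rate_ge0 QP _ _.
Qed.

Lemma jump_kernel_ge0 x y : 0 <= jump_kernel x y.
Proof.
rewrite addr_ge0 ?mulr_ge0 ?invr_ge0 ?(rate_ge0 QP)// ?ltW ?jump_diag_gt0//.
exact: unif_rate_gt0.
Qed.

Lemma sum_jump_kernel x : \sum_y jump_kernel x y = 1.
Proof.
rewrite big_split/= -mulr_suml -mulr_suml.
have -> : \sum_y ((y == x)%:R : R) = 1.
  by rewrite (bigD1 x)//= eqxx big1 ?addr0// => y /negPf->.
by rewrite mul1r addrC subrK.
Qed.

Definition jump f x := \sum_y jump_kernel x y * f y.

Lemma jumpE f x : l * (jump f x - f x) = lap f x.
Proof.
have l0 : l != 0 by rewrite gt_eqF// unif_rate_gt0.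
have -> : jump f x - f x = \sum_y Q x y / l * (f y - f x).
  rewrite -[f x in LHS]mul1r -{1}(sum_jump_kernel x) mulr_suml -sumrB.
  apply: eq_bigr => y _; rewrite -mulrBr /jump_kernel mulrDl.
  by case: eqP => [->|_]; rewrite ?subrr ?mulr0 ?mul0r// addr0.
by rewrite mulr_sumr; apply: eq_bigr => y _; field.
Qed.

Definition delta y x : R := (x == y)%:R.

Lemma sum_delta f x : \sum_y f y * delta y x = f x.
Proof.
rewrite (bigD1 x)//= /delta eqxx mulr1 big1 ?addr0// => y yx.
by rewrite eq_sym (negPf yx) mulr0.
Qed.

Lemma iter_jumpE n f x : iter n jump f x = \sum_y f y * iter n jump (delta y) x.
Proof.
elim: n f x => [|n IH] f x; first by rewrite /= sum_delta.
rewrite /= {1}/jump.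
under [LHS]eq_bigr do rewrite IH mulr_sumr.
rewrite exchange_big/=; apply: eq_bigr => y _; rewrite /jump mulr_sumr.
by apply: eq_bigr => z _; rewrite mulrCA.
Qed.

Lemma iter_jump_le n f x : `|iter n jump f x| <= \sum_y `|f y|.
Proof.
elim: n x => [|n IH] x /=.
  by rewrite (bigD1 x)//= lerDl sumr_ge0.
rewrite /jump (le_trans (ler_norm_sum _ _ _))//.
rewrite -[leRHS]mul1r -(sum_jump_kernel x) mulr_suml ler_sum// => y _.
by rewrite normrM ger0_norm ?jump_kernel_ge0// ler_wpM2l// jump_kernel_ge0.
Qed.

(** Coefficients of the exponential series of l t J, with J the jump operator. For f >= 0 they are
    nonnegative, so positivity of the flow can be read off term by term; the series of e^(t lap)
    would not show it. *)
Definition heat_coef f x (n : nat) := l ^+ n / n`!%:R * iter n jump f x.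

Lemma is_cvg_heat_coef f x t : cvgn (pseries (heat_coef f x) t).
Proof.
apply: normed_cvg.
apply: (@series_le_cvg R _ (fun n => exp_coeff (l * `|t|) n * \sum_y `|f y|)) => [n|n|n|].
- exact: normr_ge0.
- rewrite mulr_ge0 ?sumr_ge0// exp_coeff_ge0// mulr_ge0//.
  exact/ltW/unif_rate_gt0.
- have c0 : 0 <= l ^+ n / n`!%:R.
    by rewrite mulr_ge0// ?invr_ge0 ?exprn_ge0// ltW// unif_rate_gt0.
  rewrite /= /heat_coef normrM normrX normrM (ger0_norm c0) /exp_coeff /= exprMn.
  rewrite [leRHS](_ : _ = l ^+ n / n`!%:R * (\sum_y `|f y|) * `|t| ^+ n); last by ring.
  by rewrite ler_wpM2r ?exprn_ge0// ler_wpM2l// iter_jump_le.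
- rewrite (_ : series _ = (fun n => series (exp_coeff (l * `|t|)) n * \sum_y `|f y|)).
    by apply: is_cvgMr_tmp; exact: is_cvg_series_exp_coeff.
  by apply/funext => n; rewrite /series/= mulr_suml.
Qed.

Definition heat_sum t f x := limn (pseries (heat_coef f x) t).

Definition heat t f x := expR (- l * t) * heat_sum t f x.

Lemma cvg_heat_sum t f x : pseries (heat_coef f x) t @ \oo --> heat_sum t f x.
Proof. exact: is_cvg_heat_coef. Qed.

Lemma cvg_bigsum (F : X -> nat -> R) (a : X -> R) :
  (forall y, F y n @[n --> \oo] --> a y) ->
  \sum_y F y n @[n --> \oo] --> \sum_y a y.
Proof.
move=> Fa; elim: (index_enum X) => [|y r IH].
  by rewrite big_nil; under eq_fun do rewrite big_nil; exact: cvg_cst.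
by rewrite big_cons; under eq_fun do rewrite big_cons; exact: cvgD.
Qed.

Lemma heat_sumE t f x : heat_sum t f x = \sum_y f y * heat_sum t (delta y) x.
Proof.
apply/(@cvg_lim R) => //.
rewrite (_ : pseries _ _ = (fun n => \sum_y f y * pseries (heat_coef (delta y) x) t n)).
  by apply: cvg_bigsum => y; apply: cvgM; [exact: cvg_cst|exact: cvg_heat_sum].
apply/funext => n; rewrite /pseries /series/=.
under [RHS]eq_bigr do rewrite mulr_sumr.
rewrite exchange_big/=; apply: eq_bigr => i _.
rewrite /heat_coef iter_jumpE mulr_sumr mulr_suml; apply: eq_bigr => y _.
by ring.
Qed.

(** The numbers [heat t (delta y) x] are the transition kernel. Separating them from [f] lets curves
    such as [heat (tau u) (g u)] be differentiated by the product rule. *)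
Lemma heatE t f x : heat t f x = \sum_y f y * heat t (delta y) x.
Proof.
by rewrite /heat heat_sumE mulr_sumr; apply: eq_bigr => y _; rewrite mulrCA.
Qed.

Lemma heat_lincomb t a b f g x :
  heat t (fun z => a * f z + b * g z) x = a * heat t f x + b * heat t g x.
Proof.
rewrite heatE (heatE t f) (heatE t g) !mulr_sumr -big_split/=.
by apply: eq_bigr => y _; ring.
Qed.

Lemma heat_sum_jump t f x : heat_sum t (jump f) x = jump (heat_sum t f) x.
Proof.
apply/(@cvg_lim R) => //.
rewrite (_ : pseries _ _ = (fun n => \sum_y jump_kernel x y * pseries (heat_coef f y) t n)).
  by apply: cvg_bigsum => y; apply: cvgM; [exact: cvg_cst|exact: cvg_heat_sum].
apply/funext => n; rewrite /pseries /series/=.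
under [RHS]eq_bigr do rewrite mulr_sumr.
rewrite exchange_big/=; apply: eq_bigr => i _.
rewrite /heat_coef -iterSr/= {1}/jump mulr_sumr mulr_suml; apply: eq_bigr => y _.
by ring.
Qed.

Lemma heat_jump t f x : heat t (jump f) x = jump (heat t f) x.
Proof.
rewrite /heat heat_sum_jump /jump mulr_sumr; apply: eq_bigr => y _.
by rewrite mulrCA.
Qed.

Lemma heat_lap t f x : heat t (lap f) x = lap (heat t f) x.
Proof.
rewrite -jumpE -heat_jump (_ : lap f = fun z => l * jump f z + (- l) * f z).
  by rewrite heat_lincomb; ring.
by apply/funext => z; rewrite -jumpE; ring.
Qed.

(** Termwise differentiation shifts the coefficients, and the shifted ones are l times those of
    [jump f]. The theorem on power series asks for convergence of the first two derived series at a
    radius beyond |t|, here |t| + 1. *)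
Lemma is_derive_heat_sum t f x :
  is_derive t 1 (fun u => heat_sum u f x) (l * heat_sum t (jump f) x).
Proof.
have E g : pseries_diffs (heat_coef g x) = (fun n => l * heat_coef (jump g) x n).
  apply/funext => n; rewrite /pseries_diffs /heat_coef -iterSr.
  rewrite exprS factS natrM invfM.
  have n0 : (n.+1%:R : R) != 0 by rewrite pnatr_eq0.
  have f0 : (n`!%:R : R) != 0 by rewrite pnatr_eq0 -lt0n fact_gt0.
  set N : R := n.+1%:R in n0 *; set F : R := n`!%:R in f0 *.
  set J := iter _ _ _ _; set L := l ^+ n.
  rewrite [LHS](_ : _ = (N / N) * (l * (L / F * J))); last by ring.
  by rewrite divff// mul1r.
have P c (h : nat -> R) (K : R) : pseries (fun n => c * h n) K = (fun n => c * pseries h K n).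
  by apply/funext => n; rewrite /pseries /series/= mulr_sumr; apply: eq_bigr => i _; rewrite mulrA.
have E2 g : pseries_diffs (pseries_diffs (heat_coef g x)) =
    (fun n => l * (l * heat_coef (jump (jump g)) x n)).
  by rewrite E; apply/funext => n; rewrite {1}/pseries_diffs mulrCA -/(pseries_diffs _ n) E.
have C c h (K : R) : cvgn (pseries h K) -> cvgn (pseries (fun n => c * h n) K).
  by move=> hK; rewrite P; apply: is_cvgMl_tmp.
have := @pseries_snd_diffs R (heat_coef f x) (`|t| + 1) t.
rewrite E2 E.
have -> : limn (pseries (fun n => l * heat_coef (jump f) x n) t) = l * heat_sum t (jump f) x.
  rewrite P.
  by apply/(@cvg_lim R) => //; apply: cvgM; [exact: cvg_cst|exact: cvg_heat_sum].
apply.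
- exact: is_cvg_heat_coef.
- exact/C/is_cvg_heat_coef.
- exact/C/C/is_cvg_heat_coef.
- by rewrite [ltRHS]ger0_norm ?addr_ge0// ltrDl.
Qed.

Lemma is_derive_heat t f x :
  is_derive t 1 (fun u => heat u f x) (heat t (lap f) x).
Proof.
have h := is_deriveMf (is_derive_expRM (- l) t) (is_derive_heat_sum t f x).
apply: is_derive_eq.
rewrite heat_lap -jumpE -heat_jump /heat; ring.
Qed.

Lemma heat_sum0 f x : heat_sum 0 f x = f x.
Proof.
apply/(@cvg_lim R) => //; apply: cvg_near_cst; exists 1%N => // n /= n0.
rewrite -(prednK n0) /pseries /series/= big_nat_recl// big1 => [|i _]; last by rewrite expr0n mulr0.
by rewrite expr0 /heat_coef/= expr0 fact0 divr1 !mulr1 mul1r addr0.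
Qed.

Lemma heat0 f x : heat 0 f x = f x.
Proof. by rewrite /heat mulr0 expR0 mul1r heat_sum0. Qed.

Lemma jump_gt0 f x y : (forall z, 0 <= f z) -> 0 < Q x y -> 0 < f y -> 0 < jump f x.
Proof.
move=> f0 Qxy fy; rewrite /jump (bigD1 y)//= ltr_pwDl//.
  rewrite mulr_gt0// /jump_kernel ltr_pwDl// ?divr_gt0 ?unif_rate_gt0//.
  by rewrite mulr_ge0// ltW// jump_diag_gt0.
by rewrite sumr_ge0// => z _; rewrite mulr_ge0// jump_kernel_ge0.
Qed.

Lemma iter_jump_ge0 n f x : (forall z, 0 <= f z) -> 0 <= iter n jump f x.
Proof.
move=> f0; elim: n x => [|n IH] x //=; rewrite sumr_ge0// => y _.
by rewrite mulr_ge0// jump_kernel_ge0.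
Qed.

(** [n] is the length of a path of positive rates from x to y, given by irreducibility. *)
Lemma iter_jump_gt0 f x y : (forall z, 0 <= f z) -> 0 < f y ->
  exists n, 0 < iter n jump f x.
Proof.
move=> f0 fy; have /connectP[p] := irreducible QP x y.
elim: p x => [|z p IH] x /=; first by move=> _ e; exists 0%N; rewrite /= -e.
move=> /andP[Qxz zp] e; have [n zn] := IH _ zp e.
by exists n.+1; apply: (jump_gt0 _ Qxz zn) => w; exact: iter_jump_ge0.
Qed.

Lemma heat_coef_ge0 n f x : (forall z, 0 <= f z) -> 0 <= heat_coef f x n.
Proof.
move=> f0; rewrite /heat_coef mulr_ge0 ?iter_jump_ge0// mulr_ge0 ?invr_ge0//.
by rewrite exprn_ge0// ltW// unif_rate_gt0.
Qed.

Lemma heat_coef_le_sum t n f x : 0 <= t -> (forall z, 0 <= f z) ->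
  heat_coef f x n * t ^+ n <= heat_sum t f x.
Proof.
move=> t0 f0; apply: limr_ge.
  exact: is_cvg_heat_coef.
exists n.+1 => // m /= nm; rewrite /pseries /series/= (bigD1_seq n)/= ?iota_uniq//.
  rewrite lerDl sumr_ge0// => i _.
  by rewrite mulr_ge0 ?heat_coef_ge0// exprn_ge0.
by rewrite mem_index_iota.
Qed.

Lemma heat_ge0 t f x : 0 <= t -> (forall z, 0 <= f z) -> 0 <= heat t f x.
Proof.
move=> t0 f0; rewrite mulr_ge0 ?expR_ge0//.
apply: le_trans (heat_coef_le_sum 0 x t0 f0).
by rewrite mulr_ge0 ?heat_coef_ge0.
Qed.

Lemma heat_gt0 t f x y : 0 < t -> (forall z, 0 <= f z) -> 0 < f y -> 0 < heat t f x.
Proof.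
move=> t0 f0 fy; have [n xn] := iter_jump_gt0 x f0 fy.
rewrite mulr_gt0 ?expR_gt0//.
apply: lt_le_trans (heat_coef_le_sum n x (ltW t0) f0).
by rewrite /heat_coef mulr_gt0 ?exprn_gt0// mulr_gt0// divr_gt0 ?exprn_gt0 ?unif_rate_gt0.
Qed.

Lemma ip_lap f g : ip (lap f) g = ip f (lap g).
Proof.
rewrite /ip /lap.
have H u v : \sum_x (\sum_y Q x y * (u y - u x)) * v x * pi x =
  \sum_x \sum_y Q x y * pi x * (u y * v x) - \sum_x \sum_y Q x y * pi x * (u x * v x).
  rewrite -sumrB; apply: eq_bigr => x _; rewrite !mulr_suml -sumrB.
  by apply: eq_bigr => y _; ring.
rewrite H; under [RHS]eq_bigr do rewrite [f _ * _]mulrC.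
rewrite H; congr (_ - _).
  rewrite exchange_big/=; apply: eq_bigr => x _; apply: eq_bigr => y _.
  by rewrite (detailed_balance QP); ring.
by apply: eq_bigr => x _; apply: eq_bigr => y _; ring.
Qed.

Lemma is_derive_ip (F G : R -> X -> R) (dF dG : X -> R) t :
  (forall x, is_derive t 1 (F ^~ x) (dF x)) ->
  (forall x, is_derive t 1 (G ^~ x) (dG x)) ->
  is_derive t 1 (fun u => ip (F u) (G u)) (ip dF (G t) + ip (F t) dG).
Proof.
move=> Fd Gd.
have h : is_derive t 1 (fun u => \sum_x pi x * (F u x * G u x))
    (\sum_x pi x * (dF x * G t x + F t x * dG x)).
  by apply: is_derive_bigsum => x _; apply: is_deriveZf; exact: is_deriveMf.
rewrite (_ : (fun u => ip _ _) = fun u => \sum_x pi x * (F u x * G u x)).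
  apply: is_derive_eq; rewrite /ip -big_split; apply: eq_bigr => x _ /=.
  by ring.
by apply/funext => u; rewrite /ip; apply: eq_bigr => x _; rewrite mulrC.
Qed.

Lemma is_derive_heatN t s f x :
  is_derive t 1 (fun u => heat (s - u) f x) (- heat (s - t) (lap f) x).
Proof.
have h := is_deriveBf (is_deriveCf s t) (is_derive_id t 1).
have := @is_derive_compf _ _ (fun u => s - u) _ _ _ (is_derive_heat (s - t) f x) h.
by rewrite sub0r mulrN1.
Qed.

(** Time is moved from one factor to the other: the product at times t - u and s + u has zero
    derivative in u, because the generator is symmetric. *)
Lemma ip_heat_heat s t f g : ip (heat t f) (heat s g) = ip f (heat (t + s) g).
Proof.
pose F u := ip (heat (t - u) f) (heat (s + u) g).
have hF (u : R) : is_derive u 1 F 0.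
  have h1 : forall x, is_derive u 1 (fun v => heat (s + v) g x) (heat (s + u) (lap g) x).
    move=> x; have h := is_deriveDf (is_deriveCf s u) (is_derive_id u 1).
    by have := is_derive_compf (is_derive_heat (s + u) g x) h; rewrite add0r mulr1.
  have := is_derive_ip (fun x => is_derive_heatN u t f x) h1.
  have -> : ip (fun x => - heat (t - u) (lap f) x) (heat (s + u) g) +
     ip (heat (t - u) f) ((heat (s + u) (lap g))) = 0 => //.
  have -> : heat (s + u) (lap g) = lap (heat (s + u) g).
    by apply/funext => x; exact: heat_lap.
  rewrite -ip_lap -big_split/= big1// => x _.
  by rewrite heat_lap; ring.
have := is_derive_0_constant 0 t hF.
rewrite /F subr0 addr0 subrr addrC => ->; congr ip.
by apply/funext => x; rewrite heat0.
Qed.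

Lemma ip_heat t f g : ip (heat t f) g = ip f (heat t g).
Proof.
have := ip_heat_heat 0 t f g; rewrite addr0 => <-; congr ip.
by apply/funext => x; rewrite heat0.
Qed.

Lemma ip_delta f y : ip f (delta y) = f y * pi y.
Proof.
rewrite /ip (bigD1 y)//= /delta eqxx mulr1 big1 ?addr0// => x /negPf ->.
by rewrite mulr0 mul0r.
Qed.

(** Tested against [delta x], both flows move to the other side by symmetry, where [ip_heat_heat]
    merges them; no uniqueness theorem for differential equations enters. *)
Lemma heatD s t f x : heat s (heat t f) x = heat (s + t) f x.
Proof.
have p0 : pi x != 0 by rewrite gt_eqF// (stat_gt0 QP).
apply: (mulIf p0).
by rewrite -!ip_delta ip_heat ip_heat_heat ip_heat addrC.
Qed.

Lemma heat1 t x : heat t (fun=> 1) x = 1.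
Proof.
have h (u : R) : is_derive u 1 (fun v => heat v (fun=> 1) x) 0.
  have := is_derive_heat u (fun=> 1) x; rewrite heatE big1// => y _.
  by rewrite /lap big1 ?mul0r// => z _; rewrite subrr mulr0.
by have := is_derive_0_constant t 0 h; rewrite heat0.
Qed.

Lemma heat_mass t f : ip (heat t f) (fun=> 1) = ip f (fun=> 1).
Proof. by rewrite ip_heat; congr ip; apply/funext => x; rewrite heat1. Qed.

End HeatSemigroup.

(** * Continuity of finite sums and products *)

Section ContinuousBigops.
Context {R : realType}.

Lemma continuous_bigprod (I : Type) (s : seq I) (F : I -> R -> R) (t : R) :
  (forall i, {for t, continuous (F i)}) ->
  {for t, continuous (fun u => \prod_(i <- s) F i u)}.
Proof.
move=> Fc; elim: s => [|i s IH].
  rewrite (_ : (fun u => _) = fun=> 1); first exact: cvg_cst.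
  by apply/funext => u; rewrite big_nil.
rewrite (_ : (fun u => _) = fun u => F i u * \prod_(j <- s) F j u).
  by apply: cvgM; [exact: Fc|exact: IH].
by apply/funext => u; rewrite big_cons.
Qed.

Lemma continuous_bigsum (I : Type) (s : seq I) (F : I -> R -> R) (t : R) :
  (forall i, {for t, continuous (F i)}) ->
  {for t, continuous (fun u => \sum_(i <- s) F i u)}.
Proof.
move=> Fc; elim: s => [|i s IH].
  rewrite (_ : (fun u => _) = fun=> 0); first exact: cvg_cst.
  by apply/funext => u; rewrite big_nil.
rewrite (_ : (fun u => _) = fun u => F i u + \sum_(j <- s) F j u).
  by apply: cvgD; [exact: Fc|exact: IH].
by apply/funext => u; rewrite big_cons.
Qed.

End ContinuousBigops.

(** * The Onsager operator and the contraction of its form under the heat flow *)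

Section OnsagerOperator.
Context {R : realType} {X : finType} (Q : X -> X -> R) (pi : X -> R).
Context (QP : reversible_chain Q pi).
Implicit Types (rho r f g h psi phi : X -> R) (t c a b : R) (x y z : X).
Local Notation lap := (lap Q).
Local Notation ip := (ip pi).
Local Notation heat := (heat Q).

Definition onsager rho psi x :=
  \sum_y (psi x - psi y) * theta (rho x) (rho y) * Q x y.

(** On the diagonal f = g this is the integrand of [action], with the factor 1/2 included. *)
Definition dform rho f g := 2^-1 * \sum_x \sum_y
  (f x - f y) * (g x - g y) * theta (rho x) (rho y) * Q x y * pi x.

(* The dual form of [<K(rho)^-1 f, f> <= c], meaningful for any [rho >= 0]. *)
Definition dual_le rho f c := forall phi, 2 * ip f phi - dform rho phi phi <= c.

(** Summation by parts: exchanging x and y, with detailed balance and the symmetry of [theta],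
    produces the second half of the gradient of phi. *)
Lemma ip_onsager rho psi phi : (forall x, 0 <= rho x) ->
  ip (onsager rho psi) phi = dform rho psi phi.
Proof.
move=> rho0; rewrite /ip /onsager /dform.
pose F x y := (psi x - psi y) * theta (rho x) (rho y) * Q x y * pi x * phi x.
have -> : \sum_x (\sum_y (psi x - psi y) * theta (rho x) (rho y) * Q x y) * phi x * pi x
    = \sum_x \sum_y F x y.
  by apply: eq_bigr => x _; rewrite !mulr_suml; apply: eq_bigr => y _; rewrite /F; ring.
have -> : \sum_x \sum_y (psi x - psi y) * (phi x - phi y) * theta (rho x) (rho y) * Q x y * pi x
    = \sum_x \sum_y F x y + \sum_x \sum_y F y x.
  rewrite -big_split; apply: eq_bigr => x _; rewrite -big_split; apply: eq_bigr => y _ /=.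
  rewrite /F (thetaC (rho0 y) (rho0 x)).
  by rewrite -(mulrA _ (Q y x)) -(detailed_balance QP x y); ring.
by rewrite [X in _ + X]exchange_big/= -mulr2n -[X in 2^-1 * X]mulr_natl mulrA mulVf ?mul1r// pnatr_eq0.
Qed.

Lemma dformC rho f g : dform rho f g = dform rho g f.
Proof.
rewrite /dform; congr (_ * _); apply: eq_bigr => x _; apply: eq_bigr => y _.
by rewrite [X in X * _ * _ * _]mulrC.
Qed.

Lemma dform_lincomb rho a b f g h :
  dform rho (fun x => a * f x + b * g x) h = a * dform rho f h + b * dform rho g h.
Proof.
rewrite /dform !mulr_sumr -big_split; apply: eq_bigr => x _ /=.
rewrite !mulr_sumr -big_split; apply: eq_bigr => y _ /=; ring.
Qed.

Lemma dform_ge0 rho f : (forall x, 0 <= rho x) -> 0 <= dform rho f f.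
Proof.
move=> rho0; rewrite mulr_ge0 ?invr_ge0//; apply: sumr_ge0 => x _.
apply: sumr_ge0 => y _; rewrite mulr_ge0 ?(ltW (stat_gt0 QP x))//.
rewrite mulr_ge0 ?(rate_ge0 QP)// mulr_ge0 ?theta_ge0//.
by rewrite -expr2 sqr_ge0.
Qed.

Lemma ip_lincomb a b f g h :
  ip (fun x => a * f x + b * g x) h = a * ip f h + b * ip g h.
Proof. by rewrite /ip !mulr_sumr -big_split; apply: eq_bigr => x _ /=; ring. Qed.

Lemma ipC f g : ip f g = ip g f.
Proof. by apply: eq_bigr => x _; rewrite [f x * _]mulrC. Qed.

Lemma dform_sq rho a b f g :
  dform rho (fun x => a * f x + b * g x) (fun x => a * f x + b * g x) =
  a ^+ 2 * dform rho f f + 2 * a * b * dform rho f g + b ^+ 2 * dform rho g g.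
Proof.
rewrite dform_lincomb (dformC _ f) (dformC _ g) !dform_lincomb (dformC _ g f).
by ring.
Qed.

(** This is nonnegativity of [dform] at psi - phi. *)
Lemma dual_onsager rho psi : (forall x, 0 <= rho x) ->
  dual_le rho (onsager rho psi) (dform rho psi psi).
Proof.
move=> rho0 phi; rewrite ip_onsager//.
have := dform_ge0 (fun x => 1 * psi x + (-1) * phi x) rho0.
by rewrite dform_sq; lra.
Qed.

Lemma onsager_ln r : (forall x, 0 < r x) ->
  forall x, onsager r (fun y => ln (r y)) x = - lap r x.
Proof.
move=> r0 x; rewrite /onsager /lap -sumrN; apply: eq_bigr => y _.
by rewrite [X in X * _]mulrC theta_ln//; ring.
Qed.

(* Completing the square: [|g - c grad H|^2] drops by at least
   [2 c <f, grad H>], where [lap r = - grad H (r)]. *)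
Lemma dual_entropy r f g c a : (forall x, 0 < r x) ->
  (forall x, f x = g x + a * lap r x) ->
  dual_le r g c -> dual_le r f (c - 2 * a * ip f (fun x => ln (r x))).
Proof.
move=> r0 fE gc phi; pose lnr x := ln (r x).
have rge0 x : 0 <= r x by exact: ltW.
have lapE psi : ip (lap r) psi = - dform r lnr psi.
  rewrite -ip_onsager// /ip -sumrN; apply: eq_bigr => x _.
  by rewrite onsager_ln//; ring.
have fipE psi : ip f psi = ip g psi - a * dform r lnr psi.
  rewrite (_ : f = fun x => 1 * g x + a * lap r x).
    by rewrite ip_lincomb lapE; ring.
  by apply/funext => x; rewrite fE mul1r.
rewrite !fipE -/lnr.
(* The test function is shifted by a ln r; what is left over is a^2 times [dform] at ln r, which is
   nonnegative and dropped. *)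
have := gc (fun x => 1 * phi x + a * lnr x); rewrite dform_sq ipC ip_lincomb.
rewrite (ipC phi) (ipC lnr) (dformC _ phi).
have := mulr_ge0 (sqr_ge0 a) (dform_ge0 lnr rge0); nra.
Qed.

(** A discrete Bochner inequality. The right-hand side is the derivative in u of [dform] at density
    P_u rho and potential P_(t-u) f, with psi the latter; the sum on the left is twice [dform],
    whence the exponential rate 2 kappa. *)
Definition curvature (kappa : R) := forall rho psi, (forall x, 0 < rho x) ->
  kappa * (\sum_x \sum_y (psi x - psi y) ^+ 2 * theta (rho x) (rho y) * Q x y * pi x)
  <= \sum_x \sum_y Q x y * pi x *
     (2^-1 * (psi x - psi y) ^+ 2 *
        (dtheta (rho x) (rho y) * lap rho x + dtheta (rho y) (rho x) * lap rho y)
      - (psi x - psi y) * (lap psi x - lap psi y) * theta (rho x) (rho y)).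

Lemma is_derive_dform_heat rho f t u : (forall x, 0 < heat u rho x) ->
  is_derive u 1
    (fun v => dform (heat v rho) (heat (t - v) f) (heat (t - v) f))
    (\sum_x \sum_y Q x y * pi x *
      (2^-1 * (heat (t - u) f x - heat (t - u) f y) ^+ 2 *
        (dtheta (heat u rho x) (heat u rho y) * lap (heat u rho) x
         + dtheta (heat u rho y) (heat u rho x) * lap (heat u rho) y)
      - (heat (t - u) f x - heat (t - u) f y)
        * (lap (heat (t - u) f) x - lap (heat (t - u) f) y)
        * theta (heat u rho x) (heat u rho y))).
Proof.
move=> u0.
have hf x := is_derive_heatN QP u t f x.
have hr x := is_derive_heat QP u rho x.
have H x y : is_derive u 1
  (fun v => (Q x y * pi x * 2^-1) * (((heat (t - v) f x - heat (t - v) f y) *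
     (heat (t - v) f x - heat (t - v) f y)) * theta (heat v rho x) (heat v rho y)))
  ((Q x y * pi x * 2^-1) * (
    ((- heat (t - u) (lap f) x - - heat (t - u) (lap f) y) * (heat (t - u) f x - heat (t - u) f y)
    + (heat (t - u) f x - heat (t - u) f y) * (- heat (t - u) (lap f) x - - heat (t - u) (lap f) y))
     * theta (heat u rho x) (heat u rho y)
   + ((heat (t - u) f x - heat (t - u) f y) * (heat (t - u) f x - heat (t - u) f y)) *
    (dtheta (heat u rho x) (heat u rho y) * heat u (lap rho) x
     + dtheta (heat u rho y) (heat u rho x) * heat u (lap rho) y))).
  apply: is_deriveZf; apply: is_deriveMf; last exact: is_derive_theta.
  by apply: is_deriveMf; exact: is_deriveBf.
have HH := is_derive_bigsum (P := predT) (fun x _ =>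
  is_derive_bigsum (P := predT) (fun y _ => H x y)).
rewrite (_ : (fun v => dform _ _ _) = fun v => \sum_x \sum_y (Q x y * pi x * 2^-1) *
  (((heat (t - v) f x - heat (t - v) f y) *
     (heat (t - v) f x - heat (t - v) f y)) * theta (heat v rho x) (heat v rho y))).
  apply: is_derive_eq; apply: eq_bigr => x _; apply: eq_bigr => y _.
  by rewrite -!(heat_lap QP); field.
apply/funext => v; rewrite /dform mulr_sumr; apply: eq_bigr => x _.
by rewrite mulr_sumr; apply: eq_bigr => y _; ring.
Qed.

(** The product with e^(- 2 kappa u) is nondecreasing. The starting time s stays a parameter because
    the derivative of [theta] is available only at positive densities. *)
Lemma dform_heat_le_pos kappa rho f t s : curvature kappa -> 0 <= s <= t ->
  (forall u x, s <= u -> 0 < heat u rho x) ->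
  expR (- (2 * kappa) * s) * dform (heat s rho) (heat (t - s) f) (heat (t - s) f) <=
  expR (- (2 * kappa) * t) * dform (heat t rho) f f.
Proof.
move=> HC /andP[s0 st] rho0.
have -> : dform (heat t rho) f f = dform (heat t rho) (heat (t - t) f) (heat (t - t) f).
  by congr dform; apply/funext => x; rewrite subrr heat0.
have hE (u : R) := is_derive_expRM (- (2 * kappa)) u.
apply: (is_derive_ge0_nondecreasing st (fun u hu => is_deriveMf (hE u)
   (is_derive_dform_heat f t (fun x => rho0 u x (andP hu).1)))).
move=> u /andP[su ut].
have := HC (heat u rho) (heat (t - u) f) (fun x => rho0 u x su).
set S := (X in _ <= X) => hS.
rewrite -[X in _ + _ * X]/S; set D := dform _ _ _.
rewrite (_ : _ + _ = expR (- (2 * kappa) * u) * (S - 2 * kappa * D)); last by ring.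
rewrite mulr_ge0 ?expR_ge0// subr_ge0 (le_trans _ hS)//.
by rewrite /D /dform mulrA (mulrC 2) -mulrA -(mulrA kappa) mulVKf ?pnatr_eq0.

Qed.

(* The left-hand side is lower semicontinuous at [u = 0], since [theta]
   vanishes as soon as one argument does. *)
Lemma dform_heat_le kappa rho f t : curvature kappa -> 0 < t ->
  (forall x, 0 <= rho x) -> (exists x, 0 < rho x) ->
  dform rho (heat t f) (heat t f) <=
  expR (- (2 * kappa) * t) * dform (heat t rho) f f.
Proof.
move=> HC t0 rho0 [x0 rhox0]; set G := expR _ * _.
pose P x y := (0 < rho x) && (0 < rho y).
(* Only pairs on which rho is positive at time 0 are kept. For u > 0 this discards nonnegative
   terms, at u = 0 it discards zeros, and the kept terms are continuous at 0. *)
pose Hf u := expR (- (2 * kappa) * u) * (2^-1 * \sum_x \sum_y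
  if P x y then (heat (t - u) f x - heat (t - u) f y) *
   (heat (t - u) f x - heat (t - u) f y) * theta (heat u rho x) (heat u rho y)
   * Q x y * pi x else 0).
have hpos u x : 0 < u -> 0 < heat u rho x by move=> u0; exact: (heat_gt0 QP x u0 rho0 rhox0).
have HG u : 0 < u -> u <= t -> Hf u <= G.
  move=> u0 ut; apply: le_trans (@dform_heat_le_pos kappa rho f t u HC _ _); last first.
  - by move=> v x uv; apply: hpos; exact: lt_le_trans uv.
  - by rewrite (ltW u0).
  rewrite ler_wpM2l ?expR_ge0// /dform ler_wpM2l ?invr_ge0//.
  apply: ler_sum => x _; apply: ler_sum => y _; case: ifP => // _.
  rewrite mulr_ge0 ?(ltW (stat_gt0 QP x))// mulr_ge0 ?(rate_ge0 QP)//.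
  by rewrite mulr_ge0 -?expr2 ?sqr_ge0// theta_ge0// ltW// hpos.
have H0 : Hf 0 = dform rho (heat t f) (heat t f).
  rewrite /Hf mulr0 expR0 mul1r /dform; congr (_ * _).
  apply: eq_bigr => x _; apply: eq_bigr => y _; rewrite subr0 !heat0; case: ifP => // /negP Pn.
  have [xx|xx] := ltP 0 (rho x); last first.
    by rewrite (_ : rho x = 0) ?theta0l ?mulr0 ?mul0r//; apply/le_anti; rewrite xx rho0.
  have [yy|yy] := ltP 0 (rho y); last first.
    by rewrite (_ : rho y = 0) ?theta0r ?mulr0 ?mul0r//; apply/le_anti; rewrite yy rho0.
  by case: Pn; rewrite /P xx yy.
have cH : {for 0, continuous Hf}.
  have ch g x : {for (0:R), continuous (fun u => heat (t - u) g x)}.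
    exact: is_derive_continuous (is_derive_heatN QP 0 t g x).
  apply: cvgM.
    exact: is_derive_continuous (is_derive_expRM _ _).
  apply: cvgM; first exact: cvg_cst.
  apply: continuous_bigsum => x; apply: continuous_bigsum => y; case: (boolP (P x y)) => [/andP[rx ry]|_]; last exact: cvg_cst.
  apply: cvgM; last exact: cvg_cst.
  apply: cvgM; last exact: cvg_cst.
  apply: cvgM; first by apply: cvgM; apply: cvgB; exact: ch.
  apply: (is_derive_continuous (is_derive_theta _ _ (is_derive_heat QP 0 rho x) (is_derive_heat QP 0 rho y))).
    by rewrite heat0.
  by rewrite heat0.
rewrite -H0 leNgt; apply/negP => GH.
have := cvgr_gt (Hf 0) cH _ GH => -[e /= e0 He].
pose u := Num.min (e / 2) t.
have u0 : 0 < u by rewrite /u lt_min t0 divr_gt0.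
have := He u; rewrite /ball_/= sub0r normrN gtr0_norm// => Hu.
have /Hu : u < e by rewrite /u gt_min ltr_pdivrMr// ltr_pMr// ltr1n.
by apply/negP; rewrite -leNgt HG// /u ge_min lexx orbT.
Qed.

(** Symmetry of P_t turns a test function phi into P_t phi. Dividing it by the decay factor E
    balances the linear against the quadratic term, so that the bound of [dform_heat_le] becomes the
    factor E on c. *)
Lemma dual_heat kappa rho f c t : curvature kappa -> 0 < t ->
  (forall x, 0 <= rho x) -> (exists x, 0 < rho x) -> dual_le rho f c ->
  dual_le (heat t rho) (heat t f) (expR (- (2 * kappa) * t) * c).
Proof.
move=> HC t0 rho0 rhop fc phi; rewrite (ip_heat QP).
have := dform_heat_le phi HC t0 rho0 rhop; set E := expR _ => h.
have E0 : 0 < E by exact: expR_gt0.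
have := fc (fun x => E^-1 * heat t phi x + 0 * phi x).
rewrite dform_sq ipC ip_lincomb ipC expr0n/= !(mul0r, mulr0, addr0).
move/(ler_wpM2l (ltW E0)); apply: le_trans.
rewrite mulrBr.
have En : E != 0 by rewrite gt_eqF.
rewrite (_ : E * (2 * (E^-1 * _)) = 2 * ip f (heat t phi)); last by field.
rewrite (_ : E * (E^-1 ^+ 2 * _) = E^-1 * dform rho (heat t phi) (heat t phi)); last by field.
by rewrite lerD2l lerN2 ler_pdivrMl.
Qed.

End OnsagerOperator.

(** * Inverting the Onsager operator at positive densities *)

Section OnsagerInverse.
Context {R : realType} {X : finType} (Q : X -> X -> R) (pi : X -> R).
Context (QP : reversible_chain Q pi).
Implicit Types (rho r f g psi : X -> R) (x y z : X).
Local Notation ip := (ip pi).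
Local Notation onsager := (onsager Q).
Local Notation dform := (dform Q pi).

(* The matrix of [psi |-> onsager rho psi + <psi, 1>], acting on row vectors. *)
Definition onsager_mx rho : 'M[R]_#|X| := \matrix_(i, j)
  let x := enum_val j in let y := enum_val i in
  (x == y)%:R * (\sum_z theta (rho x) (rho z) * Q x z)
  - theta (rho x) (rho y) * Q x y + pi y.

(** Cramer's rule: written with determinants, the solution depends continuously on rho and f for
    purely algebraic reasons. *)
Definition solve rho f x := (\det (onsager_mx rho))^-1 *
  \sum_j f (enum_val j) * \adj (onsager_mx rho) j (enum_rank x).

Lemma mul_onsager_mx rho (v : 'rV[R]_#|X|) x :
  let psi y := v 0 (enum_rank y) in
  (v *m onsager_mx rho) 0 (enum_rank x) = onsager rho psi x + ip psi (fun=> 1).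
Proof.
move=> psi; rewrite mxE.
rewrite (reindex (@enum_rank X))/=; last exact/onW_bij/enum_rank_bij.
rewrite /onsager /ip; under eq_bigr do rewrite !mxE /= !enum_rankK.
under eq_bigr do rewrite mulrDr mulrBr.
rewrite big_split/= sumrB; congr (_ + _); last first.
  by apply: eq_bigr => y _; rewrite mulr1.
rewrite [X in X - _](_ : _ = psi x * \sum_z theta (rho x) (rho z) * Q x z); last first.
  rewrite (bigD1 x)//= eqxx mul1r [X in _ + X = _]big1 => [|y]; first by rewrite addr0.
  by rewrite eq_sym => /negPf ->; rewrite mul0r mulr0.
rewrite mulr_sumr -sumrB; apply: eq_bigr => y _; rewrite /psi; ring.
Qed.

Lemma dform_eq0_constant rho psi : (forall x, 0 < rho x) ->
  dform rho psi psi = 0 -> forall x y, psi x = psi y.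
Proof.
move=> rho0 /eqP; rewrite mulf_eq0 invr_eq0 pnatr_eq0/=.
have t0 a b : 0 <= (psi a - psi b) * (psi a - psi b) * theta (rho a) (rho b) * Q a b * pi a.
  rewrite mulr_ge0 ?(ltW (stat_gt0 QP _))// mulr_ge0 ?(rate_ge0 QP)//.
  by rewrite mulr_ge0 -?expr2 ?sqr_ge0// theta_ge0// ltW.
rewrite psumr_eq0 => [/allP H|a _]; last by apply: sumr_ge0 => b _.
have step a b : 0 < Q a b -> psi a = psi b.
  move=> Qab; have := H a (mem_index_enum _); rewrite psumr_eq0// => /allP/(_ b (mem_index_enum _)).
  rewrite !mulf_eq0 !(gt_eqF Qab) (gt_eqF (stat_gt0 QP a)) !orbF/=.
  by rewrite (gt_eqF (theta_gt0 (rho0 a) (rho0 b))) orbF orbb subr_eq0 => /eqP.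
move=> x y; have /connectP[p] := irreducible QP x y.
by elim: p x => [|z p IH] x /=; [move=> _ ->|move=> /andP[/step -> zp] /(IH _ zp)].
Qed.

(** Pairing a kernel vector psi with itself gives [dform rho psi psi] plus the squared mean, equal
    to 0. Irreducibility then makes psi constant, and the vanishing mean makes it zero. *)
Lemma onsager_mx_det rho : (forall x, 0 < rho x) -> \det (onsager_mx rho) != 0.
Proof.
move=> rho0; apply/negP => /det0P[v v0 vA].
pose psi y := v 0 (enum_rank y).
have E x : onsager rho psi x + ip psi (fun=> 1) = 0.
  by have := mul_onsager_mx rho v x; rewrite vA mxE => /= ->.
have : dform rho psi psi + (ip psi (fun=> 1)) ^+ 2 = 0.
  rewrite -(ip_onsager QP) => [|x]; last exact: ltW.
  have -> : (ip psi (fun=> 1)) ^+ 2 = \sum_x ip psi (fun=> 1) * psi x * pi x.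
    rewrite expr2 {2}/ip mulr_sumr; apply: eq_bigr => x _; ring.
  rewrite {1}/ip -big_split big1// => x _ /=.
  by rewrite -!mulrA -mulrDl E mul0r.
move/eqP; rewrite paddr_eq0 ?sqr_ge0//; last first.
  by apply: (dform_ge0 QP) => x; exact: ltW.
move=> /andP[/eqP/(dform_eq0_constant rho0) c]; rewrite sqrf_eq0 => /eqP i0.
case/negP: v0; apply/eqP/rowP => j; rewrite mxE -(enum_valK j).
move: i0; rewrite /ip; under eq_bigr do rewrite (c _ (enum_val j)) mulr1.
by rewrite -mulr_sumr (stat_sum1 QP) mulr1.
Qed.

(** The matrix adds the mean of the solution to the operator. Pairing with 1 shows that this mean is
    the mean of f, hence 0. *)
Lemma onsager_solve rho f : (forall x, 0 < rho x) -> ip f (fun=> 1) = 0 ->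
  forall x, onsager rho (solve rho f) x = f x.
Proof.
move=> rho0 f0.
pose d := \det (onsager_mx rho).
have d0 : d != 0 := onsager_mx_det rho0.
pose fv : 'rV[R]_#|X| := \row_j f (enum_val j).
pose v := d^-1 *: (fv *m \adj (onsager_mx rho)).
have vE y : v 0 (enum_rank y) = solve rho f y.
  rewrite !mxE /solve; congr (_ * _); apply: eq_bigr => j _; by rewrite mxE.
have vA : v *m onsager_mx rho = fv.
  by rewrite -scalemxAl -mulmxA mul_adj_mx mul_mx_scalar scalerA mulVf// scale1r.
have E x : onsager rho (solve rho f) x + ip (solve rho f) (fun=> 1) = f x.
  have := mul_onsager_mx rho v x; rewrite vA mxE enum_rankK => /= ->.
  by rewrite (_ : (fun y => v 0 (enum_rank y)) = solve rho f)//; exact/funext.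
suff s0 : ip (solve rho f) (fun=> 1) = 0 by move=> x; have := E x; rewrite s0 addr0.
set c := ip (solve rho f) _ in E *.
have {1}<- : ip (fun x => 1 * onsager rho (solve rho f) x + c * 1) (fun=> 1) = 0.
  by rewrite -f0; congr ip; apply/funext => x; rewrite mul1r mulr1 E.
rewrite (ip_lincomb pi 1 c _ (fun=> 1)) (ip_onsager QP) => [|x]; last exact: ltW.
have -> : dform rho (solve rho f) (fun=> 1) = 0.
  by rewrite /dform big1 ?mulr0// => x _; rewrite big1// => y _; rewrite subrr mulr0 !mul0r.
have -> : ip (fun=> 1) (fun=> 1) = 1.
  by rewrite -[RHS](stat_sum1 QP); apply: eq_bigr => x _; rewrite !mul1r.
by rewrite mulr0 mulr1 add0r.
Qed.

(** The solution itself is the optimal test function in [dual_le], where 2 D - D = D. *)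
Lemma solve_le rho f c : (forall x, 0 < rho x) -> ip f (fun=> 1) = 0 ->
  dual_le Q pi rho f c -> dform rho (solve rho f) (solve rho f) <= c.
Proof.
move=> rho0 f0 /(_ (solve rho f)).
have {1}-> : f = onsager rho (solve rho f).
  by apply/funext => x; rewrite onsager_solve.
rewrite (ip_onsager QP) => [|x]; last exact: ltW.
by apply: le_trans; rewrite le_eqVlt; apply/orP; left; apply/eqP; ring.
Qed.

Lemma continuous_det n (A : R -> 'M[R]_n) (t : R) :
  (forall i j, {for t, continuous (fun u => A u i j)}) ->
  {for t, continuous (fun u => \det (A u))}.
Proof.
move=> Ac; rewrite /determinant; apply: continuous_bigsum => s.
by apply: cvgM; [exact: cvg_cst|exact: continuous_bigprod].
Qed.

Lemma continuous_theta (f g : R -> R) (t : R) : 0 < f t -> 0 < g t ->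
  {for t, continuous f} -> {for t, continuous g} ->
  {for t, continuous (fun u => theta (f u) (g u))}.
Proof.
move=> f0 g0 fc gc.
have h : {for t, continuous (fun u => g u * expmean (ln (f u) - ln (g u)))}.
  apply: cvgM => //; apply: (continuous_comp (f := fun u => ln (f u) - ln (g u))).
    by apply: cvgB; apply: (continuous_comp (f := _) (g := @ln R)) => //; exact: continuous_ln.
  exact: is_derive_continuous (is_derive_expmean _).
move: h; rewrite /prop_for /continuous_at -(thetaE f0 g0) => h.
apply: cvg_trans h; apply: near_eq_cvg.
have nf := cvgr_gt (f t) fc _ f0; have ng := cvgr_gt (g t) gc _ g0.
near=> u; rewrite thetaE//; first by near: u; exact: nf.
by near: u; exact: ng.
Unshelve. all: by end_near. Qed.

Lemma continuous_solve (r f : R -> X -> R) (t : R) x : (forall y, 0 < r t y) ->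
  (forall y, {for t, continuous (r ^~ y)}) ->
  (forall y, {for t, continuous (f ^~ y)}) ->
  {for t, continuous (fun u => solve (r u) (f u) x)}.
Proof.
move=> r0 rc fc.
have tc y z := continuous_theta (r0 y) (r0 z) (rc y) (rc z).
have Ac i j : {for t, continuous (fun u => onsager_mx (r u) i j)}.
  rewrite (_ : (fun u => _) = fun u => ((enum_val j == enum_val i)%:R *
   (\sum_z theta (r u (enum_val j)) (r u z) * Q (enum_val j) z)
  - theta (r u (enum_val j)) (r u (enum_val i)) * Q (enum_val j) (enum_val i) + pi (enum_val i)));
   last by apply/funext => u; rewrite mxE.
  apply: cvgD; last exact: cvg_cst.
  apply: cvgB; last by apply: cvgM; [exact: tc|exact: cvg_cst].
  apply: cvgM; first exact: cvg_cst.
  by apply: continuous_bigsum => z; apply: cvgM; [exact: tc|exact: cvg_cst].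
apply: cvgM; first by apply: cvgV; [exact: onsager_mx_det|exact: continuous_det].
apply: continuous_bigsum => j; apply: cvgM; first exact: fc.
suff : {for t, continuous (fun u => cofactor (onsager_mx (r u)) (enum_rank x) j)}.
  rewrite (_ : (fun u => cofactor _ _ _) = fun u => (\adj (onsager_mx (r u))) j (enum_rank x)) //.
  by apply/funext => u; rewrite mxE.
rewrite /cofactor; apply: cvgM; first exact: cvg_cst.
apply: continuous_det => i k; rewrite (_ : (fun u => _) =
  fun u => onsager_mx (r u) (lift (enum_rank x) i) (lift j k)); first exact: Ac.
by apply/funext => u; rewrite !mxE.
Qed.

Lemma continuous_dform (r f g : R -> X -> R) (t : R) : (forall y, 0 < r t y) ->
  (forall y, {for t, continuous (r ^~ y)}) ->
  (forall y, {for t, continuous (f ^~ y)}) ->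
  (forall y, {for t, continuous (g ^~ y)}) ->
  {for t, continuous (fun u => dform (r u) (f u) (g u))}.
Proof.
move=> r0 rc fc gc; apply: cvgM; first exact: cvg_cst.
apply: continuous_bigsum => x; apply: continuous_bigsum => y.
apply: cvgM; last exact: cvg_cst.
apply: cvgM; last exact: cvg_cst.
apply: cvgM; last exact: continuous_theta.
by apply: cvgM; apply: cvgB; [exact: fc|exact: fc|exact: gc|exact: gc].
Qed.

End OnsagerInverse.

(** * The birth and death chain on configurations *)

Section Configurations.
Context {R : realType} {T : finType} (A : {fset config T}) (nu : T -> R).
Context (A_decr : decreasing A).
Context (A_nonzero : exists x i, x \in A /\ (0 < x i)%N).
Context (nu_gt0 : forall i, 0 < nu i).
Implicit Types (x y z : config T) (i j : T).

Lemma incrE x i j : incr x i j = (x j + (j == i))%N.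
Proof. by rewrite !ffunE. Qed.

Lemma decrE x i j : decr x i j = (x j - (j == i))%N.
Proof. by rewrite !ffunE. Qed.

Lemma incrK x i : decr (incr x i) i = x.
Proof. by apply/ffunP => j; rewrite decrE incrE addnK. Qed.

Lemma decrK x i : (0 < x i)%N -> incr (decr x i) i = x.
Proof.
move=> xi; apply/ffunP => j; rewrite incrE decrE.
by case: eqP => [->|_]; rewrite ?subnK// subn0 addn0.
Qed.

Lemma incrC x i j : incr (incr x i) j = incr (incr x j) i.
Proof. by apply/ffunP => k; rewrite !incrE addnAC. Qed.

Lemma incr_injr x : injective (incr x).
Proof.
move=> i j /ffunP/(_ i); rewrite !incrE eqxx => /eqP.
by rewrite eqn_add2l eq_sym eqb1 => /eqP.
Qed.

Lemma incr_eq_decr x y i : (x == incr y i) = (0 < x i)%N && (y == decr x i).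
Proof.
apply/eqP/andP => [->|[xi /eqP ->]]; last by rewrite decrK.
by rewrite incrK eqxx incrE eqxx addn1.
Qed.

Lemma decr_mem x i : x \in A -> decr x i \in A.
Proof. by move=> xA; apply: (A_decr xA) => j; rewrite decrE leq_subr. Qed.

Lemma incr_mem x i : incr x i \in A -> x \in A.
Proof. by move=> xA; apply: (A_decr xA) => j; rewrite incrE leq_addr. Qed.

Lemma sum_indic (F : config T -> R) y :
  \sum_(x : A) (val x == y)%:R * F (val x) = (y \in A)%:R * F y.
Proof.
have [yA|yA] := boolP (y \in A); last first.
  rewrite mul0r big1// => x _; case: eqP => [e|_]; last by rewrite mul0r.
  by move: yA; rewrite -e (valP x).
rewrite (bigD1 [` yA]%fset)//= eqxx big1 ?addr0// => x xy.
by rewrite (_ : (_ == _) = false) ?mul0r//; apply/negbTE; apply: contra xy => /eqP e; apply/eqP/val_inj.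
Qed.

(** At most one term in total is nonzero. For [val x i = 0] the truncated [decr] returns x itself,
    but the factor [val x i] removes that term; membership indicators disappear because y lies in
    A. *)
Lemma rateE (x y : A) : rate nu x y =
  \sum_i (val y == incr (val x) i)%:R * nu i
  + \sum_i (val y == decr (val x) i)%:R * (val x i)%:R.
Proof.
rewrite /rate; case: pickP => [i /eqP yi|y1].
  rewrite yi -{1}yi (valP y) mulr1 (bigD1 i)//= eqxx mul1r big1 => [|j ji]; last first.
    rewrite (_ : (_ == _) = false) ?mul0r//; apply/negbTE; apply: contra ji => /eqP e.
    by apply/eqP/(@incr_injr (val x)).
  rewrite addr0 big1 ?addr0// => j _; rewrite (_ : (_ == _) = false) ?mul0r//.
  apply/negbTE/eqP => /ffunP/(_ i); rewrite incrE decrE eqxx addn1 => e.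
  by have := leq_subr (i == j) (val x i); rewrite -e ltnn.
rewrite [X in X + _]big1 ?add0r => [|i _]; last by rewrite y1 mul0r.
case: pickP => [i /andP[xi /eqP yi]|y2].
  rewrite yi -{1}yi (valP y) mulr1 (bigD1 i)//= eqxx mul1r big1 ?addr0// => j ji.
  case: eqP => [e|_]; last by rewrite mul0r.
  move/ffunP/(_ i): e; rewrite !decrE eqxx eq_sym (negPf ji) subn0 subn1 => e.
  by have := ltn_predL (val x i); rewrite e ltnn xi.
rewrite big1// => i _; move: (y2 i); case: (val x i) => [|n]; first by rewrite mulr0.
by move=> /= ->; rewrite mul0r.
Qed.

Lemma sum_rate (x : A) (F : config T -> R) :
  \sum_(y : A) rate nu x y * F (val y) =
  \sum_i (incr (val x) i \in A)%:R * nu i * F (incr (val x) i)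
  + \sum_i (val x i)%:R * F (decr (val x) i).
Proof.
under eq_bigr do rewrite rateE mulrDl !mulr_suml.
rewrite big_split/=; congr (_ + _); rewrite exchange_big/=; apply: eq_bigr => i _.
  under eq_bigr do rewrite -mulrA.
  by rewrite (sum_indic (fun y => nu i * F y)) mulrA.
under eq_bigr do rewrite -mulrA.
by rewrite (sum_indic (fun y => _ * F y)) decr_mem ?mul1r// (valP x).
Qed.

(** Adding a particle at i is a bijection onto the configurations of A with a particle at i, since A
    is decreasing. *)
Lemma sum_shift i (F : config T -> R) :
  \sum_(x : A) (0 < val x i)%N%:R * F (val x) =
  \sum_(x : A) (incr (val x) i \in A)%:R * F (incr (val x) i).
Proof.
under [RHS]eq_bigr do rewrite -sum_indic.
rewrite exchange_big/=; apply: eq_bigr => x _.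
rewrite -mulr_suml; congr (_ * _).
under eq_bigr do rewrite incr_eq_decr -mulnb natrM mulrC.
rewrite (sum_indic (fun=> _)) decr_mem ?mul1r//; exact: valP.
Qed.

(** The stationary measure extended to all configurations, so that identities relating x and x + 1_i
    need no membership proofs. *)
Definition config_weight x : R := weight nu x / \sum_(z : A) weight nu (val z).
Local Notation w := config_weight.

Lemma weight_gt0 x : 0 < weight nu x.
Proof.
by apply: prodr_gt0 => i _; rewrite divr_gt0 ?exprn_gt0// ltr0n fact_gt0.
Qed.

Lemma sum_weight_gt0 : 0 < \sum_(z : A) weight nu (val z).
Proof.
case: A_nonzero => x [i [xA _]].
rewrite (bigD1 [` xA]%fset)//= ltr_pwDl ?weight_gt0//.
by apply: sumr_ge0 => z _; exact/ltW/weight_gt0.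
Qed.

Lemma config_weight_gt0 x : 0 < w x.
Proof. by rewrite divr_gt0 ?weight_gt0// sum_weight_gt0. Qed.

Lemma config_weight_incr x i : w (incr x i) * (x i).+1%:R = nu i * w x.
Proof.
rewrite /w mulrAC [RHS]mulrA; congr (_ / _).
rewrite /weight (bigD1 i)//= [in RHS](bigD1 i)//= incrE eqxx addn1.
rewrite (eq_bigr (fun j => nu j ^+ x j / (x j)`!%:R)) => [|j ji]; last first.
  by rewrite incrE (negPf ji) addn0.
set P := \prod_(_ | _) _; rewrite exprS factS natrM invfM.
have n0 : (x i).+1%:R != 0 :> R by rewrite pnatr_eq0.
set N : R := (x i).+1%:R in n0 *.
set F : R := _`!%:R^-1; set L := nu i ^+ x i.
rewrite [LHS](_ : _ = (N / N) * (nu i * (L * F * P))); last by ring.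
by rewrite divff// mul1r.
Qed.

Lemma rate_balance x y i : (y == incr x i)%:R * nu i * w x =
  (x == decr y i)%:R * (y i)%:R * w y.
Proof.
rewrite incr_eq_decr; have [yi|] := posnP (y i).
  by rewrite yi mulr0 !mul0r.
case: eqP => [->|_] yi; last by rewrite !mul0r.
rewrite mul1r mul1r -config_weight_incr decrK// decrE eqxx subn1 prednK//.
by rewrite mulrC.
Qed.

(** Particles are removed one at a time, by induction on their number; each removal stays in A and
    is reversible with positive rate. *)
Lemma connect_zero (x z : A) : (forall i, val z i = 0%N) ->
  connect [rel a b | 0 < rate nu a b] x z && connect [rel a b | 0 < rate nu a b] z x.
Proof.
move=> z0; pose e := [rel a b : A | 0 < rate nu a b]; rewrite -/e.
have step (u v : A) i : val v = incr (val u) i -> e u v && e v u.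
  move=> vE; rewrite /e/= !rateE; apply/andP; split.
    rewrite ltr_pwDl//; last by apply: sumr_ge0 => j _; rewrite mulr_ge0.
    rewrite (bigD1 i)//= vE eqxx mul1r ltr_pwDl//.
    by apply: sumr_ge0 => j _; rewrite mulr_ge0// ltW.
  rewrite ltr_wpDl//; first by apply: sumr_ge0 => j _; rewrite mulr_ge0// ltW.
  rewrite (bigD1 i)//= vE incrK eqxx mul1r ltr_pwDl//.
    by rewrite ltr0n incrE eqxx addn1.
  by apply: sumr_ge0 => j _; rewrite mulr_ge0.
have [n] := ubnP (\sum_i val x i)%N; elim: n x => // n IH x; rewrite ltnS => xn.
have [/existsP[i xi]|] := boolP [exists i, (0 < val x i)%N]; last first.
  rewrite negb_exists => /forallP x0; rewrite (_ : x = z) ?connect0//.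
  by apply/val_inj/ffunP => i; apply/eqP; rewrite z0 -leqn0 leqNgt x0.
have yA : decr (val x) i \in A by apply: decr_mem; exact: valP.
pose y : A := [` yA]%fset.
have /andP[yx xy] : e y x && e x y by apply: (step y x i); rewrite /y/= decrK.
have /IH/andP[yz zy] : (\sum_j val y j < n)%N.
  apply: leq_trans xn; rewrite (bigD1 i)//= [ltnRHS](bigD1 i)//=.
  rewrite decrE eqxx subn1 -ltnS -addSn prednK// ltnS leq_add2l.
  by apply: leq_sum => j _; rewrite decrE leq_subr.
by rewrite (connect_trans (connect1 xy) yz) (connect_trans zy (connect1 yx)).
Qed.

Lemma rate_reversible_chain : reversible_chain (@rate R T A nu) (@stat_measure R T A nu).
Proof.
split.
- move=> x y; rewrite rateE addr_ge0// sumr_ge0// => i _; rewrite mulr_ge0//.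
  exact: ltW.
- by move=> x; exact: config_weight_gt0.
- by rewrite -mulr_suml divff// gt_eqF// sum_weight_gt0.
- move=> x y; rewrite !rateE !mulrDl addrC !mulr_suml; congr (_ + _).
    by apply: eq_bigr => i _; exact: esym (rate_balance (val y) (val x) i).
  by apply: eq_bigr => i _; exact: rate_balance (val x) (val y) i.
- move=> x y; case: A_nonzero => x0 [i [x0A _]].
  have zA : [ffun=> 0%N] \in A by apply: (A_decr x0A) => j; rewrite ffunE.
  have z0 j : val [` zA]%fset j = 0%N by rewrite /= ffunE.
  have /andP[xz _] := connect_zero x z0; have /andP[_ zy] := connect_zero y z0.
  exact: connect_trans xz zy.
Qed.

(** Each undirected edge is indexed by its lower end. Deaths are shifted to the lower end, where
    detailed balance gives them the weight of the opposite birth. *)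
Lemma sum_edges (H : config T -> config T -> R) :
  \sum_(x : A) \sum_(y : A) rate nu x y * w (val x) * H (val x) (val y) =
  \sum_(x : A) \sum_i (incr (val x) i \in A)%:R * nu i * w (val x) *
    (H (val x) (incr (val x) i) + H (incr (val x) i) (val x)).
Proof.
under eq_bigr => x _.
  under eq_bigr do rewrite -mulrA.
  rewrite (sum_rate x (fun y => w (val x) * H (val x) y)); over.
rewrite big_split/= [X in _ + X]exchange_big/=.
under [X in _ + X]eq_bigr => i _.
  rewrite (eq_bigr (fun x : A => (0 < val x i)%N%:R * ((val x i)%:R * (w (val x) * H (val x) (decr (val x) i))))); last first.
    by move=> x _; case: (val x i) => [|n]; rewrite ?mul0r// mul1r.
  rewrite (sum_shift i (fun x => (x i)%:R * (w x * H x (decr x i)))).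
  over.
rewrite [X in _ + X]exchange_big/= -big_split/=; apply: eq_bigr => x _.
rewrite -big_split/=; apply: eq_bigr => i _.
rewrite incrK incrE eqxx addn1.
have e : w (incr (fsval x) i) * (fsval x i).+1%:R = nu i * w (fsval x).
  exact: config_weight_incr.
rewrite (_ : (fsval x i).+1%:R * (_ * _) =
  (nu i * w (fsval x)) * H (incr (fsval x) i) (fsval x)); last by rewrite -e; ring.
by ring.
Qed.

End Configurations.

(** * Elementary inequalities for a coupled jump *)

Section CouplingBounds.
Context {R : realType}.
Implicit Types (a b t d e : R).

(** An edge with gradient a and mean t moves to one with gradient b and mean t'; d and e stand for
    the partial derivatives of [theta]. The difference of the two sides is half of a^2 times the
    concavity gap plus t (a - b)^2. *)
Lemma move_bound a b t t' d e (px py pu pv : R) : 0 <= t ->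
  t' <= d * pu + e * pv -> d * px + e * py = t ->
  2^-1 * (a ^+ 2 * t' - b ^+ 2 * t) <=
  2^-1 * a ^+ 2 * (d * (pu - px) + e * (pv - py)) - a * (b - a) * t.
Proof.
move=> t0 tt tE.
have h1 := mulr_ge0 (sqr_ge0 a) (eqbRL (subr_ge0 _ _) tt).
have h2 := mulr_ge0 t0 (sqr_ge0 (a - b)).
rewrite (_ : d * _ + e * _ = d * pu + e * pv - t); last by rewrite -tE; ring.
rewrite -subr_ge0 (_ : _ - _ = 2^-1 * (a ^+ 2 * (d * pu + e * pv - t') + t * (a - b) ^+ 2)).
  by rewrite mulr_ge0 ?invr_ge0// addr_ge0.
by field.
Qed.

(** Here the new gradient is 0. The gradient term gains a^2 t, the loss of mean costs half of it,
    and the nonnegative rest is dropped. *)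
Lemma coalescence_bound a t t' d e (px py pu pv : R) :
  t' <= d * pu + e * pv -> d * px + e * py = t -> 0 <= t' ->
  2^-1 * a ^+ 2 * t <=
  2^-1 * a ^+ 2 * (d * (pu - px) + e * (pv - py)) - a * (0 - a) * t.
Proof.
move=> tt tE t'0.
have h1 := mulr_ge0 (sqr_ge0 a) (le_trans t'0 tt).
rewrite (_ : d * _ + e * _ = d * pu + e * pv - t); last by rewrite -tE; ring.
rewrite -subr_ge0 (_ : _ - _ = 2^-1 * (a ^+ 2 * (d * pu + e * pv))).
  by rewrite mulr_ge0 ?invr_ge0.
by field.
Qed.

Lemma sum_linear (I : finType) (P : pred I) (c F G H K : I -> R) (m d e n : R) :
  m * (d * (\sum_(i | P i) c i * F i) + e * (\sum_(i | P i) c i * G i))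
  - n * ((\sum_(i | P i) c i * H i) - (\sum_(i | P i) c i * K i)) =
  \sum_(i | P i) c i * (m * (d * F i + e * G i) - n * (H i - K i)).
Proof.
rewrite !mulr_sumr -big_split/= mulr_sumr -sumrB mulr_sumr -sumrB.
by apply: eq_bigr => i _; ring.
Qed.

End CouplingBounds.

(** * The curvature inequality for the birth and death rates *)

Section CurvatureOfRates.
Context {R : realType} {T : finType} (A : {fset config T}) (nu : T -> R).
Context (A_decr : decreasing A).
Context (A_nonzero : exists x i, x \in A /\ (0 < x i)%N).
Context (nu_gt0 : forall i, 0 < nu i).
Context (eps0_le1 : eps0 A nu <= 1).
Implicit Types (x y z : config T) (i j : T) (f : config T -> R).
Local Notation w := (config_weight A nu).
Local Notation Q := (@rate R T A nu).
Local Notation pi := (@stat_measure R T A nu).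

(** The default 0 keeps an extended density nonnegative, so [theta] stays symmetric on all
    configurations. *)
Definition extend (F : A -> R) x := if insub x is Some u then F u else 0.

Lemma extendE F (u : A) : extend F (val u) = F u.
Proof. by rewrite /extend valK. Qed.

Definition config_lap f x :=
  \sum_j (incr x j \in A)%:R * nu j * (f (incr x j) - f x)
  + \sum_j (x j)%:R * (f (decr x j) - f x).

Lemma lap_rateE (F : A -> R) (u : A) : lap Q F u = config_lap (extend F) (val u).
Proof.
rewrite /config_lap -(sum_rate nu A_decr u (fun y => extend F y - extend F (val u))).
by rewrite /lap; apply: eq_bigr => v _; rewrite !extendE.
Qed.

Lemma incr2_mem x i j : incr (incr x i) j \in A -> incr x j \in A.
Proof. by rewrite incrC; exact: incr_mem. Qed.

(* The jumps from [x] and from [x + 1_i] are coupled: common births and the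
   deaths of [x] move both ends in parallel, the other births of [x], with the
   rates [uncoupled_birth], are coupled with the extra death of [x + 1_i]. *)
Definition uncoupled_birth x i j :=
  (incr x j \in A)%:R * (incr (incr x i) j \notin A)%:R * nu j.

Definition common_birth x i j := (incr (incr x i) j \in A)%:R * nu j.

(** The extra death of x + 1_i has rate 1. Uncoupled births at j <> i use up part of it; this is the
    remainder, nonnegative because [eps0] is at most 1. *)
Definition coalescence x i := 1 - \sum_(j | j != i) uncoupled_birth x i j.

(** The uncoupled birth at i itself is split off: it takes x to x + 1_i, so the two ends meet
    there. *)
Lemma config_lap_fst x i f : incr x i \in A -> config_lap f x =
  \sum_j common_birth x i j * (f (incr x j) - f x)
  + \sum_j (x j)%:R * (f (decr x j) - f x)
  + \sum_(j | j != i) uncoupled_birth x i j * (f (incr x j) - f x)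
  + uncoupled_birth x i i * (f (incr x i) - f x).
Proof.
move=> yA; rewrite -addrA [X in _ + X]addrC -(bigD1 (P := predT) i)//= addrAC.
rewrite -big_split/=; congr (_ + _); apply: eq_bigr => j _.
rewrite -mulrDl; congr (_ * _); rewrite /common_birth /uncoupled_birth.
have [h|h] := boolP (incr (incr x i) j \in A); last by rewrite mul0r add0r mulr1.
by rewrite (incr2_mem h)/= mulr0 mul0r addr0.
Qed.

Lemma config_lap_snd x i f : incr x i \in A -> config_lap f (incr x i) =
  \sum_j common_birth x i j * (f (incr (incr x i) j) - f (incr x i))
  + \sum_j (x j)%:R * (f (decr (incr x i) j) - f (incr x i))
  + \sum_(j | j != i) uncoupled_birth x i j * (f x - f (incr x i))
  + coalescence x i * (f x - f (incr x i)).
Proof.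
move=> yA; rewrite -[RHS]addrA -mulr_suml -mulrDl /coalescence.
rewrite [\sum_(_ | _) _ + (1 - _)]addrC subrK mul1r.
rewrite /config_lap -[RHS]addrA; congr (_ + _).
have -> : f x - f (incr x i) = \sum_j (j == i)%:R * (f (decr (incr x i) j) - f (incr x i)).
  rewrite (bigD1 i)//= eqxx mul1r incrK big1 ?addr0// => j /negPf ->.
  by rewrite mul0r.
by rewrite -big_split/=; apply: eq_bigr => j _; rewrite -mulrDl incrE natrD.
Qed.

(** The extremal terms are taken at x + 1_i, whose coordinate i is positive; there the configuration
    with one particle exchanged from i to j is x + 1_j. *)
Lemma coalescence_ge x i : incr x i \in A ->
  1 - eps0 A nu <= coalescence x i /\ eps1 A nu <= uncoupled_birth x i i.
Proof.
move=> yA; have yi : (0 < incr x i i)%N by rewrite incrE eqxx addn1.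
have [_ h0] := eps0_max nu A_nonzero; have [_ h1] := eps1_min nu A_nonzero.
split; last first.
  apply: le_trans (h1 _ _ yA yi) _.
  by rewrite /eps1_term /uncoupled_birth yA mul1r mulrC.
rewrite /coalescence lerD2l lerN2; apply: le_trans (h0 _ _ yA yi).
rewrite le_eqVlt; apply/orP; left; apply/eqP; apply: eq_bigr => j _.
by rewrite /uncoupled_birth incrC incrK; ring.
Qed.

Lemma uncoupled_birth_ge0 x i j : 0 <= uncoupled_birth x i j.
Proof. by rewrite mulr_ge0// ltW. Qed.

Lemma coalescence_ge0 x i : incr x i \in A -> 0 <= coalescence x i.
Proof.
by move=> /coalescence_ge[h _]; apply: le_trans h; rewrite subr_ge0.
Qed.

Section Potential.
Variables (p s : config T -> R).
Hypothesis p_gt0 : forall x, x \in A -> 0 < p x.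
Hypothesis p_ge0 : forall x, 0 <= p x.

Definition edge_theta x y := theta (p x) (p y).

(** Lower bound for a jump of the edge (x, y) to (u, v), as in [move_bound]. It changes sign when
    the two edges are exchanged, so it cancels against a coupling that is invariant under this
    exchange. *)
Definition edge_flux x y u v :=
  2^-1 * ((s x - s y) ^+ 2 * edge_theta u v - (s u - s v) ^+ 2 * edge_theta x y).

Definition edge_term x y :=
  2^-1 * (s x - s y) ^+ 2 *
    (dtheta (p x) (p y) * config_lap p x + dtheta (p y) (p x) * config_lap p y)
  - (s x - s y) * (config_lap s x - config_lap s y) * edge_theta x y.

(** The contribution to [edge_term] of one coupled jump from (x, y) to (u, v) at unit rate. *)
Let tau x y u v := 2^-1 * (s x - s y) ^+ 2 *
    (dtheta (p x) (p y) * (p u - p x) + dtheta (p y) (p x) * (p v - p y))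
  - (s x - s y) * edge_theta x y * ((s u - s x) - (s v - s y)).

Lemma edge_flux_antisym x y u v : edge_flux u v x y = - edge_flux x y u v.
Proof. by rewrite /edge_flux -[RHS]mulrN opprB. Qed.

Lemma edge_thetaC x y : edge_theta x y = edge_theta y x.
Proof. exact: thetaC. Qed.

Lemma edge_flux_le x y u v : x \in A -> y \in A -> u \in A -> v \in A ->
  edge_flux x y u v <= tau x y u v.
Proof.
move=> xA yA uA vA; have x0 := p_gt0 xA; have y0 := p_gt0 yA.
have := move_bound (s x - s y) (s u - s v) (ltW (theta_gt0 x0 y0))
  (theta_tangent x0 y0 (p_gt0 uA) (p_gt0 vA)) (theta_euler x0 y0).
move/le_trans; apply; rewrite le_eqVlt; apply/orP; left; apply/eqP.
by rewrite /tau /edge_theta; ring.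
Qed.

Lemma edge_coalesce_le x y u : x \in A -> y \in A -> u \in A ->
  2^-1 * (s x - s y) ^+ 2 * edge_theta x y <= tau x y u u.
Proof.
move=> xA yA uA; have x0 := p_gt0 xA; have y0 := p_gt0 yA.
have := coalescence_bound (s x - s y)
  (theta_tangent x0 y0 (p_gt0 uA) (p_gt0 uA)) (theta_euler x0 y0)
  (ltW (theta_gt0 (p_gt0 uA) (p_gt0 uA))).
move/le_trans; apply; rewrite le_eqVlt; apply/orP; left; apply/eqP.
by rewrite /tau /edge_theta; ring.
Qed.

Lemma edge_termE x i : incr x i \in A -> edge_term x (incr x i) =
  \sum_j common_birth x i j * tau x (incr x i) (incr x j) (incr (incr x i) j)
  + \sum_j (x j)%:R * tau x (incr x i) (decr x j) (decr (incr x i) j)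
  + \sum_(j | j != i) uncoupled_birth x i j * tau x (incr x i) (incr x j) x
  + coalescence x i * tau x (incr x i) x x
  + uncoupled_birth x i i * tau x (incr x i) (incr x i) (incr x i).
Proof.
move=> yA; rewrite /edge_term !(config_lap_fst _ yA) !(config_lap_snd _ yA).
rewrite {1 2 3}/tau -!sum_linear /tau; ring.
Qed.

(** Jumps to another edge are bounded by their flux. The two kinds of meeting jumps, at x and at x +
    1_i, each give half the energy of the edge, and their rates add up to at least 1 - eps0 +
    eps1. *)
Lemma edge_term_ge x i : incr x i \in A ->
  \sum_j common_birth x i j * edge_flux x (incr x i) (incr x j) (incr (incr x i) j)
  + \sum_j (x j)%:R * edge_flux x (incr x i) (decr x j) (decr (incr x i) j)
  + \sum_(j | j != i) uncoupled_birth x i j * edge_flux x (incr x i) (incr x j) x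
  + (1 - eps0 A nu + eps1 A nu) * (2^-1 * (s x - s (incr x i)) ^+ 2 * edge_theta x (incr x i))
  <= edge_term x (incr x i).
Proof.
move=> yA; have xA := incr_mem A_decr yA; rewrite edge_termE//.
have e0 : 0 <= 2^-1 * (s x - s (incr x i)) ^+ 2 * edge_theta x (incr x i).
  by rewrite mulr_ge0 ?theta_ge0// mulr_ge0 ?invr_ge0 ?sqr_ge0.
rewrite -[leRHS]addrA; apply: lerD; last first.
  have [h0 h1] := coalescence_ge yA.
  apply: le_trans (ler_wpM2r e0 (lerD h0 h1)) _; rewrite mulrDl lerD//.
    by rewrite ler_wpM2l ?coalescence_ge0// edge_coalesce_le.
  by rewrite ler_wpM2l ?uncoupled_birth_ge0// edge_coalesce_le.
apply: lerD; first apply: lerD.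
- apply: ler_sum => j _; rewrite /common_birth.
  have [jA|_] := boolP (incr (incr x i) j \in A); last by rewrite !mul0r.
  rewrite !mul1r ler_wpM2l ?(ltW (nu_gt0 j))// edge_flux_le//.
  exact: incr2_mem jA.
- apply: ler_sum => j _; have [->|xj] := posnP (x j); first by rewrite !mul0r.
  by rewrite ler_wpM2l// edge_flux_le// decr_mem.
- apply: ler_sum => j _; rewrite /uncoupled_birth.
  have [jA|_] := boolP (incr x j \in A); last by rewrite !mul0r.
  by rewrite ler_wpM2l ?edge_flux_le// mulr_ge0 ?(ltW (nu_gt0 j)).
Qed.

Let E x i : R := (incr x i \in A)%:R * nu i * w x.

(* The parallel births and deaths are time reversals of each other. *)
Lemma sum_parallel_flux :
  \sum_(u : A) \sum_i E (val u) i * (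
    \sum_j common_birth (val u) i j *
      edge_flux (val u) (incr (val u) i) (incr (val u) j) (incr (incr (val u) i) j)
    + \sum_j (val u j)%:R *
      edge_flux (val u) (incr (val u) i) (decr (val u) j) (decr (incr (val u) i) j)) = 0.
Proof.
pose F x i j := E x i * common_birth x i j *
  edge_flux x (incr x i) (incr x j) (incr (incr x i) j).
pose G x i j := E x i * (x j)%:R *
  edge_flux x (incr x i) (decr x j) (decr (incr x i) j).
transitivity (\sum_i \sum_j \sum_(u : A) F (val u) i j
              + \sum_i \sum_j \sum_(u : A) G (val u) i j).
  rewrite -big_split/= exchange_big/=; apply: eq_bigr => i _.
  rewrite [X in _ = X + _]exchange_big [X in _ = _ + X]exchange_big/=.
  rewrite -big_split/=; apply: eq_bigr => u _; rewrite mulrDr !mulr_sumr -big_split/=.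
  rewrite -big_split/=.
  by apply: eq_bigr => j _; rewrite /F /G !mulrA.
rewrite -big_split/=; apply: big1 => i _; rewrite -big_split/=; apply: big1 => j _.
(* Deaths at j are reindexed by their target. The detailed balance of the weights at x and x + 1_j
   then matches each with the opposite birth, whose flux has the opposite sign. *)
have -> : \sum_(u : A) G (val u) i j =
    \sum_(u : A) (incr (val u) j \in A)%:R * G (incr (val u) j) i j.
  rewrite -(sum_shift A_decr j (fun x => G x i j)); apply: eq_bigr => u _.
  by rewrite /G; case: (val u j) => [|n]; rewrite ?mulr0 ?mul0r// mul1r.
rewrite -big_split/=; apply: big1 => u _; rewrite /F /G.
move: (fsval u) => x.
rewrite incrK (incrC x j i) incrK -(incrC x j i) edge_flux_antisym incrE eqxx addn1 mulrN.
rewrite /E /common_birth (incrC x i j).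
have [ijA|ijA] := boolP (incr (incr x j) i \in A); last by rewrite !(mul0r, mulr0) oppr0 addr0.
have jA := incr_mem A_decr ijA.
have iA : incr x i \in A by move: ijA; rewrite incrC; exact: incr_mem.
rewrite jA iA !mul1r -[nu i * w (incr x j) * _]mulrA config_weight_incr.
generalize (edge_flux (incr x j) (incr (incr x j) i) x (incr x i)) (w x) => K W.
by ring.
Qed.

(** At fixed x the jump takes (x, x + 1_i) to (x + 1_j, x). Its total weight contains nu_i nu_j and
    is symmetric in i and j, while the flux changes sign under the swap. *)
Lemma sum_exchange_flux :
  \sum_(u : A) \sum_i E (val u) i * (\sum_(j | j != i) uncoupled_birth (val u) i j *
    edge_flux (val u) (incr (val u) i) (incr (val u) j) (val u)) = 0.
Proof.
apply: big1 => u _; set x := val u.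
pose F i j := (j != i)%:R * (E x i * (uncoupled_birth x i j * edge_flux x (incr x i) (incr x j) x)).
have -> : \sum_i E x i * (\sum_(j | j != i) uncoupled_birth x i j *
    edge_flux x (incr x i) (incr x j) x) = \sum_i \sum_j F i j.
  apply: eq_bigr => i _; rewrite mulr_sumr big_mkcond/=; apply: eq_bigr => j _.
  by rewrite /F; case: ifP => _; rewrite ?mul1r ?mul0r.
have FN i j : F i j = - F j i.
  rewrite /F eq_sym /E /uncoupled_birth (incrC x i j).
  rewrite /edge_flux (edge_thetaC (incr x j) x) (edge_thetaC (incr x i) x).
  generalize (edge_theta x (incr x j)) (edge_theta x (incr x i)).
  generalize (s x) (s (incr x i)) (s (incr x j)) (w x) (nu i) (nu j).
  generalize ((incr x i \in A)%:R : R) ((incr x j \in A)%:R : R).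
  generalize ((incr (incr x j) i \notin A)%:R : R) ((i != j)%:R : R) => *.
  by ring.
have SN : \sum_i \sum_j F i j = - \sum_i \sum_j F i j.
  rewrite {1}exchange_big/= -sumrN; apply: eq_bigr => i _.
  by rewrite -sumrN; apply: eq_bigr => j _; exact: FN.
by move: SN; generalize (\sum_i \sum_j F i j) => S; lra.
Qed.

Lemma sum_edge_term_ge :
  (1 - eps0 A nu + eps1 A nu) * (\sum_(u : A) \sum_i E (val u) i *
    (2^-1 * (s (val u) - s (incr (val u) i)) ^+ 2 * edge_theta (val u) (incr (val u) i)))
  <= \sum_(u : A) \sum_i E (val u) i * edge_term (val u) (incr (val u) i).
Proof.
set S := (X in _ * X <= _).
have -> : (1 - eps0 A nu + eps1 A nu) * S = 0 + 0 + (1 - eps0 A nu + eps1 A nu) * S.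
  by rewrite !add0r.
rewrite -[X in X + _ + _ <= _]sum_parallel_flux -[X in _ + X + _ <= _]sum_exchange_flux.
rewrite /S mulr_sumr -!big_split/=.
apply: ler_sum => u _; rewrite mulr_sumr -!big_split/=; apply: ler_sum => i _.
have [yA|yA] := boolP (incr (val u) i \in A); last by rewrite /E (negPf yA) !mul0r !mulr0 !addr0.
rewrite mulrCA -!mulrDr ler_wpM2l ?edge_term_ge//.
by rewrite mulr_ge0 ?(ltW (config_weight_gt0 A_nonzero nu_gt0 _))// mulr_ge0// ltW.
Qed.

End Potential.

Lemma curvature_rate : curvature Q pi (2^-1 * (1 - eps0 A nu + eps1 A nu)).
Proof.
move=> rho psi rho0; pose p := extend rho; pose s := extend psi.
have p_gt0 x : x \in A -> 0 < p x.
  by move=> xA; have := extendE rho [` xA]%fset; rewrite /p => /= ->.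
have p_ge0 x : 0 <= p x.
  by rewrite /p /extend; case: insubP => // u _ _; exact: ltW.
pose H1 x y := (s x - s y) ^+ 2 * edge_theta p x y.
have -> : \sum_x \sum_y (psi x - psi y) ^+ 2 * theta (rho x) (rho y) * Q x y * pi x
    = \sum_x \sum_y Q x y * w (val x) * H1 (val x) (val y).
  apply: eq_bigr => x _; apply: eq_bigr => y _.
  by rewrite /H1 /edge_theta /s /p !extendE -mulrA; exact: mulrC.
have -> : \sum_x \sum_y Q x y * pi x *
     (2^-1 * (psi x - psi y) ^+ 2 *
        (dtheta (rho x) (rho y) * lap Q rho x + dtheta (rho y) (rho x) * lap Q rho y)
      - (psi x - psi y) * (lap Q psi x - lap Q psi y) * theta (rho x) (rho y))
    = \sum_x \sum_y Q x y * w (val x) * edge_term p s (val x) (val y).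
  apply: eq_bigr => x _; apply: eq_bigr => y _.
  by rewrite /edge_term /edge_theta !lap_rateE -/p -/s /s /p !extendE.
rewrite !(sum_edges nu A_decr).
(* Both orientations of an edge are counted. The energy appears 4 times its half and [edge_term]
   twice, and this ratio yields the factor 1/2 of the constant. *)
have H1C x y : H1 x y + H1 y x = 4 * (2^-1 * (s x - s y) ^+ 2 * edge_theta p x y).
  by rewrite /H1 (edge_thetaC p_ge0 y x); field.
have H2C x y : edge_term p s x y + edge_term p s y x = 2 * edge_term p s x y.
  by rewrite /edge_term (edge_thetaC p_ge0 y x); ring.
under eq_bigr => u _.
  under eq_bigr => i _ do rewrite H1C mulrCA.
  rewrite -mulr_sumr; over.
under [leRHS]eq_bigr => u _.
  under eq_bigr => i _ do rewrite H2C mulrCA.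
  rewrite -mulr_sumr; over.
rewrite -!mulr_sumr /=.
have := sum_edge_term_ge s p_gt0 p_ge0.
set S1 := (X in _ * X <= _); set S2 := (X in _ <= X) => h.
rewrite (_ : _ * (4 * S1) = 2 * ((1 - eps0 A nu + eps1 A nu) * S1)); last by field.
by rewrite ler_pM2l.
Qed.

End CurvatureOfRates.

(** * Piecewise C^1 curves with common breakpoints *)

Section PiecewiseC1.
Context {R : realType} {I : finType}.
Implicit Types (a b c d m t : R) (S : pred I) (rho : R -> I -> R).

Definition C1_on (f : R -> R) a b :=
  exists2 g : R -> R, C1 g & {in `[a, b], f =1 g}.

Lemma C1_on_sub f a b c d : a <= c -> d <= b -> C1_on f a b -> C1_on f c d.
Proof.
move=> ac db [g gC fg]; exists g => // t; rewrite in_itv/= => /andP[ct td].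
by apply: fg; rewrite in_itv/= (le_trans ac ct) (le_trans td db).
Qed.

(* An inductive form of [piecewise_C1] for a family of functions with common
   breakpoints. *)
Inductive pwC1 S rho : R -> R -> Prop :=
| pwC1_base a b : a < b -> (forall x, S x -> C1_on (rho ^~ x) a b) -> pwC1 S rho a b
| pwC1_cat a m b : pwC1 S rho a m -> pwC1 S rho m b -> pwC1 S rho a b.

Lemma pwC1_lt S rho a b : pwC1 S rho a b -> a < b.
Proof. by elim=> // a0 m b0 _ am _ mb; exact: lt_trans mb. Qed.

Lemma pwC1_sub S rho a b c d : pwC1 S rho a b -> a <= c -> c < d -> d <= b ->
  pwC1 S rho c d.
Proof.
move=> H; elim: H c d => {a b} [a b ab Hb|a m b Ham IHam Hmb IHmb] c d ac cd db.
  by apply: pwC1_base => // x Sx; exact: C1_on_sub (Hb x Sx).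
have [dm|md] := leP d m; first exact: IHam.
have [mc|cm] := leP m c; first exact: IHmb.
by apply: (pwC1_cat (m := m)); [exact: IHam|apply: IHmb => //; exact: ltW].
Qed.

(** Common refinement of two subdivisions: each piece of the first is cut by the second. *)
Lemma pwC1_join S S' rho a b : pwC1 S rho a b -> pwC1 S' rho a b ->
  pwC1 (predU S S') rho a b.
Proof.
move=> H; elim: H => {a b} [a b ab Hb|a m b Ham IHam Hmb IHmb] H'.
  elim: H' Hb {ab} => {a b} [a b ab Hb'|a m b Ham IHam Hmb IHmb] Hb.
    by apply: pwC1_base => // x /orP[/Hb|/Hb'].
  have am := ltW (pwC1_lt Ham); have mb := ltW (pwC1_lt Hmb).
  apply: (pwC1_cat (m := m)); [apply: IHam|apply: IHmb] => x Sx.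
  - exact: C1_on_sub (Hb x Sx).
  - exact: C1_on_sub (Hb x Sx).
have am := pwC1_lt Ham; have mb := pwC1_lt Hmb.
apply: (pwC1_cat (m := m)); [apply: IHam|apply: IHmb].
- by apply: pwC1_sub H' _ _ _ => //; exact: ltW.
- by apply: pwC1_sub H' _ _ _ => //; exact: ltW.
Qed.

Lemma pwC1_subpred S S' rho a b : (forall x, S' x -> S x) ->
  pwC1 S rho a b -> pwC1 S' rho a b.
Proof.
move=> SS; elim=> {a b} [a b ab Hb|a m b _ Ham _ Hmb]; last exact: pwC1_cat Ham Hmb.
by apply: pwC1_base => // x /SS/Hb.
Qed.

Lemma pwC1_eq S rho rho' a b : {in `[a, b], rho =1 rho'} ->
  pwC1 S rho a b -> pwC1 S rho' a b.
Proof.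
move=> + H; elim: H => {a b} [a b ab Hb|a m b Ham IHam Hmb IHmb] E.
  apply: pwC1_base => // x /Hb[g gC rg]; exists g => // t tab.
  by rewrite -E// rg.
have am := ltW (pwC1_lt Ham); have mb := ltW (pwC1_lt Hmb).
apply: (pwC1_cat (m := m)); [apply: IHam|apply: IHmb] => t.
- by rewrite in_itv/= => /andP[h1 h2]; apply: E; rewrite in_itv/= h1 (le_trans h2).
- by rewrite in_itv/= => /andP[h1 h2]; apply: E; rewrite in_itv/= h2 (le_trans _ h1).
Qed.

Lemma piecewise_C1_pwC1 rho x : piecewise_C1 (rho ^~ x) -> pwC1 (pred1 x) rho 0 1.
Proof.
move=> [s [sp s1 Hs]].
have s0 : s != [::] by apply/eqP => e; move: s1; rewrite e/= => /eqP; rewrite eq_sym oner_eq0.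
suff H : forall a : R, path <%R a s -> (forall k, (k < size s)%N ->
    C1_on (rho ^~ x) (nth 0 (a :: s) k) (nth 0 s k)) ->
    pwC1 (pred1 x) rho a (last a s) by rewrite -s1; exact: H.
elim: s s0 {sp Hs s1} => // b s IH _ a /= /andP[ab bs] Hs.
have Hb : pwC1 (pred1 x) rho a b.
  by apply: pwC1_base => // y /eqP ->; have [g gC rg] := Hs 0%N isT; exists g.
case: s IH bs Hs => [|c s] IH bs Hs; first by [].
by apply: (pwC1_cat Hb); apply: IH => // k ks; exact: Hs k.+1 ks.
Qed.

Lemma piecewise_C1_pwC1_all rho : (forall x, piecewise_C1 (rho ^~ x)) ->
  pwC1 predT rho 0 1.
Proof.
move=> H; suff: pwC1 (mem (enum I)) rho 0 1.
  by apply: pwC1_subpred => x _; rewrite /= mem_enum.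
elim: (enum I) => [|x s IH]; first by apply: pwC1_base.
apply: pwC1_subpred (pwC1_join (piecewise_C1_pwC1 (H x)) IH) => y /=.
by rewrite inE.
Qed.

Lemma pwC1_piecewise_C1 rho x : pwC1 predT rho 0 1 -> piecewise_C1 (rho ^~ x).
Proof.
suff H a b : pwC1 predT rho a b -> exists s : seq R, [/\ path <%R a s, last a s = b &
    forall k, (k < size s)%N -> exists2 g : R -> R, C1 g &
      {in `[nth 0 (a :: s) k, nth 0 s k], rho ^~ x =1 g}] by exact: H.
elim=> {a b} [a b ab Hb|a m b _ [s1 [p1 l1 H1]] _ [s2 [p2 l2 H2]]].
  exists [:: b]; split; rewrite /= ?ab// => -[|//] _.
  by have [g gC rg] := Hb x isT; exists g.
exists (s1 ++ s2); split; rewrite ?cat_path ?last_cat ?l1 ?p1// => k.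
rewrite size_cat -cat_cons !nth_cat /= ltnS => ks.
have [k1|k1] := ltnP k (size s1); first by rewrite ltnW//; exact: H1.
have ks2 : (k - size s1 < size s2)%N by rewrite ltn_subLR.
have [g gC rg] := H2 _ ks2; exists g => //.
(* At k = [size s1] the left end is still read in [a :: s1], as its last entry m, while the right
   end is already the first entry of [s2]. *)
move: k1; rewrite leq_eqVlt => /predU1P[e|k1]; last first.
  by rewrite leqNgt k1/= subnS; case: (k - size s1)%N rg (subn_gt0 (size s1) k) => [_|n rg _]; rewrite ?k1.
move: rg; rewrite -e leqnn subnn /=.
by rewrite (_ : nth 0 (a :: s1) (size s1) = m)// -l1 (last_nth 0).
Qed.

End PiecewiseC1.

(** * Continuity of x ln x, measurability, primitives *)

Section EntropyDensity.
Context {R : realType}.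
Implicit Types (x t : R).

(** Follows from ln u <= u at u = x^(-1/2). It gives continuity of x ln x at 0, needed as densities
    may vanish. *)
Lemma xlnx_le x : `|x * ln x| <= 2 * Num.sqrt x \/ 1 < x.
Proof.
have [|x1] := ltP 1 x; [by right|left].
have [x0|x0] := leP x 0; first by rewrite ln0// mulr0 normr0 mulr_ge0// sqrtr_ge0.
have s0 : 0 < Num.sqrt x by rewrite sqrtr_gt0.
have e : x = Num.sqrt x * Num.sqrt x by rewrite -expr2 sqr_sqrtr// ltW.
have lx : ln x <= 0 by exact: ln_le0.
rewrite ler0_norm ?(mulr_ge0_le0 (ltW x0) lx)//.
set s := Num.sqrt x in s0 e *.
have h : ln s^-1 <= s^-1 by rewrite ltW// ln_sublinear// invr_gt0.
move: h; rewrite lnV// => h; rewrite e lnM ?posrE//.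
have := ler_wpM2l (ltW (mulr_gt0 s0 s0)) h.
have sn : s != 0 by rewrite gt_eqF.
rewrite (_ : s * s / s = s); last by field.
by lra.
Qed.

Lemma continuous_xlnx : continuous (fun x : R => x * ln x).
Proof.
move=> x; have [x0|x0|->] := ltgtP x 0.
- have n : \forall y \near x, 0 = y * ln y.
    by near=> y; rewrite ln0 ?mulr0//; apply/ltW; near: y; exact: lt_nbhsl.
  have e0 : x * ln x = 0 by rewrite ln0 ?mulr0 ?ltW.
  by rewrite /continuous_at e0; apply: cvg_trans (near_eq_cvg n) _; exact: cvg_cst.
- by apply: cvgM; [exact: cvg_id|exact: continuous_ln].
- rewrite /continuous_at mul0r; apply/cvgr0Pnorm_lt => e e0.
  near=> y.
  have y1 : y < 1 by near: y; exact: lt_nbhsl.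
  have [h|] := xlnx_le y; last by rewrite ltNge (ltW y1).
  apply: le_lt_trans h _.
  have ye : y < (e / 2) ^+ 2 by near: y; apply: lt_nbhsl; rewrite exprn_gt0// divr_gt0.
  rewrite mulrC -ltr_pdivlMr// -(ltr_pXn2r (n := 2))// ?nnegrE ?sqrtr_ge0 ?divr_ge0 ?(ltW e0)//.
  have [y0|/ltW y0] := leP 0 y; first by rewrite sqr_sqrtr.
  by rewrite ler0_sqrtr// expr0n/= exprn_gt0// divr_gt0.
Unshelve. all: by end_near. Qed.

End EntropyDensity.

Section MeasurableTheta.
Context {R : realType}.

Lemma continuous_expmean : continuous (@expmean R).
Proof. by move=> u; exact: is_derive_continuous (is_derive_expmean u). Qed.

Lemma measurable_theta (D : set R) (f g : R -> R) : measurable D ->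
  (forall t, D t -> 0 <= f t) -> (forall t, D t -> 0 <= g t) ->
  measurable_fun D f -> measurable_fun D g ->
  measurable_fun D (fun t => theta (f t) (g t)).
Proof.
move=> mD f0 g0 mf mg.
apply: (eq_measurable_fun (fun t => if (f t == 0) || (g t == 0) then 0
    else g t * expmean (ln (f t) - ln (g t)))).
  move=> t; rewrite inE => Dt; case: ifPn => [/orP[/eqP ->|/eqP ->]|].
  - by rewrite theta0l.
  - by rewrite theta0r.
  rewrite negb_or => /andP[fn gn].
  by rewrite thetaE// lt_neqAle eq_sym ?fn ?gn /= ?f0 ?g0.
have ml (h : R -> R) : measurable_fun D h -> measurable_fun D (fun t => ln (h t)).
  by move=> mh; apply: measurableT_comp => //; exact: measurable_ln.
have m2 : measurable_fun D (fun t => g t * expmean (ln (f t) - ln (g t))).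
  apply: measurable_funM => //; apply: measurableT_comp.
    by apply: continuous_measurable_fun; exact: continuous_expmean.
  by apply: measurable_funB; exact: ml.
apply: measurable_fun_if => //.
- by apply: measurable_or; exact: measurable_fun_eqr.
- by apply: measurable_funS m2.
Qed.

Lemma pwC1_measurable (I : finType) (rho : R -> I -> R) (a b : R) x :
  pwC1 predT rho a b -> measurable_fun `[a, b] (rho ^~ x).
Proof.
elim=> {a b} [a b ab /(_ x isT)[g [gd gc] rg]|a m b Ham IHam Hmb IHmb].
  apply: (eq_measurable_fun g) => [t|]; first by rewrite inE => /rg.
  apply: measurable_funTS; apply: continuous_measurable_fun => t.
  by apply/differentiable_continuous/derivable1_diffP.
have am := ltW (pwC1_lt Ham); have mb := ltW (pwC1_lt Hmb).
rewrite (_ : `[a, b]%classic = `[a, m] `|` `[m, b]).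
  by apply/measurable_funU.
apply/seteqP; split => t /=; rewrite !in_itv/=.
  move=> /andP[at_ tb]; have [tm|/ltW mt] := leP t m; [left|right].
    by rewrite at_.
  by rewrite mt.
by move=> [/andP[-> tm]|/andP[mt ->]]; rewrite ?(le_trans tm mb) ?(le_trans am mt).
Qed.

End MeasurableTheta.

Section C1Functions.
Context {R : realType}.
Implicit Types (f g : R -> R) (a b t : R).

Lemma C1_is_derive g t : C1 g -> is_derive t 1 g (derive1 g t).
Proof. by move=> [gd _]; apply: DeriveDef; [exact: gd|rewrite derive1E]. Qed.

Lemma is_derive_C1 g (g' : R -> R) : (forall t, is_derive t 1 g (g' t)) ->
  continuous g' -> C1 g /\ derive1 g = g'.
Proof.
move=> gd gc; have e : derive1 g = g'.
  by apply/funext => t; have h := gd t; rewrite derive1E derive_val.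
by split => //; split; [move=> t; have h := gd t; exact: ex_derive|rewrite e].
Qed.

Lemma continuous_on_FTC2 (F f : R -> R) a b : a < b ->
  (forall t, a <= t <= b -> is_derive t 1 F (f t)) ->
  (forall t, a <= t <= b -> {for t, continuous f}) ->
  (\int[lebesgue_measure]_(t in `]a, b[) (f t)%:E = (F b - F a)%:E)%E.
Proof.
move=> ab Fd fc.
have mf : measurable_fun `]a, b[ (EFin \o f).
  apply/measurable_EFinP; apply: open_continuous_measurable_fun; first exact: interval_open.
  by move=> t; rewrite inE/= in_itv/= => /andP[/ltW h1 /ltW h2]; apply: fc; rewrite h1.
rewrite -(integral_itv_bndoo true false mf) (continuous_FTC2 (F := F) ab)//.
- apply: continuous_in_subspaceT => t; rewrite inE/= in_itv/=; exact: fc.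
- split.
  + move=> t; rewrite in_itv/= => /andP[/ltW h1 /ltW h2].
    have h : is_derive t 1 F (f t) by apply: Fd; rewrite h1.
    exact: ex_derive.
  + apply: cvg_at_right_filter; apply: is_derive_continuous (Fd a _).
    by rewrite lexx ltW.
  + apply: cvg_at_left_filter; apply: is_derive_continuous (Fd b _).
    by rewrite lexx ltW.
- move=> t; rewrite in_itv/= => /andP[/ltW h1 /ltW h2].
  have h : is_derive t 1 F (f t) by apply: Fd; rewrite h1.
  by rewrite derive1E derive_val.
Qed.

(** Clamping the argument to [a, b] makes [f] continuous on the line, and integrating from a - 1
    puts a in the interior, so that the derivative at a is two-sided. *)
Lemma exists_primitive a b f : a <= b ->
  (forall t, a <= t <= b -> {for t, continuous f}) ->
  exists V v : R -> R, [/\ forall t, a <= t <= b -> is_derive t 1 V (v t),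
    continuous v & forall t, a <= t <= b -> v t = f t].
Proof.
move=> ab fc; pose clamp t := Num.max a (Num.min b t).
have cab t : a <= clamp t <= b by rewrite /clamp le_max lexx ge_max ab ge_min lexx.
have cE t : a <= t <= b -> clamp t = t.
  by move=> /andP[h1 h2]; rewrite /clamp min_r// max_r.
pose v t := f (clamp t).
have vc : continuous v.
  move=> t; apply: (continuous_comp (f := clamp)); last exact: fc.
  apply: continuous_max; first exact: cvg_cst.
  by apply: continuous_min; [exact: cvg_cst|exact: cvg_id].
exists (fun t => \int[lebesgue_measure]_(s in `[a - 1, t]) v s), v; split => //.
  move=> t /andP[h1 h2].
  have tb : t < b + 1 by rewrite (le_lt_trans h2)// ltrDl.
  have at1 : a - 1 < t by rewrite (lt_le_trans _ h1)// ltrBlDr ltrDl.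
  have [d1 d2] := continuous_FTC1_closed tb (continuous_integrable_segment _ _ vc) at1 (vc t).
  by apply: DeriveDef; [exact: d1|rewrite -derive1E; exact: d2].
by move=> t /cE e; rewrite /v e.
Qed.

End C1Functions.

(** * Chains of smooth curves and their evolution under the heat flow *)

Section SmoothCurves.
Context {R : realType} {X : finType} (Q : X -> X -> R) (pi : X -> R).
Context (QP : reversible_chain Q pi).
Implicit Types (x y z : X) (r g : R -> X -> R) (p q f : X -> R) (a b c s t : R).
Local Notation lap := (lap Q).
Local Notation ip := (ip pi).
Local Notation heat := (heat Q).
Local Notation dual_le := (dual_le Q pi).

Lemma heat_lap_sum t f x :
  \sum_y f y * heat t (lap (delta y)) x = lap (heat t f) x.
Proof.
rewrite /lap; under eq_bigr => y _.
  rewrite (heat_lap QP) /lap mulr_sumr; over.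
rewrite exchange_big/=; apply: eq_bigr => z _.
rewrite (heatE QP t f z) (heatE QP t f x) -sumrB mulr_sumr.
by apply: eq_bigr => y _; ring.
Qed.

Lemma is_derive_heat_curve g (dg : X -> R) (al be t : R) x :
  (forall y, is_derive t 1 (g ^~ y) (dg y)) ->
  is_derive t 1 (fun u => heat (al * u + be) (g u) x)
    (heat (al * t + be) dg x + al * lap (heat (al * t + be) (g t)) x).
Proof.
move=> gd.
have h y := is_deriveMf (gd y) (@is_derive_compf _ _ (fun u => al * u + be)
  _ _ _ (is_derive_heat QP (al * t + be) (delta y) x) (is_derive_affine al be t)).
have H := is_derive_bigsum (P := predT) (fun y _ => h y).
rewrite (_ : (fun u => heat _ _ _) =
    fun u => \sum_y g u y * heat (al * u + be) (delta y) x); last first.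
  by apply/funext => u; rewrite (heatE QP).
apply: is_derive_eq; rewrite big_split/= -(heatE QP); congr (_ + _).
by rewrite -heat_lap_sum mulr_sumr; apply: eq_bigr => y _; rewrite mulrA mulrC.
Qed.

Lemma continuous_heat_curve (f0 : R -> X -> R) (al be t : R) x :
  (forall y, {for t, continuous (f0 ^~ y)}) ->
  {for t, continuous (fun u => heat (al * u + be) (f0 u) x)}.
Proof.
move=> fc; rewrite (_ : (fun u => _) =
    fun u => \sum_y f0 u y * heat (al * u + be) (delta y) x); last first.
  by apply/funext => u; rewrite (heatE QP).
apply: continuous_bigsum => y; apply: cvgM; first exact: fc.
exact: is_derive_continuous (@is_derive_compf _ _ (fun u => al * u + be) _ _ _ (is_derive_heat QP _ _ _) (is_derive_affine al be t)).
Qed.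

Lemma heat_curve_C1 g (al be : R) : (forall y, C1 (g ^~ y)) ->
  let dg t y := derive1 (g ^~ y) t in
  forall x, C1 (fun u => heat (al * u + be) (g u) x) /\
  derive1 (fun u => heat (al * u + be) (g u) x) =
  fun t => heat (al * t + be) (dg t) x + al * lap (heat (al * t + be) (g t)) x.
Proof.
move=> gC dg x; apply: is_derive_C1 => t.
  by apply: is_derive_heat_curve => y; exact: C1_is_derive.
have gc y : {for t, continuous (g ^~ y)} := is_derive_continuous (C1_is_derive t (gC y)).
apply: cvgD; first by apply: continuous_heat_curve => y; exact: (gC y).2.
apply: cvgM; first exact: cvg_cst.
apply: continuous_bigsum => z; apply: cvgM; first exact: cvg_cst.
by apply: cvgB; exact: continuous_heat_curve.
Qed.

Lemma ip1E f : ip f (fun=> 1) = \sum_x f x * pi x.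
Proof. by apply: eq_bigr => x _; rewrite mulr1. Qed.

(** [dform] vanishes on constants, so a linear function of the constant k would be bounded above
    unless its slope is 0. *)
Lemma dual_mass p f c : dual_le p f c -> ip f (fun=> 1) = 0.
Proof.
move=> H; have K k : 2 * k * ip f (fun=> 1) <= c.
  have := H (fun=> k); rewrite /dform big1 ?mulr0 ?subr0; last first.
    by move=> x _; rewrite big1// => y _; rewrite subrr !mul0r.
  rewrite (_ : ip f (fun=> k) = k * ip f (fun=> 1)); last first.
    by rewrite /ip mulr_sumr; apply: eq_bigr => x _; ring.
  by rewrite mulrA.
apply/eqP; apply/negP => /negP n0.
have := K ((c + 1) / (2 * ip f (fun=> 1))).
rewrite (_ : _ * _ = c + 1); last by field.
by rewrite leNgt ltrDl ltr01.
Qed.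

Lemma dual_ge0 p f c : dual_le p f c -> 0 <= c.
Proof.
move=> /(_ (fun=> 0)); rewrite /dform /ip !big1 ?mulr0 ?subrr// => x _.
  by rewrite big1// => y _; rewrite !mul0r.
by rewrite mulr0 mul0r.
Qed.

Lemma dual_scale p f c (k : R) : (forall x, 0 <= p x) -> dual_le p f c ->
  dual_le p (fun x => k * f x) (k ^+ 2 * c).
Proof.
move=> p0 H phi; have [->|k0] := eqVneq k 0.
  rewrite (_ : ip _ _ = 0) ?mulr0 ?expr0n/= ?mul0r ?sub0r ?oppr_le0.
    exact: (dform_ge0 QP).
  by rewrite /ip big1// => x _; rewrite !mul0r.
have := ler_wpM2l (sqr_ge0 k) (H (fun x => k^-1 * phi x + 0 * phi x)).
rewrite dform_sq ipC ip_lincomb; apply: le_trans.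
rewrite (_ : ip (fun x => k * f x) phi = k * ip f phi); last first.
  by rewrite /ip mulr_sumr; apply: eq_bigr => x _; ring.
by rewrite (ipC pi f) le_eqVlt; apply/orP; left; apply/eqP; field.
Qed.

Lemma heat_pos t f x : 0 <= t -> (forall y, 0 < f y) -> 0 < heat t f x.
Proof.
rewrite le_eqVlt => /predU1P[<-|t0] f0; first by rewrite heat0.
by apply: (heat_gt0 QP _ t0 _ (f0 x)) => y; exact: ltW.
Qed.

Lemma is_derive_entropy r (f : X -> R) t : (forall x, 0 < r t x) ->
  (forall x, is_derive t 1 (r ^~ x) (f x)) ->
  is_derive t 1 (fun u => entropy pi (r u))
    (ip f (fun x => ln (r t x)) + ip f (fun=> 1)).
Proof.
move=> r0 rd.
have h x := is_deriveMf (is_deriveZf (pi x) (rd x)) (is_derive_lnf (r0 x) (rd x)).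
have H := is_derive_bigsum (P := predT) (fun x _ => h x).
apply: is_derive_eq; rewrite /ip -big_split; apply: eq_bigr => x _ /=.
have rn : r t x != 0 by rewrite gt_eqF.
by field.
Qed.

Lemma continuous_ip (f0 g0 : R -> X -> R) t : (forall y, {for t, continuous (f0 ^~ y)}) ->
  (forall y, {for t, continuous (g0 ^~ y)}) ->
  {for t, continuous (fun u => ip (f0 u) (g0 u))}.
Proof.
move=> fc gc; apply: continuous_bigsum => x; apply: cvgM; last exact: cvg_cst.
by apply: cvgM; [exact: fc|exact: gc].
Qed.

(* A smooth curve of positive densities whose squared speed is at most [v = V']. *)
Record piece a b r (V v : R -> R) : Prop := Piece {
  piece_lt : a < b;
  piece_C1 : forall x, C1 (r ^~ x);
  piece_gt0 : forall t x, a <= t <= b -> 0 < r t x;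
  piece_mass : forall t, a <= t <= b -> ip (r t) (fun=> 1) = 1;
  piece_derive : forall t, a <= t <= b -> is_derive t 1 V (v t);
  piece_continuous : forall t, a <= t <= b -> {for t, continuous v};
  piece_dual : forall t, a < t < b ->
    dual_le (r t) (fun x => derive1 (r ^~ x) t) (v t) }.

Lemma piece_affine a b r V v (k e a' b' : R) : piece a b r V v -> a' < b' ->
  (forall t, a' <= t <= b' -> a <= k * t + e <= b) ->
  (forall t, a' < t < b' -> a < k * t + e < b) ->
  piece a' b' (fun t => r (k * t + e)) (fun t => k * V (k * t + e))
    (fun t => k ^+ 2 * v (k * t + e)).
Proof.
move=> P ab' cl op.
have rd x t : is_derive t 1 (fun u => r (k * u + e) x) (k * derive1 (r ^~ x) (k * t + e)).
  rewrite mulrC; apply: (@is_derive_compf _ (r ^~ x) (fun u => k * u + e)).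
    by apply: C1_is_derive; exact: piece_C1 P x.
  exact: is_derive_affine.
have ac t : {for t, continuous (fun u => k * u + e)} := is_derive_continuous (is_derive_affine k e t).
have rC x : C1 (fun u => r (k * u + e) x) /\
    derive1 (fun u => r (k * u + e) x) = fun t => k * derive1 (r ^~ x) (k * t + e).
  apply: is_derive_C1 => // t; apply: cvgM; first exact: cvg_cst.
  exact: continuous_comp (ac t) ((piece_C1 P x).2 (k * t + e)).
split => //.
- by move=> x; case: (rC x).
- by move=> t x /cl h; exact: (piece_gt0 P x h).
- by move=> t /cl h; exact: (piece_mass P h).
- move=> t /cl h; have hh := is_deriveZf k (@is_derive_compf _ _ (fun u => k * u + e) _ _ _ (piece_derive P h) (is_derive_affine k e t)).
  by apply: is_derive_eq; rewrite expr2; ring.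
- move=> t /cl h; apply: cvgM; first exact: cvg_cst.
  exact: continuous_comp (ac t) (piece_continuous P h).
- move=> t h; have := op _ h => h'.
  have e1 : (fun x => derive1 (fun u => r (k * u + e) x) t) = fun x => k * derive1 (r ^~ x) (k * t + e).
    by apply/funext => x; case: (rC x) => _ ->.
  rewrite e1; apply: dual_scale; last exact: piece_dual P _ h'.
  by move=> x; apply/ltW/(piece_gt0 P); move: h' => /andP[/ltW -> /ltW ->].
Qed.

Context (kappa : R) (kappa_ge0 : 0 <= kappa) (HC : curvature Q pi kappa).

Lemma dual_heat_ge0 p f c t : 0 <= t -> (forall x, 0 <= p x) ->
  (exists x, 0 < p x) -> dual_le p f c ->
  dual_le (heat t p) (heat t f) (expR (- (2 * kappa) * t) * c).
Proof.
rewrite le_eqVlt => /predU1P[<-|t0] p0 pp H; last exact: dual_heat.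
rewrite mulr0 expR0 mul1r.
have e (f0 : X -> R) : heat 0 f0 = f0 by apply/funext => x; rewrite heat0.
by rewrite !e.
Qed.

(** The flow adds h times [lap] to the velocity. By [dual_entropy] the speed bound then drops by 2 h
    times the derivative of the entropy, so its primitive drops by 2 h times the entropy. *)
Lemma piece_heat a b r V v h t0 : piece a b r V v -> 0 <= h -> t0 <= a ->
  exists v', piece a b (fun t => heat (h * t + - (h * t0)) (r t))
    (fun t => V t - 2 * h * entropy pi (heat (h * t + - (h * t0)) (r t))) v'.
Proof.
move=> P h0 t0a.
pose dr t x := derive1 (r ^~ x) t; pose tau t := h * t + - (h * t0).
pose q t := heat (tau t) (r t).
pose dq t x := heat (tau t) (dr t) x + h * lap (q t) x.
have tau0 t : a <= t -> 0 <= tau t.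
  by move=> at_; rewrite /tau subr_ge0 ler_wpM2l// (le_trans t0a).
have qC x := heat_curve_C1 h (- (h * t0)) (piece_C1 P) x.
have q0 t x : a <= t <= b -> 0 < q t x.
  by move=> /[dup] tab /andP[at_ _]; apply: heat_pos; [exact: tau0|move=> y; exact: piece_gt0 P _ _ tab].
have qd t x : is_derive t 1 (q ^~ x) (dq t x).
  by have [C e] := qC x; have := C1_is_derive t C; rewrite e.
have dqc t y : {for t, continuous (dq ^~ y)}.
  by have [[_ C] e] := qC y; have := C t; rewrite e.
have lnc t y : a <= t <= b -> {for t, continuous (fun u => ln (q u y))}.
  by move=> tab; exact: is_derive_continuous (@is_derive_lnf _ (q ^~ y) t _ (q0 t y tab) (qd t y)).
exists (fun t => v t - 2 * h * (ip (dq t) (fun x => ln (q t x)) + ip (dq t) (fun=> 1))).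
split => //; first exact: piece_lt P.
- by move=> x; case: (qC x).
- by move=> t /(piece_mass P) m; rewrite (heat_mass QP).
- move=> t tab; apply: is_deriveBf; first exact: piece_derive P t tab.
  apply: is_deriveZf.
  exact: (is_derive_entropy (fun x => q0 t x tab) (fun x => qd t x)).
- move=> t tab; apply: cvgB; first exact: piece_continuous P t tab.
  apply: cvgM; first exact: cvg_cst.
  apply: cvgD; apply: continuous_ip => y //; first exact: lnc.
  exact: cvg_cst.
- move=> t /[dup] /andP[/ltW at_ /ltW tb] tab.
  have tab' : a <= t <= b by rewrite at_.
  have D := piece_dual P tab; have r0 x := piece_gt0 P x tab'.
  have [x0|X0] := pickP (@predT X); last first.
    have := piece_mass P tab'; rewrite /ip big1 ?(esym (oner_neq0 _)) => [|x]; last by have := X0 x.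
    by move=> /eqP; rewrite eq_sym oner_eq0.
  move=> _; have D1 := dual_heat_ge0 (tau0 t at_) (fun x => ltW (r0 x)) (ex_intro _ x0 (r0 x0)) D.
  (* The decay factor is only bounded by 1 here; the gain in the final estimate is made at the grid
     nodes. *)
  have D2 : dual_le (q t) (heat (tau t) (dr t)) (v t).
    move=> phi; apply: le_trans (D1 phi) _; rewrite ler_piMl ?(dual_ge0 D)//.
    by rewrite -expR0 ler_expR mulNr oppr_le0 mulr_ge0 ?mulr_ge0// tau0.
  have := dual_entropy QP (fun x => q0 t x tab') (fun x => erefl (dq t x)) D2.
  have -> : (fun x => derive1 (fun u => heat (h * u + - (h * t0)) (r u) x) t) = dq t.
    by apply/funext => x; have [_ ->] := qC x.
  move=> D3; by rewrite (dual_mass D3) addr0.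
Qed.

Lemma piece_integral a b r V v : piece a b r V v ->
  (\int[lebesgue_measure]_(t in `]a, b[) (v t)%:E = (V b - V a)%:E)%E.
Proof.
move=> P; apply: continuous_on_FTC2 => [|t|t]; first exact: piece_lt P.
- exact: piece_derive P t.
- exact: piece_continuous P t.
Qed.

Definition speed r t := let psi := solve Q pi (r t) (fun x => derive1 (r ^~ x) t) in
  dform Q pi (r t) psi psi.

Lemma constant_mass_derive r a b t : (forall x, C1 (r ^~ x)) ->
  (forall t, a <= t <= b -> ip (r t) (fun=> 1) = 1) -> a < t < b ->
  ip (fun x => derive1 (r ^~ x) t) (fun=> 1) = 0.
Proof.
move=> rC r1 tab.
have h1 := is_derive_ip pi (fun x => C1_is_derive t (rC x)) (fun x => is_deriveCf 1 t).
have h2 : is_derive t 1 (fun u => ip (r u) (fun=> 1)) 0.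
  apply: (@near_eq_is_derive R R R (fun=> 1 : R)) => //.
  near=> u; apply/esym/r1; apply/andP; split.
    by apply: ltW; near: u; apply: lt_nbhsr; case/andP: tab.
  by apply: ltW; near: u; apply: lt_nbhsl; case/andP: tab.
have := is_derive_unique h1 h2; rewrite [X in _ + X](_ : _ = 0) ?addr0//.
by rewrite /ip big1// => x _; rewrite mulr0 mul0r.
Unshelve. all: by end_near. Qed.

Lemma piece_speed r a b : a < b -> (forall x, C1 (r ^~ x)) ->
  (forall t x, a <= t <= b -> 0 < r t x) ->
  (forall t, a <= t <= b -> ip (r t) (fun=> 1) = 1) ->
  exists V v, piece a b r V v /\ forall t, a <= t <= b -> v t = speed r t.
Proof.
move=> ab rC r0 r1.
have sc t : a <= t <= b -> {for t, continuous (speed r)}.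
  move=> tab; have rc y : {for t, continuous (r ^~ y)} := is_derive_continuous (C1_is_derive t (rC y)).
  have fc y : {for t, continuous ((fun u x => derive1 (r ^~ x) u) ^~ y)} := (rC y).2 t.
  by apply: continuous_dform => // y; try exact: r0; apply: (continuous_solve QP) => // z; exact: r0.
have [V [v [Vd vc vE]]] := exists_primitive (ltW ab) sc.
exists V, v; split => //; split => // t; first by move=> _; exact: vc.
move=> tab; have tab' : a <= t <= b by case/andP: tab => /ltW -> /ltW ->.
rewrite vE// /speed; set f := fun x => _; set psi := solve _ _ _ _.
have -> : f = onsager Q (r t) psi.
  apply/funext => x; rewrite (onsager_solve QP)// => [y|]; first exact: r0.
  exact: constant_mass_derive r1 tab.
by apply: (dual_onsager QP) => y; apply/ltW/r0.
Qed.

(* Chains of smooth pieces, of total action at most [c], from [p] at time [a]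
   to [q] at time [b]. *)
Inductive conn : R -> R -> (X -> R) -> (X -> R) -> R -> Prop :=
| conn_base a b r V v c : piece a b r V v -> V b - V a <= c ->
    conn a b (r a) (r b) c
| conn_cat a m b p o q c d : conn a m p o c -> conn m b o q d ->
    conn a b p q (c + d).

Lemma conn_lt a b p q c : conn a b p q c -> a < b.
Proof.
by elim=> [? ? ? ? ? ? P _|a0 m b0 ? ? ? ? ? _ am _]; [exact: piece_lt P|exact: lt_trans].
Qed.

Lemma conn_le a b p q c d : c <= d -> conn a b p q c -> conn a b p q d.
Proof.
move=> + H; elim: H d => [{}a {}b r V v c0 P h|{}a m {}b {}p o {}q c0 c1 H1 IH1 H2 IH2] d cd.
  exact: conn_base P (le_trans h cd).
by rewrite -(subrKC c0 d); apply: conn_cat H1 _; apply: IH2; rewrite lerBrDl.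
Qed.

Lemma conn_scale a b p q c (k e : R) : 0 < k -> conn a b p q c ->
  conn (k * a + e) (k * b + e) p q (c / k).
Proof.
move=> k0; have kn : k != 0 by rewrite gt_eqF.
elim=> [{}a {}b r V v {}c P h|{}a m {}b {}p o {}q c0 c1 _ IH1 _ IH2]; last first.
  by rewrite mulrDl; exact: conn_cat IH1 IH2.
have K (t : R) : k^-1 * (k * t + e) + - (k^-1 * e) = t by field.
have K' (t : R) : k * (k^-1 * t + - (k^-1 * e)) + e = t by field.
have cl (u w t : R) : k * u + e <= t <= k * w + e -> u <= k^-1 * t + - (k^-1 * e) <= w.
  by rewrite -{1 2}(K' t) !lerD2r !ler_pM2l.
have op (u w t : R) : k * u + e < t < k * w + e -> u < k^-1 * t + - (k^-1 * e) < w.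
  by rewrite -{1 2}(K' t) !ltrD2r !ltr_pM2l.
have ab' : k * a + e < k * b + e by rewrite ltrD2r ltr_pM2l// (piece_lt P).
have P' := piece_affine P ab' (cl a b) (op a b).
have /(conn_base P') : k^-1 * V (k^-1 * (k * b + e) + - (k^-1 * e)) -
    k^-1 * V (k^-1 * (k * a + e) + - (k^-1 * e)) <= c / k.
  by rewrite !K -mulrBr mulrC ler_wpM2r// invr_ge0 ltW.
by rewrite !K.
Qed.

Lemma conn_rev a b p q c : conn a b p q c -> conn (- b) (- a) q p c.
Proof.
elim=> [{}a {}b r V v {}c P h|{}a m {}b {}p o {}q c0 c1 _ IH1 _ IH2]; last first.
  by rewrite addrC; exact: conn_cat IH2 IH1.
have K (t : R) : -1 * - t + 0 = t by ring.
have cl t : - b <= t <= - a -> a <= -1 * t + 0 <= b.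
  by move=> /andP[h1 h2]; apply/andP; split; lra.
have op t : - b < t < - a -> a < -1 * t + 0 < b.
  by move=> /andP[h1 h2]; apply/andP; split; lra.
have ab' : - b < - a by rewrite ltrN2 (piece_lt P).
have P' := piece_affine P ab' cl op.
have /(conn_base P') : -1 * V (-1 * - a + 0) - -1 * V (-1 * - b + 0) <= c.
  by rewrite !K; apply: le_trans h; lra.
by rewrite !K.
Qed.

(* The flow of the heat semigroup, run for a time proportional to the
   parameter of the curve, trades action for entropy. *)
Lemma conn_heat a b p q c h t0 : conn a b p q c -> 0 <= h -> t0 <= a ->
  let p' := heat (h * (a - t0)) p in let q' := heat (h * (b - t0)) q in
  conn a b p' q' (c + 2 * h * (entropy pi p' - entropy pi q')).
Proof.
move=> H h0; elim: H => [{}a {}b r V v {}c P H|{}a m {}b {}p o {}q c0 c1 H1 IH1 H2 IH2] t0a /=.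
  have [v' P'] := piece_heat P h0 t0a.
  rewrite !(mulrBr h); apply: (conn_le _ (conn_base P' (lexx _))).
  by move: H; lra.
have am := conn_lt H1.
have := conn_cat (IH1 t0a) (IH2 (le_trans t0a (ltW am))); apply: conn_le.
by lra.
Qed.

End SmoothCurves.

(** * Passing between admissible curves and chains of smooth pieces *)

Section AdmissibleCurves.
Context {R : realType} {X : finType} (Q : X -> X -> R) (pi : X -> R).
Context (QP : reversible_chain Q pi).
Implicit Types (x y z : X) (rho psi : R -> X -> R) (p q f : X -> R) (a b c s t m : R).
Local Notation mu := (@lebesgue_measure R).
Local Notation dform := (dform Q pi).
Local Notation heat := (heat Q).
Local Notation dual_le := (dual_le Q pi).
Local Notation onsager := (onsager Q).
Local Notation ip := (ip pi).

Lemma density_ip p : density pi p <-> (forall x, 0 <= p x) /\ ip p (fun=> 1) = 1.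
Proof. by rewrite ip1E. Qed.

Lemma density_exists_gt0 p : density pi p -> exists x, 0 < p x.
Proof.
move=> [p0 p1]; apply/not_existsP => H.
have : \sum_x p x * pi x = 0.
  apply: big1 => x _; rewrite (_ : p x = 0) ?mul0r//; apply/le_anti.
  by rewrite p0 andbT leNgt; apply/negP/H.
by rewrite p1 => /eqP; rewrite oner_eq0.
Qed.

Lemma measurable_dform (D : set R) rho psi : measurable D ->
  (forall x, measurable_fun D (rho ^~ x)) -> (forall t x, D t -> 0 <= rho t x) ->
  (forall x, measurable_fun D (psi ^~ x)) ->
  measurable_fun D (fun t => dform (rho t) (psi t) (psi t)).
Proof.
move=> mD mr r0 mp; apply: measurable_funM; first exact: measurable_cst.
apply: measurable_sum => x; apply: measurable_sum => y.
apply: measurable_funM; last exact: measurable_cst.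
apply: measurable_funM; last exact: measurable_cst.
apply: measurable_funM; last first.
  by apply: measurable_theta => // [t|t]; exact: r0.
by apply: measurable_funM; apply: measurable_funB.
Qed.

Lemma integral_split (F : R -> \bar R) a m b : a < m -> m < b ->
  measurable_fun `]a, b[ F -> (forall t, a < t < b -> (0 <= F t)%E) ->
  (\int[mu]_(t in `]a, b[) F t =
   \int[mu]_(t in `]a, m[) F t + \int[mu]_(t in `]m, b[) F t)%E.
Proof.
move=> am mb mF F0.
have e : `]a, b[%classic = `]a, m] `|` `]m, b[ :> set R.
  apply/seteqP; split => t /=; rewrite !in_itv/=.
    by move=> /andP[-> ->]; have [_|_] := leP t m; [left|right].
  move=> [/andP[-> tm]|/andP[mt ->]]; first exact: le_lt_trans tm mb.
  by rewrite (lt_trans am mt).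
rewrite {1}e ge0_integral_setU//=.
- congr (_ + _)%E; apply: (integral_itv_bndoo false false).
  apply: measurable_funS mF => // t /=; rewrite !in_itv/= => /andP[-> tm].
  exact: lt_trans mb.
- by rewrite -e.
- move=> t h; have : `]a, b[%classic t by rewrite e.
  by rewrite /= in_itv/=; exact: F0.
- by apply/disj_setPS => t [] /=; rewrite !in_itv/= => /andP[_ tm] /andP[mt _];
    have := le_lt_trans tm mt; rewrite ltxx.
Qed.

Lemma ae_sub (P P' : R -> Prop) : (forall t, P t -> P' t) ->
  {ae mu, forall t : R, P t} -> {ae mu, forall t : R, P' t}.
Proof. by move=> PP'; apply: negligibleS; exact: subsetC. Qed.

Lemma ae_and (P P' : R -> Prop) : {ae mu, forall t : R, P t} ->
  {ae mu, forall t : R, P' t} -> {ae mu, forall t : R, P t /\ P' t}.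
Proof.
move=> h1 h2; apply: negligibleS (negligibleU h1 h2) => t /=.
by move/not_andP.
Qed.

Lemma ae_neq (c : R) : {ae mu, forall t : R, t != c}.
Proof.
exists [set c]; split => //; first exact: lebesgue_measure_set1.
by move=> t /= /negP; rewrite negbK => /eqP.
Qed.

Lemma eq_derive1_oo (f g : R -> R) a b t : (forall u, a < u < b -> f u = g u) ->
  a < t < b -> derive1 f t = derive1 g t.
Proof.
move=> fg /andP[at_ tb]; rewrite !derive1E; apply: near_eq_derive => //.
near=> u; apply: fg; apply/andP; split; near: u; [exact: lt_nbhsr|exact: lt_nbhsl].
Unshelve. all: by end_near. Qed.

(* An admissible curve of action at most [c] on the time interval [a, b]. *)
Record acurve a b p q c rho psi : Prop := ACurve {
  acurve_density : forall t, a <= t <= b -> density pi (rho t);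
  acurve_pwC1 : pwC1 predT rho a b;
  acurve_measurable : forall x, measurable_fun `]a, b[ (psi ^~ x);
  acurve_continuity : {ae mu, forall t, a < t < b -> forall x,
    derive1 (rho ^~ x) t = onsager (rho t) (psi t) x};
  acurve_l : rho a = p;
  acurve_r : rho b = q;
  acurve_le : (\int[mu]_(t in `]a, b[) (dform (rho t) (psi t) (psi t))%:E <= c%:E)%E }.

Lemma acurve_glue a m b p o q c d rho1 psi1 rho2 psi2 :
  acurve a m p o c rho1 psi1 -> acurve m b o q d rho2 psi2 ->
  acurve a b p q (c + d) (fun t => if t <= m then rho1 t else rho2 t)
    (fun t => if t <= m then psi1 t else psi2 t).
Proof.
move=> P1 P2; have am := pwC1_lt (acurve_pwC1 P1); have mb := pwC1_lt (acurve_pwC1 P2).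
set rho := fun t => _; set psi := fun t => if _ then psi1 t else _.
have r1 t : t <= m -> rho t = rho1 t by rewrite /rho => ->.
have r2 t : m <= t -> rho t = rho2 t.
  rewrite /rho le_eqVlt => /predU1P[<-|mt]; last by rewrite leNgt mt.
  by rewrite lexx (acurve_r P1) (acurve_l P2).
have p1 t : t <= m -> psi t = psi1 t by rewrite /psi => ->.
have p2 t : m < t -> psi t = psi2 t by rewrite /psi leNgt => ->.
have D t : a <= t <= b -> density pi (rho t).
  move=> /andP[at_ tb]; have [tm|/ltW mt] := leP t m.
    by rewrite r1//; apply: (acurve_density P1); rewrite at_.
  by rewrite r2//; apply: (acurve_density P2); rewrite mt.
have PW : pwC1 predT rho a b.
  apply: (pwC1_cat (m := m)).
    by apply: pwC1_eq (acurve_pwC1 P1) => t; rewrite in_itv/= => /andP[_ /r1].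
  by apply: pwC1_eq (acurve_pwC1 P2) => t; rewrite in_itv/= => /andP[/r2].
have M x : measurable_fun `]a, b[ (psi ^~ x).
  rewrite (_ : psi ^~ x = fun t => if t <= m then psi1 t x else psi2 t x); last first.
    by apply/funext => t; rewrite /psi; case: ifP.
  apply: measurable_fun_if => //.
  - by apply: measurable_funTS; exact: measurable_fun_ler.
  - rewrite (_ : _ `&` _ = `]a, m[ `|` [set m]); last first.
      apply/seteqP; split => t /=; rewrite !in_itv/=.
        by move=> [/andP[-> _] +]; rewrite le_eqVlt => /predU1P[->|->]; [right|left].
      move=> [/andP[-> tm]|->]; first by rewrite ltW// (lt_trans tm mb).
      by rewrite am mb lexx.
    apply/measurable_funU => //; split; last exact: measurable_fun_set1.
    exact: acurve_measurable P1 x.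
  - rewrite (_ : _ `&` _ = `]m, b[%classic); first exact: acurve_measurable P2 x.
    apply/seteqP; split => t /=; rewrite !in_itv/=.
      by move=> [/andP[_ ->] +]; rewrite leNgt => /negbFE ->.
    by move=> /andP[mt ->]; rewrite (lt_trans am mt) leNgt mt.
split => //; last first.
- have mF : measurable_fun `]a, b[ (fun t => (dform (rho t) (psi t) (psi t))%:E).
    apply/measurable_EFinP; apply: measurable_dform => // [x|t x].
      apply: measurable_funS (pwC1_measurable x PW) => //; exact: subset_itv_oo_cc.
    by rewrite /= in_itv/= => /andP[/ltW h1 /ltW h2]; have [] := D t; rewrite ?h1.
  rewrite (integral_split am mb mF); last first.
    move=> t /andP[/ltW h1 /ltW h2]; rewrite lee_fin; apply: (dform_ge0 QP).
    by have [] := D t; rewrite ?h1.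
  rewrite EFinD; apply: leeD.
    apply: le_trans (acurve_le P1); rewrite le_eqVlt; apply/orP; left; apply/eqP.
    by apply: eq_integral => t; rewrite inE/= in_itv/= => /andP[_ /ltW tm]; rewrite r1// p1.
  apply: le_trans (acurve_le P2); rewrite le_eqVlt; apply/orP; left; apply/eqP.
  by apply: eq_integral => t; rewrite inE/= in_itv/= => /andP[mt _]; rewrite r2 ?p2// ltW.
- by rewrite r2 ?ltW// (acurve_r P2).
- by rewrite r1 ?ltW// (acurve_l P1).
- apply: ae_sub (ae_and (ae_and (acurve_continuity P1) (acurve_continuity P2)) (ae_neq m)).
  move=> t [[h1 h2] tm] /andP[at_ tb] x.
  have [tm'|mt'] := ltP t m.
    rewrite r1 ?(ltW tm')// p1 ?(ltW tm')// -h1 ?at_//.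
    apply: (@eq_derive1_oo _ _ a m); last by rewrite at_.
    by move=> u /andP[_ /ltW um]; rewrite r1.
  have {tm}mt : m < t by rewrite lt_neqAle eq_sym tm.
  rewrite r2// p2// -h2 ?mt//.
  apply: (@eq_derive1_oo _ _ m b); last by rewrite mt.
  by move=> u /andP[/ltW mu' _]; rewrite r2.
Qed.

(** The potential solving the continuity equation is the optimal test function, so its action
    density is at most any dual bound v. *)
Lemma piece_acurve a b r V v c : piece Q pi a b r V v -> V b - V a <= c ->
  exists rho psi, acurve a b (r a) (r b) c rho psi.
Proof.
move=> P Vc; pose f t x := derive1 (r ^~ x) t; pose psi t := solve Q pi (r t) (f t).
have cl t : a < t < b -> a <= t <= b by move=> /andP[/ltW -> /ltW ->].
have rc t y : {for t, continuous (r ^~ y)} := is_derive_continuous (C1_is_derive t (piece_C1 P y)).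
have psic t x : a < t < b -> {for t, continuous (psi ^~ x)}.
  move=> tab; apply: (continuous_solve QP) => [y|//|y].
    exact: (piece_gt0 P y (cl t tab)).
  exact: (piece_C1 P y).2.
have D t : a <= t <= b -> density pi (r t).
  move=> tab; apply/density_ip; split; last exact: piece_mass P t tab.
  by move=> x; apply/ltW/(piece_gt0 P).
have M x : measurable_fun `]a, b[ (psi ^~ x).
  apply: open_continuous_measurable_fun; first exact: interval_open.
  by move=> t; rewrite inE/= in_itv/= => tab; exact: psic.
have PW : pwC1 predT r a b.
  by apply: pwC1_base (piece_lt P) _ => x _; exists (r ^~ x) => //; exact: piece_C1 P x.
exists r, psi; split => //.
- apply: aeW => t tab x; rewrite /psi (onsager_solve QP)// => [y|].
    exact: (piece_gt0 P y (cl t tab)).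
  exact: dual_mass (piece_dual P tab).
- apply: le_trans (_ : (\int[mu]_(t in `]a, b[) (v t)%:E <= _)%E).
    apply: ge0_le_integral => //.
    + move=> t /=; rewrite in_itv/= => tab; rewrite lee_fin (dform_ge0 QP)// => x.
      by apply/ltW/(piece_gt0 P)/cl.
    + apply/measurable_EFinP; apply: measurable_dform => // [x|t x].
        apply: measurable_funS (pwC1_measurable x PW) => //; exact: subset_itv_oo_cc.
      by rewrite /= in_itv/= => tab; apply/ltW/(piece_gt0 P)/cl.
    + apply/measurable_EFinP; apply: open_continuous_measurable_fun; first exact: interval_open.
      by move=> t; rewrite inE/= in_itv/= => /cl; exact: piece_continuous P t.
    + move=> t /=; rewrite in_itv/= => tab; rewrite lee_fin.
      apply: (solve_le QP) (piece_dual P tab) => [x|]; last exact: dual_mass (piece_dual P tab).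
      exact: (piece_gt0 P x (cl t tab)).
  by rewrite (piece_integral P) lee_fin.
Qed.

Lemma conn_acurve a b p q c : conn Q pi a b p q c ->
  exists rho psi, acurve a b p q c rho psi.
Proof.
elim=> [{}a {}b r V v {}c P h|{}a m {}b {}p o {}q c0 c1 _ [r1 [s1 H1]] _ [r2 [s2 H2]]].
  exact: piece_acurve P h.
by eexists; eexists; exact: acurve_glue H1 H2.
Qed.

(** A fixed positive flow time makes each C^1 piece a curve of positive densities. The velocity of
    the original curve, where densities may vanish, is transported in dual form by [dual_heat]. *)
Lemma acurve_conn a b p q c rho psi kappa d : 0 < d -> curvature Q pi kappa ->
  acurve a b p q c rho psi ->
  conn Q pi a b (heat d p) (heat d q) (expR (- (2 * kappa) * d) * c).
Proof.
move=> d0 HC [D PW]; elim: PW p q c D => {a b} [a b ab Hb|a m b Ham IHam Hmb IHmb] p q c D M E rp rq I.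
- have [g Hg] : exists g : X -> R -> R, forall x, C1 (g x) /\ {in `[a, b], rho ^~ x =1 g x}.
    have H x : exists g0 : R -> R, C1 g0 /\ {in `[a, b], rho ^~ x =1 g0}.
      by have [g0 h1 h2] := Hb x isT; exists g0.
    by have [g Hg] := boolp.choice H; exists g.
  (* The C^1 extensions to the line replace the curve; they are densities only on [a, b]. *)
  pose G t x := g x t; pose dG t x := derive1 (G ^~ x) t.
  have GC x : C1 (G ^~ x) by case: (Hg x).
  have GE t : a <= t <= b -> rho t = G t.
    by move=> tab; apply/funext => x; case: (Hg x) => _ ->.
  pose r t := heat (0 * t + d) (G t).
  have rC x := heat_curve_C1 QP 0 d GC x.
  have dr t x : derive1 (r ^~ x) t = heat d (dG t) x.
    by have [_ ->] := rC x; rewrite !mul0r add0r addr0.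
  have rE t : r t = heat d (G t) by rewrite /r mul0r add0r.
  have GD t : a <= t <= b -> density pi (G t) by move=> tab; rewrite -GE//; exact: D.
  have r0 t x : a <= t <= b -> 0 < r t x.
    move=> /GD GDt; have [y y0] := density_exists_gt0 GDt.
    by rewrite rE; apply: (heat_gt0 QP x d0 _ y0); case: GDt.
  have r1 t : a <= t <= b -> ip (r t) (fun=> 1) = 1.
    by move=> /GD/density_ip[_ h]; rewrite rE (heat_mass QP).
  have [V [v [P vE]]] := piece_speed QP ab (fun x => (rC x).1) r0 r1.
  have aab : a <= a <= b by rewrite lexx ltW.
  have bab : a <= b <= b by rewrite lexx ltW.
  rewrite -rp -rq (GE a)// (GE b)// -!rE; apply: (conn_base P).
  rewrite -lee_fin -(piece_integral P).
  have cl t : a < t < b -> a <= t <= b by move=> /andP[/ltW -> /ltW ->].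
  set k := expR _; have k0 : 0 <= k by exact: expR_ge0.
  have mF : measurable_fun `]a, b[ (fun t => dform (rho t) (psi t) (psi t)).
    apply: measurable_dform => // [x|t x].
      have PW : pwC1 predT rho a b by exact: pwC1_base.
      by apply: measurable_funS (pwC1_measurable x PW) => //; exact: subset_itv_oo_cc.
    by rewrite /= in_itv/= => /cl/D[].
  have F0 t : a < t < b -> 0 <= dform (rho t) (psi t) (psi t).
    by move=> /cl/D[h _]; exact: (dform_ge0 QP).
  apply: le_trans (_ : (\int[mu]_(t in `]a, b[) (k%:E * (dform (rho t) (psi t) (psi t))%:E) <= _)%E); last first.
    rewrite ge0_integralZl//; first by rewrite EFinM lee_wpmul2l.
    by apply/measurable_EFinP.
  apply: ae_ge0_le_integral => //.
  + move=> t /=; rewrite in_itv/= => tab; rewrite lee_fin vE; last exact: cl.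
    by apply: (dform_ge0 QP) => x; apply/ltW/r0/cl.
  + apply/measurable_EFinP; apply: open_continuous_measurable_fun; first exact: interval_open.
    by move=> t; rewrite inE/= in_itv/= => /cl; exact: piece_continuous P t.
  + by move=> t /=; rewrite in_itv/= => /F0 h; rewrite -EFinM lee_fin mulr_ge0.
  + by apply/measurable_EFinP; apply: measurable_funM => //; exact: measurable_cst.
  apply: ae_sub E => t Et /=; rewrite in_itv/= => tab; have tab' := cl t tab.
  rewrite -EFinM lee_fin vE// /speed.
  have dGE : dG t = onsager (rho t) (psi t).
    apply/funext => x; rewrite -Et//; apply/esym; apply: eq_derive1_oo tab.
    by move=> u /cl uab; rewrite GE.
  have DL : dual_le (G t) (dG t) (dform (rho t) (psi t) (psi t)).
    by rewrite dGE -GE//; apply: (dual_onsager QP); case: (D t tab').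
  have DL' : dual_le (r t) (fun x => derive1 (r ^~ x) t) (k * dform (rho t) (psi t) (psi t)).
    rewrite (_ : (fun x => _) = heat d (dG t)); last by apply/funext => x; rewrite dr.
    rewrite rE; apply: (dual_heat QP HC d0) DL; first by case: (GD t tab').
    exact: density_exists_gt0 (GD t tab').
  apply: (solve_le QP _ _ DL') => [x|]; first exact: r0.
  exact: dual_mass DL'.
have am := pwC1_lt Ham; have mb := pwC1_lt Hmb.
have PW := pwC1_cat Ham Hmb.
pose F t := (dform (rho t) (psi t) (psi t))%:E.
have mF : measurable_fun `]a, b[ F.
  apply/measurable_EFinP; apply: measurable_dform => // [x|t x].
    by apply: measurable_funS (pwC1_measurable x PW) => //; exact: subset_itv_oo_cc.
  by rewrite /= in_itv/= => /andP[/ltW h1 /ltW h2]; have [] := D t; rewrite ?h1.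
have F0 t : a < t < b -> (0 <= F t)%E.
  move=> /andP[/ltW h1 /ltW h2]; rewrite lee_fin; apply: (dform_ge0 QP).
  by have [] := D t; rewrite ?h1.
move: I; rewrite -/F (integral_split am mb mF F0).
have I1 : (0 <= \int[mu]_(t in `]a, m[) F t)%E.
  apply: integral_ge0 => t /=; rewrite in_itv/= => /andP[h1 h2].
  by apply: F0; rewrite h1 (lt_trans h2 mb).
have I2 : (0 <= \int[mu]_(t in `]m, b[) F t)%E.
  apply: integral_ge0 => t /=; rewrite in_itv/= => /andP[h1 h2].
  by apply: F0; rewrite h2 (lt_trans am h1).
move: I1 I2.
(* The bound c is divided according to the actual integrals, which are finite because they are
   nonnegative with a finite sum. *)
case e1 : (\int[mu]_(t in `]a, m[) F t)%E => [i1| |]//.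
  case e2 : (\int[mu]_(t in `]m, b[) F t)%E => [i2| |]// _ _; rewrite -EFinD lee_fin => le12.
  apply: (conn_le (c := expR (- (2 * kappa) * d) * i1 + expR (- (2 * kappa) * d) * i2)).
    by rewrite -mulrDr ler_wpM2l ?expR_ge0.
  apply: (conn_cat (o := heat d (rho m))).
  + apply: IHam => //.
    * by move=> t /andP[h1 h2]; apply: D; rewrite h1 (le_trans h2)// ltW.
    * move=> x; apply: measurable_funS (M x) => // t /=; rewrite !in_itv/= => /andP[-> h].
      exact: lt_trans mb.
    * by apply: ae_sub E => t H /andP[h1 h2]; apply: H; rewrite h1 (lt_trans h2 mb).
    * by rewrite -/F e1.
  + apply: IHmb => //.
    * by move=> t /andP[h1 h2]; apply: D; rewrite h2 (le_trans _ h1)// ltW.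
    * move=> x; apply: measurable_funS (M x) => // t /=; rewrite !in_itv/= => /andP[h ->].
      by rewrite (lt_trans am h).
    * by apply: ae_sub E => t H /andP[h1 h2]; apply: H; rewrite h2 (lt_trans am h1).
    * by rewrite -/F e2.
by case: (\int[mu]_(t in `]m, b[) F t)%E.
Qed.

Lemma actionE rho psi : (forall t, 0 <= t <= 1 -> density pi (rho t)) ->
  (forall x, measurable_fun `]0 : R, 1[ (psi ^~ x)) -> pwC1 predT rho 0 1 ->
  action Q pi rho psi = (\int[mu]_(t in `]0%R, 1%R[) (dform (rho t) (psi t) (psi t))%:E)%E.
Proof.
move=> D M PW; rewrite /action.
pose F (t : R) := (\sum_x \sum_y (psi t x - psi t y) ^+ 2 * theta (rho t x) (rho t y)
  * Q x y * pi x)%:E.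
rewrite -[X in (_ * X)%E]/(\int[mu]_(t in `[0%R, 1%R]) F t)%E.
have FE t : (2^-1%:E * F t)%E = (dform (rho t) (psi t) (psi t))%:E.
  rewrite /F -EFinM /dform; congr (_ * _)%:E; apply: eq_bigr => x _.
have mG : measurable_fun `]0 : R, 1[ (fun t => (dform (rho t) (psi t) (psi t))%:E).
  apply/measurable_EFinP; apply: measurable_dform => // [x|t x].
    by apply: measurable_funS (pwC1_measurable x PW) => //; exact: subset_itv_oo_cc.
  by rewrite /= in_itv/= => /andP[/ltW h1 /ltW h2]; have [] := D t; rewrite ?h1.
have mF : measurable_fun `]0 : R, 1[ F.
  apply: (eq_measurable_fun (fun t => (2%:E * (dform (rho t) (psi t) (psi t))%:E)%E)).
    move=> t _; rewrite -FE muleA -EFinM.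
    have -> : 2 * 2^-1 = 1 :> R by rewrite divff.
    by rewrite mul1r.
  by apply: measurable_funeM.
rewrite (integral_itv_bndoo true false mF) -ge0_integralZl//.
move=> t /=; rewrite in_itv/= => /andP[/ltW h1 /ltW h2].
  have [h _] := D t ltac:(by rewrite h1).
  have := dform_ge0 QP (psi t) h; rewrite -lee_fin -FE.
  by rewrite pmule_rge0// lte_fin invr_gt0.
Qed.

Lemma admissible_acurve p q c rho psi : admissible Q pi p q rho psi ->
  (action Q pi rho psi <= c%:E)%E -> acurve 0 1 p q c rho psi.
Proof.
move=> [[D PW] M E r0 r1] A.
have D' t : 0 <= t <= 1 -> density pi (rho t).
  by move=> h; apply: D; rewrite in_itv.
have PW' := piecewise_C1_pwC1_all PW.
have M' x : measurable_fun `]0 : R, 1[ (psi ^~ x).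
  by apply: measurable_funS (M x) => //; exact: subset_itv_oo_cc.
split => //; last by rewrite -actionE.
apply: (negligibleS _ E); apply: subsetC => t /= H /andP[/ltW h1 /ltW h2] x.
have := H; rewrite in_itv/= h1 h2 => /(_ isT x)/eqP.
rewrite addr_eq0 => /eqP ->; rewrite /onsager -sumrN; apply: eq_bigr => y _.
by rewrite -!mulNr opprB.
Qed.

Lemma acurve_admissible p q c rho psi : acurve 0 1 p q c rho psi ->
  admissible Q pi p q rho psi /\ (action Q pi rho psi <= c%:E)%E.
Proof.
move=> [D PW M E r0 r1 A]; split; last by rewrite actionE.
split => //.
- split; first by move=> t; rewrite in_itv/=; exact: D.
  by move=> x; exact: pwC1_piecewise_C1.
- move=> x; rewrite (_ : `[0, 1]%classic = [set 0] `|` (`]0 : R, 1[ `|` [set 1])); last first.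
    apply/seteqP; split => t /=; rewrite !in_itv/=.
      rewrite !le_eqVlt => /andP[/predU1P[<-|t0]]; first by left.
      by move=> /predU1P[->|t1]; right; [right|left; rewrite t0].
    by move=> [->|[/andP[/ltW -> /ltW ->]|->]]//; rewrite ?lexx ?ler01.
  apply/measurable_funU => //; first exact: measurableU.
  split; first exact: measurable_fun_set1.
  by apply/measurable_funU => //; split => //; exact: measurable_fun_set1.
- suff H : {ae mu, forall t : R, t \in `[0, 1] -> forall x, derive1 (rho ^~ x) t
      + \sum_y (psi t y - psi t x) * theta (rho t x) (rho t y) * Q x y = 0} by exact: H.
  apply: ae_sub (ae_and (ae_and (ae_neq 0) (ae_neq 1)) E) => t [[t0 t1] H]; rewrite in_itv/= => /andP[h0 h1] x.
  rewrite H; last by rewrite !lt_neqAle h0 h1 t1 eq_sym t0.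
  rewrite /onsager -big_split big1// => y _ /=.
  by ring.
Qed.

End AdmissibleCurves.

(** * Entropy along the heat flow and finiteness of the distance *)

Section TransportCost.
Context {R : realType} {X : finType} (Q : X -> X -> R) (pi : X -> R).
Context (QP : reversible_chain Q pi).
Implicit Types (x y z : X) (rho psi : R -> X -> R) (p q f : X -> R) (a b c d s t m : R).
Local Notation mu := (@lebesgue_measure R).
Local Notation dform := (dform Q pi).
Local Notation heat := (heat Q).
Local Notation lap := (lap Q).
Local Notation onsager := (onsager Q).
Local Notation ip := (ip pi).
Local Notation H := (entropy pi).
Local Notation acurve := (acurve Q pi).

Lemma heat_density p d : 0 <= d -> density pi p -> density pi (heat d p).
Proof.
move=> d0 /density_ip[p0 p1]; apply/density_ip; rewrite (heat_mass QP); split => //.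
by move=> x; exact: (heat_ge0 QP).
Qed.

Lemma heat_density_gt0 p d x : 0 < d -> density pi p -> 0 < heat d p x.
Proof.
move=> d0 Dp; have [y y0] := density_exists_gt0 Dp.
by apply: (heat_gt0 QP x d0 _ y0); case: Dp.
Qed.

(** Pointwise p ln p >= p - 1, and the right-hand side has integral 0. *)
Lemma entropy_ge0 p : density pi p -> 0 <= H p.
Proof.
move=> [p0 p1]; apply: le_trans (_ : \sum_x (p x - 1) * pi x <= _).
  under eq_bigr do rewrite mulrBl mul1r.
  by rewrite sumrB p1 (stat_sum1 QP) subrr.
apply: ler_sum => x _; rewrite -mulrA [leRHS]mulrC ler_wpM2r ?(ltW (stat_gt0 QP x))//.
have := p0 x; rewrite le_eqVlt => /predU1P[<-|px]; first by rewrite mul0r sub0r oppr_le0.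
have := ln_sublinear (x := (p x)^-1); rewrite invr_gt0 lnV ?posrE// => h.
have h1 : 1 - (p x)^-1 <= ln (p x).
  have := expR_ge1Dx (- ln (p x)); rewrite expRN lnK ?posrE// ; lra.
have := ler_wpM2l (ltW px) h1; rewrite mulrBr mulr1 divff// gt_eqF//.
Qed.

Lemma continuous_entropy_heat p : continuous (fun t => H (heat t p)).
Proof.
move=> t; rewrite /entropy; apply: continuous_bigsum => x.
rewrite (_ : (fun u => _) = fun u => pi x * (heat u p x * ln (heat u p x))).
  apply: cvgM; first exact: cvg_cst.
  apply: (continuous_comp (f := fun u => heat u p x) (g := fun y : R => y * ln y)).
    exact: is_derive_continuous (is_derive_heat QP t p x).
  exact: continuous_xlnx.
by apply/funext => u; rewrite mulrA.
Qed.

Lemma ip_lap1 f : ip (lap f) (fun=> 1) = 0.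
Proof.
rewrite (ip_lap QP) /ip big1// => x _.
by rewrite /lap big1 ?mulr0 ?mul0r// => y _; rewrite subrr mulr0.
Qed.

Lemma ip_lap_ln f : (forall x, 0 < f x) ->
  ip (lap f) (fun x => ln (f x)) = - dform f (fun x => ln (f x)) (fun x => ln (f x)).
Proof.
move=> f0; rewrite -(ip_onsager QP) => [|x]; last exact: ltW.
by rewrite /ip -sumrN; apply: eq_bigr => x _; rewrite onsager_ln// !mulNr opprK.
Qed.

Lemma is_derive_entropy_heat p (al be t : R) : density pi p -> 0 < al * t + be ->
  let r := heat (al * t + be) p in
  is_derive t 1 (fun u => H (heat (al * u + be) p))
    (- al * dform r (fun x => ln (r x)) (fun x => ln (r x))).
Proof.
move=> Dp t0 r.
have r0 x : 0 < r x by exact: heat_density_gt0.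
have rd x : is_derive t 1 (fun u => heat (al * u + be) p x) (al * lap r x).
  have := @is_derive_compf _ _ (fun u => al * u + be) _ _ _
    (is_derive_heat QP (al * t + be) p x) (is_derive_affine al be t).
  by rewrite (heat_lap QP) mulrC.
have := @is_derive_entropy _ _ pi (fun u => heat (al * u + be) p) _ t r0 rd.
have E g : ip (fun x => al * lap r x) g = al * ip (lap r) g.
  by rewrite /ip mulr_sumr; apply: eq_bigr => x _; ring.
by rewrite !E ip_lap1 mulr0 addr0 ip_lap_ln// mulrN mulNr.
Qed.

Lemma entropy_heat_le p s t : density pi p -> 0 <= s <= t ->
  H (heat t p) <= H (heat s p).
Proof.
move=> Dp /andP[s0 st]; rewrite -lerN2.
have E : (fun u => - H (heat (1 * u + 0) p)) = fun u => - H (heat u p).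
  by apply/funext => u; rewrite mul1r addr0.
apply: (@is_derive_ge0_le _ (fun u => - H (heat u p))
  (fun u => dform (heat u p) (fun x => ln (heat u p x)) (fun x => ln (heat u p x)))) => //.
- apply: continuous_subspaceT => u; apply: cvgN; exact: continuous_entropy_heat.
- move=> u /andP[su _]; have u0 : 0 < 1 * u + 0 by rewrite mul1r addr0 (le_lt_trans s0).
  have := is_deriveNf (is_derive_entropy_heat Dp u0).
  by rewrite E mul1r addr0 mulN1r opprK.
- move=> u /andP[su _]; apply: (dform_ge0 QP) => x; apply/ltW/heat_density_gt0 => //.
  exact: le_lt_trans su.
Qed.

Lemma onsager_scale p f (k : R) x :
  onsager p (fun y => k * f y) x = k * onsager p f x.
Proof. by rewrite /onsager mulr_sumr; apply: eq_bigr => y _; ring. Qed.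

(* The heat flow, started or ended at [p], which may vanish somewhere: its
   action is the total variation of the entropy times the time dilation. *)
Lemma heat_acurve a b p (al be d : R) : a < b -> density pi p ->
  (forall t, a <= t <= b -> 0 <= al * t + be <= d) ->
  (forall t, a < t < b -> 0 < al * t + be) ->
  exists rho psi, acurve a b (heat (al * a + be) p) (heat (al * b + be) p)
    (`|al| * (H p - H (heat d p))) rho psi.
Proof.
move=> ab Dp tau0 tau1.
pose r t := heat (al * t + be) p; pose psi t x := - al * ln (r t x).
have rD t : a <= t <= b -> density pi (r t).
  by move=> /tau0/andP[h _]; exact: heat_density.
have r0 t x : a < t < b -> 0 < r t x by move=> /tau1 h; exact: heat_density_gt0.
have pC x : C1 (fun _ : R => p x).
  by have [] := is_derive_C1 (fun t => is_deriveCf (p x) t) (fun t => cvg_cst 0).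
have rC x := heat_curve_C1 QP al be (g := fun=> p) pC x.
have rd t x : derive1 (r ^~ x) t = al * lap (r t) x.
  have [_ ->] := rC x; rewrite (heatE QP) big1 ?add0r// => y _.
  by have h := is_deriveCf (p y) t; rewrite derive1E derive_val mul0r.
have rc t x : {for t, continuous (r ^~ x)} := is_derive_continuous (C1_is_derive t (rC x).1).
have cl t : a < t < b -> a <= t <= b by move=> /andP[/ltW -> /ltW ->].
have psic t x : a < t < b -> {for t, continuous (psi ^~ x)}.
  move=> tab; apply: cvgM; first exact: cvg_cst.
  apply: (continuous_comp (f := r ^~ x) (g := @ln R)); first exact: rc.
  by apply: continuous_ln; exact: r0.
exists r, psi.
have PW : pwC1 predT r a b.
  by apply: (pwC1_base ab) => x _; exists (r ^~ x); [exact: (rC x).1|].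
have mpsi x : measurable_fun `]a, b[ (psi ^~ x).
  apply: open_continuous_measurable_fun; first exact: interval_open.
  by move=> t; rewrite inE/= in_itv/= => tab; exact: psic.
split => //.
  apply: aeW => t tab x; rewrite rd onsager_scale onsager_ln//.
    by rewrite mulrN mulNr opprK.
  by move=> y; exact: r0.
pose F t := dform (r t) (psi t) (psi t); rewrite -[X in (X <= _)%E]/(\int[mu]_(t in `]a, b[) (F t)%:E)%E.
have mF : measurable_fun `]a, b[ F.
  apply: measurable_dform => // [x|t x].
    by apply: measurable_funS (pwC1_measurable x PW) => //; exact: subset_itv_oo_cc.
  by rewrite /= in_itv/= => /r0 h; exact/ltW.
have F0 t : a < t < b -> 0 <= F t by move=> tab; apply: (dform_ge0 QP) => x; apply/ltW/r0.
have hd t : a < t < b -> is_derive t 1 (fun u => - al * H (r u)) (F t).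
  move=> tab; have h := is_deriveZf (- al) (is_derive_entropy_heat Dp (tau1 t tab)).
  apply: is_derive_eq; rewrite /F mulrA mulrNN.
  have -> : psi t = fun x => - al * ln (r t x) + 0 * ln (r t x).
    by apply/funext => x; rewrite mul0r addr0.
  by rewrite dform_sq expr2; ring.
have Fc t : a < t < b -> {for t, continuous F}.
  move=> tab; apply: (continuous_dform) => [y|y|y|y]; first exact: r0.
  - exact: rc.
  - exact: psic.
  - exact: psic.
have Hr t : a <= t <= b -> H (heat d p) <= H (r t) <= H p.
  move=> /tau0/andP[h1 h2]; rewrite (entropy_heat_le Dp) ?h1 ?h2//=.
  rewrite -[leRHS](_ : H (heat 0 p) = _); last by congr entropy; apply/funext => x; rewrite heat0.
  by apply: (entropy_heat_le Dp); rewrite lexx.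
(* Where the flow time reaches 0 the density may vanish and the potential blow up, so the integral
   is first computed strictly inside the interval. *)
have sub a' b' : a < a' -> a' < b' -> b' < b ->
    (\int[mu]_(t in `]a', b'[) (F t)%:E <= (`|al| * (H p - H (heat d p)))%:E)%E.
  move=> aa ab' bb.
  have cl' t : a' <= t <= b' -> a < t < b.
    by move=> /andP[h1 h2]; rewrite (lt_le_trans aa h1) (le_lt_trans h2 bb).
  rewrite (continuous_on_FTC2 ab' (fun t h => hd t (cl' t h)) (fun t h => Fc t (cl' t h))).
  rewrite lee_fin.
  have a'I : a' <= a' <= b' by rewrite lexx ltW.
  have b'I : a' <= b' <= b' by rewrite lexx ltW.
  have /andP[h1 h2] := Hr _ (cl _ (cl' _ a'I)).
  have /andP[h3 h4] := Hr _ (cl _ (cl' _ b'I)).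
  rewrite (_ : _ - _ = al * (H (r a') - H (r b'))); last by ring.
  rewrite (le_trans (ler_norm _))// normrM ler_wpM2l// ler_norml.
  by apply/andP; split; lra.
(* Margins for exhausting the open interval, by monotone convergence; the denominator at least 3
   keeps the two margins below its length. *)
pose e n : R := (b - a) / n.+3%:R.
have ba : 0 < b - a by rewrite subr_gt0.
have e0 n : 0 < e n by rewrite divr_gt0.
have e2 n : e n + e n < b - a.
  rewrite /e -mulrDl ltr_pdivrMr// -mulr2n -[_ *+ 2]mulr_natr ltr_pM2l//.
  by rewrite ltr_nat.
have en n k : (n <= k)%N -> e k <= e n.
  by move=> nk; rewrite ler_wpM2l ?(ltW ba)// lef_pV2 ?posrE// ler_nat !ltnS.
pose S n : set R := `]a + e n, b - e n[%classic.
have Su : \bigcup_n S n = `]a, b[%classic.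
  apply/seteqP; split => t /=.
    move=> [n _]; rewrite /S/= !in_itv/= => /andP[h1 h2].
    by apply/andP; split; have := e0 n; lra.
  rewrite in_itv/= => /andP[h1 h2].
  have m0 : 0 < Num.min (t - a) (b - t) by rewrite lt_min !subr_gt0 h1.
  pose n := Num.truncn ((b - a) / Num.min (t - a) (b - t)).
  exists n => //; rewrite /S/= in_itv/=.
  have en' : e n < Num.min (t - a) (b - t).
    rewrite /e ltr_pdivrMr// -ltr_pdivrMl// mulrC.
    apply: lt_le_trans (truncnS_gt _) _; by rewrite ler_nat ltnS /n ltnW.
  by move: en'; rewrite lt_min => /andP[h3 h4]; apply/andP; split; lra.
have Sm n : measurable (S n) by exact: measurable_itv.
have SS n t : S n t -> a < t < b.
  by move=> /= h; have : (\bigcup_n S n) t by [exists n]; rewrite Su /= in_itv.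
have cv : (\int[mu]_(x in S i) (EFin \o F) x)%E @[i --> \oo] --> (\int[mu]_(x in `]a, b[) (EFin \o F) x)%E.
  rewrite -Su; apply: ge0_nondecreasing_set_cvg_integral => //.
  - move=> n k nk; apply/subsetPset => t; rewrite /S/= !in_itv/= => /andP[h1 h2].
    by have := en n k nk; move=> h; apply/andP; split; lra.
  - move=> n; apply/measurable_EFinP; apply: measurable_funS mF => // t /SS.
    by rewrite /= in_itv.
  - by move=> n t /SS/F0; rewrite lee_fin.
rewrite -(cvg_lim _ cv)//; apply: lime_le; first by apply/cvg_ex; exists (\int[mu]_(x in `]a, b[) (EFin \o F) x)%E.
apply: nearW => n; apply: sub.
- by rewrite ltrDl.
- by have := e2 n; lra.
- by rewrite ltrBlDr ltrDl.
Qed.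

Lemma heat_acurve_start a b p d : a < b -> 0 < d -> density pi p ->
  exists rho psi, acurve a b p (heat d p) (d / (b - a) * (H p - H (heat d p))) rho psi.
Proof.
move=> ab d0 Dp; have ba : 0 < b - a by rewrite subr_gt0.
have ban : b - a != 0 by rewrite gt_eqF.
have k0 : 0 < d / (b - a) by rewrite divr_gt0.
have E t : d / (b - a) * t + - (d / (b - a) * a) = d / (b - a) * (t - a) by ring.
have := @heat_acurve a b p (d / (b - a)) (- (d / (b - a) * a)) d ab Dp.
rewrite !E subrr mulr0 divfK//.
have -> : heat 0 p = p by apply/funext => x; rewrite heat0.
rewrite (gtr0_norm k0); apply => t /andP[h1 h2]; rewrite E.
- rewrite mulr_ge0 ?subr_ge0 ?(ltW k0)//= mulrAC ler_pdivrMr// ler_pM2l//.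
  by rewrite lerD2r.
- by rewrite mulr_gt0// subr_gt0.
Qed.

Lemma heat_acurve_end a b p d : a < b -> 0 < d -> density pi p ->
  exists rho psi, acurve a b (heat d p) p (d / (b - a) * (H p - H (heat d p))) rho psi.
Proof.
move=> ab d0 Dp; have ba : 0 < b - a by rewrite subr_gt0.
have ban : b - a != 0 by rewrite gt_eqF.
have k0 : 0 < d / (b - a) by rewrite divr_gt0.
have E t : - (d / (b - a)) * t + d / (b - a) * b = d / (b - a) * (b - t) by ring.
have := @heat_acurve a b p (- (d / (b - a))) (d / (b - a) * b) d ab Dp.
rewrite !E subrr mulr0 divfK//.
have -> : heat 0 p = p by apply/funext => x; rewrite heat0.
rewrite normrN (gtr0_norm k0); apply => t /andP[h1 h2]; rewrite E.
- rewrite mulr_ge0 ?subr_ge0 ?(ltW k0)//= mulrAC ler_pdivrMr// ler_pM2l//.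
  by rewrite lerD2l lerN2.
- by rewrite mulr_gt0// subr_gt0.
Qed.

Lemma interior_acurve a b p q : a < b -> (forall x, 0 < p x) -> (forall x, 0 < q x) ->
  density pi p -> density pi q -> exists c rho psi, acurve a b p q c rho psi.
Proof.
move=> ab p0 q0 /density_ip[_ p1] /density_ip[_ q1].
pose u t := (b - a)^-1 * t + - ((b - a)^-1 * a).
have ba : 0 < b - a by rewrite subr_gt0.
have uE t : u t = (t - a) / (b - a) by rewrite /u; ring.
pose r t x := p x + u t * (q x - p x).
have rd x t : is_derive t 1 (r ^~ x) ((b - a)^-1 * (q x - p x)).
  have h := is_deriveDf (is_deriveCf (p x) t)
    (is_deriveMf (is_derive_affine (b - a)^-1 (- ((b - a)^-1 * a)) t) (is_deriveCf (q x - p x) t)).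
  by apply: is_derive_eq; rewrite mulr0 add0r addr0.
have rC x : C1 (r ^~ x) by have [] := is_derive_C1 (rd x) (fun t => cvg_cst _).
have u01 t : a <= t <= b -> 0 <= u t <= 1.
  move=> /andP[h1 h2]; rewrite uE divr_ge0 ?subr_ge0 ?(ltW ab)//= ler_pdivrMr// mul1r.
  by rewrite lerD2r.
have r0 t x : a <= t <= b -> 0 < r t x.
  move=> /u01/andP[h1 h2]; rewrite /r (_ : _ + _ = (1 - u t) * p x + u t * q x); last by ring.
  have [e|n1] := eqVneq (u t) 1; first by rewrite e subrr mul0r add0r mul1r.
  rewrite ltr_pwDl ?mulr_ge0 ?(ltW (q0 x))// mulr_gt0// subr_gt0 lt_neqAle n1.
  exact: h2.
have r1 t : a <= t <= b -> ip (r t) (fun=> 1) = 1.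
  move=> _; rewrite (_ : r t = fun x => (1 - u t) * p x + u t * q x).
    by rewrite ip_lincomb p1 q1; ring.
  by apply/funext => x; rewrite /r; ring.
have [V [v [P _]]] := piece_speed QP ab rC r0 r1.
have [rho [psi A]] := piece_acurve QP P (lexx (V b - V a)).
exists (V b - V a), rho, psi.
have ra : r a = p.
  by apply/funext => x; rewrite /r uE subrr mul0r mul0r addr0.
have rb : r b = q.
  by apply/funext => x; rewrite /r uE divff ?gt_eqF// mul1r addrC subrK.
by rewrite -{1}ra -{1}rb.
Qed.

(** Finite cost even from the boundary: the heat flow leads inside, a straight segment crosses the
    interior, a reversed heat flow leads to q. *)
Lemma density_acurve p q : density pi p -> density pi q ->
  exists c rho psi, acurve 0 1 p q c rho psi.
Proof.
move=> Dp Dq.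
have t0 : 0 < 3^-1 :> R by rewrite invr_gt0.
have t1 : 3^-1 < 2 / 3 :> R by lra.
have t2 : 2 / 3 < 1 :> R by lra.
have [r1 [s1 A1]] := heat_acurve_start t0 ltr01 Dp.
have [r3 [s3 A3]] := heat_acurve_end t2 ltr01 Dq.
have [c [r2 [s2 A2]]] := interior_acurve t1 (fun x => heat_density_gt0 x ltr01 Dp)
  (fun x => heat_density_gt0 x ltr01 Dq) (heat_density ler01 Dp) (heat_density ler01 Dq).
by do 3!eexists; exact: (acurve_glue QP (acurve_glue QP A1 A2) A3).
Qed.

Lemma action_ge0 p q rho psi : admissible Q pi p q rho psi -> (0 <= action Q pi rho psi)%E.
Proof.
move=> [[D _] _ _ _ _]; rewrite /action mule_ge0//.
apply: integral_ge0 => t /= /D[h _]; rewrite lee_fin; apply: sumr_ge0 => x _.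
apply: sumr_ge0 => y _; rewrite mulr_ge0 ?(ltW (stat_gt0 QP x))//.
by rewrite mulr_ge0 ?(rate_ge0 QP)// mulr_ge0 ?theta_ge0// sqr_ge0.
Qed.

Lemma W_sqrE p q : (W Q pi p q ^+ 2)%E = ereal_inf [set a | exists rho psi,
  admissible Q pi p q rho psi /\ a = action Q pi rho psi].
Proof.
rewrite /W sqr_sqrte//; apply/ereal_infP => _ [rho [psi [A ->]]].
exact: action_ge0 A.
Qed.

Lemma W_sqr_le p q c rho psi : acurve 0 1 p q c rho psi -> (W Q pi p q ^+ 2 <= c%:E)%E.
Proof.
move=> A; have [h1 h2] := acurve_admissible QP A; rewrite W_sqrE.
by apply: le_trans h2; apply: ereal_inf_lbound; exists rho, psi.
Qed.

Lemma W_sqr_lt p q c : (W Q pi p q ^+ 2 < c%:E)%E ->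
  exists rho psi, acurve 0 1 p q c rho psi.
Proof.
rewrite W_sqrE => /ereal_inf_lt[_ [rho [psi [A ->]]] h].
by exists rho, psi; apply: (admissible_acurve QP A); exact: ltW.
Qed.

Lemma W_ge0 p q : (0 <= W Q pi p q)%E.
Proof. exact: sqrte_ge0. Qed.

Lemma W_fin p q : density pi p -> density pi q ->
  exists2 w : R, 0 <= w & W Q pi p q = w%:E.
Proof.
move=> Dp Dq; have [c [rho [psi /W_sqr_le h]]] := density_acurve Dp Dq.
have := W_ge0 p q; move: h; case: (W Q pi p q) => [w| |]//.
by rewrite lee_fin => _ w0; exists w.
Qed.

End TransportCost.

(** * From the curvature inequality to convexity of the entropy *)

Section RicciLowerBound.
Context {R : realType} {X : finType} (Q : X -> X -> R) (pi : X -> R).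
Context (QP : reversible_chain Q pi).
Context (kappa : R) (kappa_ge0 : 0 <= kappa) (HC : curvature Q pi kappa).
Implicit Types (x y z : X) (p q : X -> R) (G : R -> X -> R).
Implicit Types (c d h l s t u v D L : R).
Local Notation heat := (heat Q).
Local Notation H := (entropy pi).
Local Notation acurve := (acurve Q pi).
Local Notation conn := (conn Q pi).

(** Through e^(-u) <= 1/(1 + u), since (1 + u)(1 - u + u^2) = 1 + u^3. *)
Lemma expRN_le_quadratic u : 0 <= u -> expR (- u) <= 1 - u + u ^+ 2.
Proof.
move=> u0; have u1 : 0 < 1 + u by rewrite ltr_pwDl.
rewrite expRN (le_trans (_ : _ <= (1 + u)^-1))//.
  by rewrite lef_pV2 ?posrE ?expR_gt0// expR_ge1Dx.
rewrite -[_^-1]mul1r ler_pdivrMr//.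
rewrite (_ : _ * _ = 1 + u ^+ 3); last by ring.
by rewrite lerDl exprn_ge0.
Qed.

Lemma sum_natr n : 2 * \sum_(k < n) (k%:R : R) = n%:R * (n%:R - 1).
Proof.
elim: n => [|n IH]; first by rewrite big_ord0 mulr0 mul0r.
by rewrite big_ord_recr/= mulrDr IH -natr1; ring.
Qed.

Lemma le_limit_at0 D (f : R -> R) (e : R) : {for 0, continuous f} -> 0 < e ->
  (forall l, 0 < l < e -> D <= f l) -> D <= f 0.
Proof.
move=> fc e0 Df; rewrite leNgt; apply/negP => fD.
have [r /= r0 Hr] := cvgr_lt (f 0) fc _ fD.
pose l := Num.min (r / 2) (e / 2).
have l0 : 0 < l by rewrite lt_min !divr_gt0.
have lr : l < r by rewrite gt_min ltr_pdivrMr// ltr_pMr// ltr1n.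
have le : l < e.
  by rewrite gt_min; apply/orP; right; rewrite ltr_pdivrMr// ltr_pMr// ltr1n.
have : f l < D by apply: Hr; rewrite /ball_/= sub0r normrN gtr0_norm.
by rewrite ltNge Df// l0.
Qed.

Lemma heat_flow0 p : heat 0 p = p.
Proof. by apply/funext => x; rewrite heat0. Qed.

Lemma heat_flowD s t p : heat s (heat t p) = heat (s + t) p.
Proof. by apply/funext => x; rewrite (heatD QP). Qed.

(* The factor [1 - kappa h + O(h^2)] bounds the average of [expR (- 2 kappa s)]
   over [s] in [0, h]. *)
Definition contraction h := 1 - kappa * h + 4 * (kappa * h) ^+ 2.

Section Grid.
Context (G : R -> X -> R) (L : R) (L_ge0 : 0 <= L).
Context (GL : forall u v c, 0 <= u <= 1 -> 0 <= v <= 1 -> (v - u) ^+ 2 * L < c ->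
  exists rho psi, acurve 0 1 (G u) (G v) c rho psi).
Context (d h : R) (d_gt0 : 0 < d) (h_ge0 : 0 <= h).

Let node N k := heat (d + h * (k%:R / N%:R)) (G (k%:R / N%:R)).

(** A nearly optimal curve between consecutive samples is flowed for the time belonging to its left
    node, where the decay is taken; the flow time then grows by h/N along it, paid for in entropy.
    The positive d provides smoothing at k = 0 as well. *)
Lemma grid_step N k (eta : R) : (k < N)%N -> 0 < eta ->
  conn k%:R k.+1%:R (node N k) (node N k.+1)
    (expR (- (2 * kappa) * (d + h * (k%:R / N%:R))) * (L / N%:R ^+ 2 + eta)
     + 2 * (h / N%:R) * (H (node N k) - H (node N k.+1))).
Proof.
move=> kN eta0.
have N0 : 0 < N%:R :> R by rewrite ltr0n; exact: leq_ltn_trans kN.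
have Nn : N%:R != 0 :> R by rewrite gt_eqF.
have k01 (j : nat) : (j <= N)%N -> 0 <= (j%:R / N%:R : R) <= 1.
  by move=> jN; rewrite divr_ge0//= ler_pdivrMr// mul1r ler_nat.
have tau0 : 0 < d + h * (k%:R / N%:R).
  by rewrite ltr_pwDl// mulr_ge0// divr_ge0.
have [|rho [psi A]] := @GL (k%:R / N%:R) (k.+1%:R / N%:R) (L / N%:R ^+ 2 + eta)
    (k01 k (ltnW kN)) (k01 k.+1 kN).
  rewrite (_ : _ * L = L / N%:R ^+ 2); first by rewrite ltrDl.
  by rewrite -natr1; field.
have C := acurve_conn QP tau0 HC A.
have hN : 0 <= h / N%:R by rewrite divr_ge0.
have := conn_heat QP kappa_ge0 HC C hN (lexx 0).
rewrite subrr mulr0 heat_flow0 subr0 mulr1 heat_flowD.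
rewrite (_ : h / N%:R + _ = d + h * (k.+1%:R / N%:R)); last by rewrite -natr1; field.
move=> /(conn_scale QP (k%:R) ltr01); rewrite mulr0 add0r mulr1 divr1.
by rewrite addrC natr1.
Qed.

Lemma grid_conn N n (eta : R) : (n < N)%N -> 0 < eta ->
  conn 0 n.+1%:R (node N 0) (node N n.+1)
    ((\sum_(k < n.+1) expR (- (2 * kappa) * (d + h * (k%:R / N%:R)))) * (L / N%:R ^+ 2 + eta)
     + 2 * (h / N%:R) * (H (node N 0) - H (node N n.+1))).
Proof.
move=> + eta0; elim: n => [|n IH] nN.
  by rewrite big_ord1; exact: (@grid_step N 0 eta nN eta0).
have := conn_cat (IH (ltnW nN)) (grid_step nN eta0).
apply: conn_le; rewrite [in leRHS]big_ord_recr/= mulrDl.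
by rewrite le_eqVlt; apply/orP; left; apply/eqP; ring.
Qed.

(** The mean of k/N over k < N is (1 - 1/N)/2: hence kappa h in place of 2 kappa h, and the error
    term kappa h. The 4 comes from the square of 2 kappa h. *)
Lemma sum_contraction N : (0 < N)%N ->
  \sum_(k < N) expR (- (2 * kappa) * (d + h * (k%:R / N%:R))) <=
  N%:R * contraction h + kappa * h.
Proof.
move=> N0; have Nn : N%:R != 0 :> R by rewrite pnatr_eq0 -lt0n.
apply: le_trans (_ : \sum_(k < N) (1 + 4 * (kappa * h) ^+ 2 - 2 * kappa * h / N%:R * k%:R) <= _).
  apply: ler_sum => k _.
  have k0 : 0 <= k%:R / N%:R :> R by rewrite divr_ge0.
  have k1 : k%:R / N%:R <= 1 :> R by rewrite ler_pdivrMr ?ltr0n// mul1r ler_nat ltnW.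
  have u0 : 0 <= 2 * kappa * (h * (k%:R / N%:R)) by rewrite !mulr_ge0.
  apply: le_trans (_ : expR (- (2 * kappa * (h * (k%:R / N%:R)))) <= _).
    rewrite ler_expR mulNr lerN2 ler_wpM2l ?mulr_ge0//.
    by rewrite lerDr ltW.
  apply: le_trans (expRN_le_quadratic u0) _.
  rewrite [leRHS](_ : _ = 1 - 2 * kappa * (h * (k%:R / N%:R)) + 4 * (kappa * h) ^+ 2); last by field.
  rewrite lerD2l (_ : _ ^+ 2 = 4 * (kappa * h) ^+ 2 * (k%:R / N%:R) ^+ 2); last by ring.
  by rewrite ler_piMr ?mulr_ge0 ?sqr_ge0// expr_le1.
rewrite sumrB sumr_const card_ord -mulr_sumr -[_ *+ N]mulr_natl.
have -> : \sum_(k < N) (k%:R : R) = N%:R * (N%:R - 1) / 2.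
  by rewrite -sum_natr mulrC mulKf// pnatr_eq0.
by rewrite le_eqVlt; apply/orP; left; apply/eqP; rewrite /contraction; field.
Qed.

Lemma contraction_ge0 : 0 <= contraction h.
Proof.
rewrite /contraction; set k := kappa * h.
rewrite (_ : _ + _ = (2 * k - 4^-1) ^+ 2 + 15 / 16); last by field.
by rewrite addr_ge0 ?sqr_ge0// divr_ge0.
Qed.

Lemma flow_conn (eps : R) : 0 < eps ->
  conn 0 1 (heat d (G 0)) (heat (d + h) (G 1))
    (L * contraction h + eps + 2 * h * (H (heat d (G 0)) - H (heat (d + h) (G 1)))).
Proof.
move=> eps0; set m : R := contraction h; have m0 : 0 <= m := contraction_ge0.
have kh0 : 0 <= kappa * h by rewrite mulr_ge0.
(* Rescaling time to [0, 1] multiplies the action by N. This N makes the resulting error L kappa h /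
   N at most eps/2. *)
pose N := (Num.truncn (L * (kappa * h) / (eps / 2))).+1.
have N0 : 0 < N%:R :> R by rewrite ltr0n.
have Nn : N%:R != 0 :> R by rewrite gt_eqF.
have NL : L * (kappa * h) / N%:R <= eps / 2.
  rewrite ler_pdivrMr// -ler_pdivrMl ?divr_gt0// [leLHS]mulrC.
  exact/ltW/truncnS_gt.
(* The slack eta of each step is multiplied in total by N^2 m + N kappa h; the added 1 keeps the
   divisor positive. *)
pose B := N%:R ^+ 2 * m + N%:R * (kappa * h) + 1.
have B0 : 0 < B by rewrite ltr_wpDl// addr_ge0 ?mulr_ge0// exprn_ge0// ltW.
pose eta := eps / 2 / B; have eta0 : 0 < eta by rewrite !divr_gt0.
have etaB : eta * (N%:R ^+ 2 * m + N%:R * (kappa * h)) <= eps / 2.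
  rewrite -[leRHS](divfK (_ : B != 0)); last by rewrite gt_eqF.
  by rewrite ler_wpM2l ?(ltW eta0)// /B lerDl.
have := grid_conn (leqnn N) eta0.
have Ni : 0 < N%:R^-1 :> R by rewrite invr_gt0.
move=> /(conn_scale QP 0 Ni); rewrite mulr0 !addr0 mulVf//.
rewrite /node mul0r mulr0 addr0 divff// mulr1.
apply: conn_le; rewrite invrK mulrDl.
set HH := H _ - H _.
rewrite (_ : 2 * (h / N%:R) * HH * N%:R = 2 * h * HH); last by field.
rewrite lerD2r mulrAC.
have := sum_contraction (ltn0Sn _ : (0 < N)%N); set S := \sum_(_ < _) _ => hS.
have LN0 : 0 <= L / N%:R ^+ 2 + eta by rewrite addr_ge0 ?(ltW eta0)// divr_ge0// exprn_ge0// ltW.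
apply: le_trans (_ : (N%:R * m + kappa * h) * N%:R * (L / N%:R ^+ 2 + eta) <= _).
  by rewrite ler_wpM2r// ler_wpM2r// ltW.
rewrite (_ : _ * (_ + eta) = L * m + (L * (kappa * h) / N%:R
   + eta * (N%:R ^+ 2 * m + N%:R * (kappa * h)))); last by field.
by rewrite lerD2l; lra.
Qed.

End Grid.

Section Geodesic.
Context (G : R -> X -> R) (D : R) (D_ge0 : 0 <= D).
Context (GD : forall u, 0 <= u <= 1 -> density pi (G u)).
Context (GL : forall u v c, 0 <= u <= 1 -> 0 <= v <= 1 -> (v - u) ^+ 2 * D < c ->
  exists rho psi, acurve 0 1 (G u) (G v) c rho psi).
Context (GW : (W Q pi (G 0) (G 1) ^+ 2)%E = D%:E).
Context (t : R) (t_gt0 : 0 < t) (t_lt1 : t < 1).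

Let B := t^-1 + (1 - t)^-1.
Let A := H (G 0) / t + H (G 1) / (1 - t).

(** The end intervals of length l carry the heat flow from and to the ends of the geodesic. The two
    flowed halves have squared lengths t^2 D and (1 - t)^2 D and take times (1 - 2 l) t and (1 - 2
    l)(1 - t), so D is recovered up to 1/(1 - 2 l). *)
Lemma two_sided_bound h l : 0 <= h -> 0 < l < 2^-1 ->
  D <= l * (H (G 0) + H (G 1)) +
    (D * contraction h + 2 * h * (A - B * H (heat (l ^+ 2 + h) (G t))) + l) / (1 - 2 * l).
Proof.
(* With flow time l^2 in parameter time l, the end pieces cost l times an entropy drop, which
   vanishes as l tends to 0. *)
move=> h0 /andP[l0 l1]; pose d := l ^+ 2; have d0 : 0 < d by rewrite exprn_gt0.
have t1 : 0 < 1 - t by rewrite subr_gt0.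
have [tn t1n] : t != 0 /\ 1 - t != 0 by rewrite !gt_eqF.
(* Divided by t and by 1 - t, this error contributes l (1 - t) + l t = l. *)
have eps0 : 0 < l * t * (1 - t) by rewrite !mulr_gt0.
have w1 u : 0 <= u <= 1 -> 0 <= t * u <= 1.
  by move=> /andP[u0 u1]; rewrite mulr_ge0 ?(ltW t_gt0)//= mulr_ile1 ?(ltW t_gt0)// ltW.
have w2 u : 0 <= u <= 1 -> 0 <= 1 - (1 - t) * u <= 1.
  move=> /andP[u0 u1]; rewrite subr_ge0 mulr_ile1 ?(ltW t1)//=.
    by rewrite gerBl mulr_ge0// ltW.
  by rewrite gerBl ltW.
have hc1 u v c : (v - u) ^+ 2 * (t ^+ 2 * D) < c -> (t * v - t * u) ^+ 2 * D < c.
  by apply: le_lt_trans; rewrite le_eqVlt; apply/orP; left; apply/eqP; ring.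
have hc2 u v c : (v - u) ^+ 2 * ((1 - t) ^+ 2 * D) < c ->
    ((1 - (1 - t) * v) - (1 - (1 - t) * u)) ^+ 2 * D < c.
  by apply: le_lt_trans; rewrite le_eqVlt; apply/orP; left; apply/eqP; ring.
have C1 := @flow_conn (fun u => G (t * u)) (t ^+ 2 * D) (mulr_ge0 (sqr_ge0 t) D_ge0)
  (fun u v c hu hv hc => GL (w1 u hu) (w1 v hv) (hc1 _ _ _ hc))
  d h d0 h0 _ eps0.
have C2 := @flow_conn (fun u => G (1 - (1 - t) * u)) ((1 - t) ^+ 2 * D)
  (mulr_ge0 (sqr_ge0 (1 - t)) D_ge0)
  (fun u v c hu hv hc => GL (w2 u hu) (w2 v hv) (hc2 _ _ _ hc)) d h d0 h0 _ eps0.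
rewrite /= mulr0 mulr1 in C1.
rewrite /= mulr0 mulr1 subr0 subKr in C2.
set a0 := H (heat d (G 0)) in C1; set a1 := H (heat d (G 1)) in C2.
set b := H (heat (d + h) (G t)) in C1 C2; set m : R := contraction h in C1 C2.
have I0 : 0 <= (0 : R) <= 1 by rewrite lexx ler01.
have I1 : 0 <= (1 : R) <= 1 by rewrite lexx ler01.
have a0_ge0 : 0 <= a0 by apply: (entropy_ge0 QP); apply: (heat_density QP (ltW d0)); exact: GD.
have a1_ge0 : 0 <= a1 by apply: (entropy_ge0 QP); apply: (heat_density QP (ltW d0)); exact: GD.
have a0_le : a0 <= H (G 0).
  by rewrite -[G 0 in leRHS]heat_flow0; apply: (entropy_heat_le QP (GD I0)); rewrite lexx ltW.
have a1_le : a1 <= H (G 1).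
  by rewrite -[G 1 in leRHS]heat_flow0; apply: (entropy_heat_le QP (GD I1)); rewrite lexx ltW.
have k0 : 0 < 1 - 2 * l by rewrite subr_gt0 mulrC -ltr_pdivlMr// mul1r.
have kn : 1 - 2 * l != 0 by rewrite gt_eqF.
have k1_gt0 : 0 < (1 - 2 * l) * t by rewrite mulr_gt0.
have k2_gt0 : 0 < (1 - 2 * l) * (1 - t) by rewrite mulr_gt0.
have {}C1 := conn_scale QP l k1_gt0 C1.
have {}C2 := conn_scale QP (1 - l) k2_gt0 (conn_rev QP C2).
rewrite mulr0 add0r mulr1 in C1.
rewrite (_ : _ * - 1 + _ = (1 - 2 * l) * t + l) ?oppr0 ?mulr0 ?add0r in C2; last by ring.
have [r2 [s2 A2]] := conn_acurve QP (conn_cat C1 C2).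
have ll : 1 - l < 1 by rewrite ltrBlDr ltrDl.
have [r1 [s1 A1]] := heat_acurve_start QP l0 d0 (GD I0).
have [r3 [s3 A3]] := heat_acurve_end QP ll d0 (GD I1).
have := W_sqr_le QP (acurve_glue QP (acurve_glue QP A1 A2) A3).
rewrite GW lee_fin => /le_trans; apply.
rewrite -/a0 -/a1 subr0 subKr.
have dl : d / l = l by rewrite /d expr2 mulfK// gt_eqF.
rewrite dl -subr_ge0.
rewrite (_ : _ - _ = l * (a0 + a1)
  + 2 * h / (1 - 2 * l) * ((H (G 0) - a0) / t + (H (G 1) - a1) / (1 - t))); last first.
  by rewrite /A /B -/d -/b -/m; field; rewrite tn t1n kn.
have pos u v : 0 <= u -> 0 < v -> 0 <= u / v by move=> u0 /ltW v0; rewrite divr_ge0.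
rewrite addr_ge0 ?mulr_ge0 ?addr_ge0 ?pos ?subr_ge0 ?(ltW l0)//.
by rewrite invr_ge0 ltW.
Qed.

(** First l tends to 0 at fixed h; then D cancels on both sides and h can be divided out. *)
Lemma curvature_bound h : 0 < h ->
  D * (kappa - 4 * kappa ^+ 2 * h) <= 2 * (A - B * H (heat h (G t))).
Proof.
move=> h0.
pose f l := l * (H (G 0) + H (G 1)) +
  (D * contraction h + 2 * h * (A - B * H (heat (l ^+ 2 + h) (G t))) + l) / (1 - 2 * l).
have fc : {for 0, continuous f}.
  have c2 : {for 0, continuous (fun l : R => l ^+ 2 + h)}.
    by apply: cvgD; [exact: exprn_continuous|exact: cvg_cst].
  have cH : {for 0, continuous (fun l => H (heat (l ^+ 2 + h) (G t)))}.
    apply: (continuous_comp (f := fun l => l ^+ 2 + h) (g := fun s => H (heat s (G t)))) => //.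
    exact: (continuous_entropy_heat QP).
  apply: cvgD; first by apply: cvgM; [exact: cvg_id|exact: cvg_cst].
  apply: cvgM.
    apply: cvgD; last exact: cvg_id.
    apply: cvgD; first exact: cvg_cst.
    apply: cvgM; first exact: cvg_cst.
    apply: cvgB; first exact: cvg_cst.
    by apply: cvgM; [exact: cvg_cst|].
  apply: cvgV; first by rewrite mulr0 subr0.
  apply: cvgB; first exact: cvg_cst.
  by apply: cvgM; [exact: cvg_cst|exact: cvg_id].
have e0 : 0 < 2^-1 :> R by rewrite invr_gt0.
have := le_limit_at0 fc e0 (fun l hl => two_sided_bound (ltW h0) hl).
rewrite /f expr0n/= add0r mul0r mulr0 subr0 divr1 add0r addr0 /contraction => HD.
rewrite -(ler_pM2l h0) -subr_ge0.
by rewrite -subr_ge0 in HD; apply: le_trans HD _; rewrite le_eqVlt; apply/orP; left; apply/eqP; ring.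
Qed.

(** The limit h to 0, by continuity of the entropy along the flow, followed by multiplication with t
    (1 - t)/2, where B = 1/(t (1 - t)). *)
Lemma geodesic_entropy :
  H (G t) <= (1 - t) * H (G 0) + t * H (G 1) - kappa / 2 * t * (1 - t) * D.
Proof.
have t1 : 0 < 1 - t by rewrite subr_gt0.
have [tn t1n] : t != 0 /\ 1 - t != 0 by rewrite !gt_eqF.
pose f h := 2 * (A - B * H (heat h (G t))) + 4 * kappa ^+ 2 * h * D.
have fc : {for 0, continuous f}.
  apply: cvgD; last first.
    apply: cvgM; last exact: cvg_cst.
    by apply: cvgM; [exact: cvg_cst|exact: cvg_id].
  apply: cvgM; first exact: cvg_cst.
  apply: cvgB; first exact: cvg_cst.
  by apply: cvgM; [exact: cvg_cst|exact: (continuous_entropy_heat QP)].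
have hf h : 0 < h < 1 -> D * kappa <= f h.
  move=> /andP[h0 _]; have := curvature_bound h0; rewrite mulrBr lerBlDr /f.
  by rewrite [D * (_ * h)]mulrC.
have := le_limit_at0 fc ltr01 hf.
rewrite /f heat_flow0 mulr0 mul0r addr0 => h.
have t2 : 0 < t * (1 - t) / 2 by rewrite divr_gt0 ?mulr_gt0.
rewrite -(ler_pM2l t2) -subr_ge0 in h; rewrite -subr_ge0.
apply: le_trans h _; rewrite le_eqVlt; apply/orP; left; apply/eqP.
by rewrite /A /B; field; rewrite tn t1n.
Qed.

End Geodesic.

Theorem ricci_ge : Ric_ge Q pi kappa.
Proof.
move=> G [GD GW] t t01.
have I0 : (0 : R) \in `[0, 1] by rewrite in_itv/= lexx ler01.
have I1 : (1 : R) \in `[0, 1] by rewrite in_itv/= lexx ler01.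
(* Finiteness of the distance brings the extended-real inequality back to real numbers. *)
have [w w0 Ew] := W_fin QP (GD _ I0) (GD _ I1).
rewrite Ew -EFin_expe -EFinM -EFinB lee_fin.
move: t01; rewrite in_itv/= => /andP[]; rewrite le_eqVlt => /predU1P[<- _|t0].
  by rewrite mulr0 !mul0r !subr0 mul1r addr0.
rewrite le_eqVlt => /predU1P[->|t1].
  by rewrite subrr mulr0 !mul0r mul1r add0r subr0.
apply: (geodesic_entropy (D := w ^+ 2)) => //.
- exact: sqr_ge0.
- move=> u v c hu hv hc; apply: (W_sqr_lt QP); rewrite GW ?in_itv//= Ew.
  rewrite -!EFinM lte_fin -expr2 exprMn; apply: le_lt_trans hc.
  by rewrite real_normK ?num_real// -sqrrN opprB.
- by rewrite Ew EFin_expe.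
Qed.

End RicciLowerBound.

Theorem theorem4p5 (R : realType) (T : finType) (A : {fset config T})
    (nu : T -> R)
    (A_decreasing : decreasing A)
    (A_nonzero : exists x i, x \in A /\ (0 < x i)%N)
    (nu_gt0 : forall i, 0 < nu i)
    (eps0_le1 : eps0 A nu <= 1) :
  Ric_ge (@rate R T A nu) (@stat_measure R T A nu)
    (2^-1 * (1 - eps0 A nu + eps1 A nu)).
Proof.
(* The minimum is attained, so [eps1] is one of the nonnegative terms; with [eps0 A nu <= 1] this
   gives a nonnegative curvature constant. *)
have [[x [i [_ _ e1]]] _] := eps1_min nu A_nonzero.
apply: (ricci_ge (rate_reversible_chain A_decreasing A_nonzero nu_gt0)).
  rewrite mulr_ge0 ?invr_ge0// addr_ge0 ?subr_ge0// e1 /eps1_term.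
  by rewrite mulr_ge0// ltW.
exact: (curvature_rate A_decreasing A_nonzero nu_gt0 eps0_le1).
Qed.
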